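(* Let $T>0$, $\alpha>\frac13$, and let $\zeta\in\mathcal C^{\alpha}([0,T];\mathbb R^d)$ be a path with $\zeta_0=0$ admitting a Lévy area $\zeta^2$ as described in the context. Let $\mathcal K\subset\mathcal P_2(U)$ be compact, let $\varepsilon,L>0$ and let $\gamma\in\mathcal V^{\varepsilon,L}$, i.e. $\gamma:[0,T]\to\mathcal K$ with $W_2(\gamma_s,\gamma_t)\le L|t-s|^\varepsilon$ for all $s,t$. Assume $b\in\mathcal C_b^{0,1,1}([0,T]\times\mathbb R^m\times U;\mathbb R^m)$ with $b(u,x,a)$ uniformly continuous in $u$, and $\sigma\in\mathcal C_b^{1,3}([0,T]\times\mathbb R^m;\mathbb R^{m,d})$. Let $y\in\mathbb R^m$. Then for every $\kappa\in(\frac13,\alpha)$ there exists a unique $x\in\mathcal Q_\zeta^\kappa([0,T];\mathbb R^m)$ which solves $$x_t=y+\int_0^t\int_U b(s,x_s,a)\,\gamma_s(da)\,ds+\int_0^t\sigma(s,x_s)\,d\zeta_s,\qquad t\in[0,T],$$ where the last integral is a rough integral of a weakly controlled path.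
   Context: Notation: $\delta f_{st}=f_t-f_s$ for paths, $\delta h_{sut}=h_{st}-h_{su}-h_{ut}$ for two-parameter functions. $\mathcal C_1^\mu(V)$: $\mu$-Hölder $V$-valued paths; $\mathcal C_2^\mu(V)$: continuous functions $h_{st}$, $s\le t$, vanishing for $s=t$, with $\sup|h_{st}|/|t-s|^\mu<\infty$. Repeated indices are summed. $\mathcal C_b^{k,l}$: functions $f(t,x)$ for which $\partial_t^i\partial_x^\beta f$ exist, are continuous and bounded for $i\le k$, $|\beta|\le l$. $b\in\mathcal C_b^{0,1,1}$: $b(t,x,a)$ is bounded and continuous, and has bounded continuous first derivatives in $x$ and in $a$; in particular $a\mapsto b(t,x,a)$ is Lipschitz for the metric $d$ of $U$, uniformly in $(t,x)$. ''Uniformly continuous in $u$'' means: for each $x$, $\sup_{a\in U}|b(u_2,x,a)-b(u_1,x,a)|\to0$ as $|u_2-u_1|\to 0$. Assumption on $\zeta$: $\zeta\in\mathcal C_1^\alpha(\mathbb R^d)$, $\alpha>1/3$, $\zeta_0=0$, and there is $\zeta^2\in\mathcal C_2^{2\alpha}(\mathbb R^{d,d})$ with $\delta\zeta^{2;ij}_{sut}=\delta\zeta^i_{su}\,\delta\zeta^j_{ut}$ and $\zeta^{2;ij}_{st}+\zeta^{2;ji}_{st}=\delta\zeta^i_{st}\,\delta\zeta^j_{st}$. Weakly controlled paths: for $\kappa\le\alpha$, $2\kappa+\alpha>1$, $\mathcal Q_\zeta^\kappa([0,T];\mathbb R^n)$ is the set of $z\in\mathcal C_1^\kappa(\mathbb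 R^n)$ (pairs $(z,z^\zeta)$) with $\delta z^i_{st}=z_s^{\zeta;ii_1}\delta\zeta^{i_1}_{st}+\rho^i_{st}$, $z^\zeta\in\mathcal C_1^\kappa(\mathbb R^{n,d})$, $\rho\in\mathcal C_2^{2\kappa}(\mathbb R^n)$. Rough integral: $\int_s^t\mu_u^i\,d\zeta_u^i=\lim\sum_q\big[\mu^i_{t_q}\delta\zeta^i_{t_qt_{q+1}}+\mu^{\zeta;ii_1}_{t_q}\zeta^{2;i_1i}_{t_qt_{q+1}}\big]$ over partitions of $[s,t]$ with mesh tending to $0$. The path $(\sigma^{ik}(s,x_s))_k$ is regarded as weakly controlled with derivative $\partial_{x_j}\sigma^{ik}(s,x_s)x_s^{\zeta;jl}$. Control space: $U\subseteq\mathbb R^k$ is equipped with a metric $d$; $\mathcal P_2(U)$ is the set of Borel probability measures on $U$ with finite second moments, with the Wasserstein-2 metric $W_2(m_1,m_2)=\inf_{m\in\Gamma(m_1,m_2)}\big(\int\int d^2(x,y)\,dm(x,y)\big)^{1/2}$, where $\Gamma(m_1,m_2)$ is the set of couplings of $m_1$ and $m_2$.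
   Formalization: Adds κ ≤ 1/2: for κ > 1/2 the claim fails (ζ=0, ζ²=0, σ=0, b a nonzero constant gives remainder b(t−s), not of order 2κ). The equation is read as an identity of pairs, so a solution has derivative x^ζ_t = σ(t,x_t). *)

(* Defs.v *)
From HB Require Import structures.
From mathcomp Require Import all_boot all_order all_algebra.
From mathcomp Require Import all_classical all_reals all_analysis.

Set Implicit Arguments.
Unset Strict Implicit.
Unset Printing Implicit Defensive.

Import Order.TTheory GRing.Theory Num.Theory.
Import numFieldNormedType.Exports.

Local Open Scope classical_set_scope.
Local Open Scope ring_scope.

(* Conventions. Vectors of R^n are columns 'cV[R]_n; the norm of matrices is
   the (equivalent) max norm of the library. Functions of time are total
   functions on R of which only the values on [0, T] matter: every condition
   below is restricted to [0, T]. *)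

Section hoelder_spaces.
Context {R : realType} (V : normedModType R).
Implicit Types (T mu : R).

Definition hoelder1 T mu (f : R -> V) : Prop :=
  exists C : R, forall s t, 0 <= s <= T -> 0 <= t <= T ->
    `|f t - f s| <= C * `|t - s| `^ mu.

Definition hoelder2 T mu (h : R -> R -> V) : Prop :=
  [/\ {within [set p : R * R | 0 <= p.1 /\ p.1 <= p.2 /\ p.2 <= T],
         continuous (fun p => h p.1 p.2)},
      (forall t, 0 <= t <= T -> h t t = 0) &
      exists C : R, forall s t, 0 <= s -> s <= t -> t <= T ->
        `|h s t| <= C * `|t - s| `^ mu].

End hoelder_spaces.

Section rough_paths.
Context {R : realType} {d : nat}.
Implicit Types (T alpha kappa : R) (zeta : R -> 'cV[R]_d).

Definition levy_area T alpha zeta (zeta2 : R -> R -> 'M[R]_d) : Prop :=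
  [/\ hoelder2 T (2 * alpha) zeta2,
      (forall s u t, 0 <= s -> s <= u -> u <= t -> t <= T -> forall i j,
         zeta2 s t i j - zeta2 s u i j - zeta2 u t i j =
         (zeta u - zeta s) i 0 * (zeta t - zeta u) j 0) &
      (forall s t, 0 <= s -> s <= t -> t <= T -> forall i j,
         zeta2 s t i j + zeta2 s t j i =
         (zeta t - zeta s) i 0 * (zeta t - zeta s) j 0)].

(* The pair (z, z') is in Q^kappa_zeta([0, T]; R^n), z' being z^zeta. *)
Definition controlled T kappa zeta n (z : R -> 'cV[R]_n)
    (z' : R -> 'M[R]_(n, d)) : Prop :=
  [/\ hoelder1 T kappa z,
      hoelder1 T kappa z' &
      hoelder2 T (2 * kappa)
        (fun s t => (z t - z s) - z' s *m (zeta t - zeta s))].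

(* Filter of the partitions t_0 = s < t_1 < ... of [s, t], represented by
   [:: t_1; t_2; ...], as their mesh tends to 0. *)
Definition mesh_to0 (s t : R) : set_system (seq R) :=
  filter_from [set e : R | 0 < e] (fun e => [set p : seq R |
    itv_partition s t p /\
    forall q, (q < size p)%N -> (s :: p)`_q.+1 - (s :: p)`_q < e]).

Definition rough_sum zeta (zeta2 : R -> R -> 'M[R]_d) (mu : R -> 'cV[R]_d) (mu' : R -> 'M[R]_d)
    (s : R) (p : seq R) : R :=
  \sum_(q < size p)
    (let u := (s :: p)`_q in let v := (s :: p)`_q.+1 in
     \sum_(i < d) mu u i 0 * (zeta v - zeta u) i 0 +
     \sum_(i < d) \sum_(j < d) mu' u i j * zeta2 u v j i).

(* The integral of mu d zeta over [s, t] exists and equals v. *)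
Definition is_rough_integral zeta (zeta2 : R -> R -> 'M[R]_d)
    (mu : R -> 'cV[R]_d)
    (mu' : R -> 'M[R]_d) (s t v : R) : Prop :=
  rough_sum zeta zeta2 mu mu' s p @[p --> mesh_to0 s t] --> v.

End rough_paths.

Section smooth_functions.
Context {R : realType} {m : nat} {V : normedModType R}.
Implicit Types (T : R) (f : R -> 'cV[R]_m -> V).

Definition bounded_continuous (X : topologicalType) (A : set X) (f : X -> V) :=
  {within A, continuous f} /\ [bounded f p | p in A].

Definition basis_vec (j : 'I_m) : 'cV[R]_m := delta_mx j 0.

Definition partial_x (j : 'I_m) f : R -> 'cV[R]_m -> V :=
  fun t x => 'D_(basis_vec j) (f t) x.

(* Time derivatives are one-sided at 0 and T. *)
Definition near_time T (t : R) : set_system R :=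
  within [set h | 0 <= t + h <= T] 0^'.

Definition quotient_t f (t : R) (x : 'cV[R]_m) (h : R) : V :=
  h^-1 *: (f (t + h) x - f t x).

Definition partial_t T f : R -> 'cV[R]_m -> V :=
  fun t x => lim (quotient_t f t x h @[h --> near_time T t]).

Definition x_derivable T (j : 'I_m) f :=
  forall t x, 0 <= t <= T -> derivable (f t) x (basis_vec j).

Definition t_derivable T f :=
  forall t x, 0 <= t <= T -> cvg (quotient_t f t x h @[h --> near_time T t]).

Fixpoint Cb_t T (k : nat) f : Prop :=
  bounded_continuous [set p : R * 'cV[R]_m | 0 <= p.1 <= T]
    (fun p => f p.1 p.2) /\
  if k is k'.+1 then t_derivable T f /\ Cb_t T k' (partial_t T f) else True.

(* C_b^{k,l}([0, T] x R^m; V). *)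
Fixpoint Cb T (k l : nat) f : Prop :=
  Cb_t T k f /\
  if l is l'.+1 then
    forall j, x_derivable T j f /\ Cb T k l' (partial_x j f)
  else True.

End smooth_functions.

Record is_distance (R : realType) (X : Type) (dist : X -> X -> R) : Prop := {
  dist_xx : forall x, dist x x = 0;
  dist_positivity : forall x y, dist x y = 0 -> x = y;
  dist_sym : forall x y, dist x y = dist y x;
  dist_triangle : forall y x z, dist x z <= dist x y + dist y z }.

(* A subset of R^k with a metric. Nonemptiness is required by measurableType;
   it is harmless, since a Borel probability measure cannot live on an empty
   space. *)
Record control_space (R : realType) (k : nat) := ControlSpace {
  control_set : set 'cV[R]_k;
  control_dist : control_set -> control_set -> R;
  control_distP : is_distance control_dist;
  control_neq0 : control_set !=set0 }.

(* An alias of the subset, so that its topology is that of the given metric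
   and not the one induced by R^k. *)
Definition control_point (R : realType) (k : nat) (U : control_space R k) :=
  set_type (control_set U).

Section control_space_instances.
Context {R : realType} {k : nat} (U : control_space R k).

Let control_default : control_point U :=
  let: exist a Ua := cid (control_neq0 U) in exist _ a (mem_set Ua).

HB.instance Definition _ := Choice.on (control_point U).
HB.instance Definition _ := isPointed.Build (control_point U) control_default.
HB.instance Definition _ := isMetric.Build R (control_point U)
  (dist_xx (control_distP U)) (@dist_positivity _ _ _ (control_distP U))
  (dist_sym (control_distP U)) (dist_triangle (control_distP U)).

End control_space_instances.

Coercion control_point : control_space >-> Sortclass.

(* U with its Borel sigma-algebra. *)
Definition borel (R : realType) (k : nat) (U : control_space R k) :=
  g_sigma_algebraType (@open U).
HB.instance Definition _ (R : realType) (k : nat) (U : control_space R k) :=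
  Measurable.on (borel U).

Section wasserstein.
Context {R : realType} {k : nat} {U : control_space R k}.
Local Open Scope ereal_scope.

Definition finite_second_moment (mu : probability (borel U) R) : Prop :=
  exists a0 : U, \int[mu]_a ((mdist a0 (a : U)) ^+ 2)%:E < +oo.

Definition coupling (m1 m2 : probability (borel U) R)
    (m : probability (borel U * borel U)%type R) : Prop :=
  forall A : set (borel U), measurable A ->
    m (fst @^-1` A) = m1 A /\ m (snd @^-1` A) = m2 A.

Definition W2 (m1 m2 : probability (borel U) R) : \bar R :=
  ereal_inf [set (\int[m]_z ((mdist (z.1 : U) (z.2 : U)) ^+ 2)%:E) `^ 2^-1
            | m in coupling m1 m2].

End wasserstein.

Section wasserstein_space.
Context {R : realType} {k : nat}.

Record P2 (U : control_space R k) := MkP2 {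
  P2_measure :> probability (borel U) R;
  P2_moment : finite_second_moment P2_measure }.

Context (U : control_space R k).

HB.instance Definition _ := gen_eqMixin (P2 U).
HB.instance Definition _ := gen_choiceMixin (P2 U).

(* P2 U carries the topology generated by the open W2-balls. Since W2 is a
   metric, this is its metric topology. *)
Definition W2_ball (c : option (P2 U * R)) : set (P2 U) :=
  if c is Some (mu, r) then [set nu | (W2 mu nu < r%:E)%E] else setT.

HB.instance Definition _ := isSubBaseTopological.Build (P2 U) setT W2_ball.

(* The class V^{eps,L} of relaxed controls with values in K. *)
Definition relaxed_control (T : R) (K : set (P2 U)) (eps L : R)
    (gamma : R -> P2 U) : Prop :=
  (forall t, 0 <= t <= T -> K (gamma t)) /\
  (forall s t, 0 <= s <= T -> 0 <= t <= T ->
    (W2 (gamma s) (gamma t) <= (L * `|t - s| `^ eps)%:E)%E).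

End wasserstein_space.

Section drift_functions.
Context {R : realType} {k m n : nat} {U : control_space R k}.
Implicit Types (T : R) (b : R -> 'cV[R]_m -> U -> 'cV[R]_n).

(* Differential in a along U (with respect to R^k); for U open this is the
   usual one. *)
Definition is_differential_a T b (Db : R -> 'cV[R]_m -> U -> 'M[R]_(n, k)) :=
  forall t x (a : U), 0 <= t <= T -> forall e : R, 0 < e ->
    exists2 r : R, 0 < r & forall a' : U, `|val a' - val a| < r ->
      `|b t x a' - b t x a - Db t x a *m (val a' - val a)|
        <= e * `|val a' - val a|.

(* C_b^{0,1,1}([0, T] x R^m x U; R^n). The Lipschitz condition in a is part of
   the class, since the metric of U is not the one induced by R^k. *)
Definition Cb011 T b : Prop :=
  let D := [set z : R * 'cV[R]_m * U | 0 <= z.1.1 <= T] in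
  [/\ bounded_continuous D (fun z => b z.1.1 z.1.2 z.2),
      (forall j : 'I_m,
         (forall t x a, 0 <= t <= T -> derivable (b t ^~ a) x (basis_vec j)) /\
         bounded_continuous D
           (fun z => 'D_(basis_vec j) (b z.1.1 ^~ z.2) z.1.2)),
      (exists Db, is_differential_a T b Db /\
         bounded_continuous D (fun z => Db z.1.1 z.1.2 z.2)) &
      exists C : R, forall t x (a a' : U), 0 <= t <= T ->
        `|b t x a' - b t x a| <= C * mdist a a'].

Definition unif_continuous_time T b : Prop :=
  forall x (e : R), 0 < e -> exists2 r : R, 0 < r &
    forall u1 u2, 0 <= u1 <= T -> 0 <= u2 <= T -> `|u2 - u1| < r ->
      forall a, `|b u2 x a - b u1 x a| <= e.

End drift_functions.

Section rough_equation.
Context {R : realType} {d k m : nat} {U : control_space R k}.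
Variables (T : R) (zeta : R -> 'cV[R]_d) (zeta2 : R -> R -> 'M[R]_d).
Variables (gamma : R -> P2 U).
Variables (b : R -> 'cV[R]_m -> U -> 'cV[R]_m)
  (sigma : R -> 'cV[R]_m -> 'M[R]_(m, d)).
Implicit Type x : R -> 'cV[R]_m.

(* The controlled path (sigma^{ik}(s, x_s))_k and its derivative. *)
Definition sigma_path x (i : 'I_m) (s : R) : 'cV[R]_d :=
  \col_(l < d) sigma s (x s) i l.

Definition sigma_path' x (x' : R -> 'M[R]_(m, d)) (i : 'I_m) (s : R) : 'M[R]_d :=
  \matrix_(l < d, q < d)
    \sum_(j < m) partial_x j sigma s (x s) i l * x' s j q.

Definition drift x (t : R) : 'cV[R]_m :=
  \col_(i < m) (\int[@lebesgue_measure R]_(s in `[0, t])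
    (\int[gamma s]_(a in [set: borel U]) b s (x s) a i 0)).

(* The equation is an identity between weakly controlled paths, that is between
   pairs: the derivative of the right-hand side, a rough integral plus a drift,
   is the integrand sigma(t, x_t). *)
Definition solves (y : 'cV[R]_m) x (x' : R -> 'M[R]_(m, d)) : Prop :=
  forall t, 0 <= t <= T ->
    (exists I : 'cV[R]_m,
       (forall i, is_rough_integral zeta zeta2
                    (sigma_path x i) (sigma_path' x x' i) 0 t (I i 0)) /\
       x t = y + drift x t + I) /\
    x' t = sigma t (x t).

End rough_equation.

(* Main.v *)
Require Import Defs.
From mathcomp Require Import all_boot all_order all_algebra.
From mathcomp Require Import all_classical all_reals all_analysis.
From mathcomp Require Import measurable_realfun ring lra zify.

(** The equation is understood through a local expansion, in the manner of Davie.
Write B(s, p) for the integral of b(s, p, a) against gamma_s(da), G_t for the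
integral of B(s, x_s) over [0, t], k for kappa, and
   A_st(p) = sigma(s, p) (zeta_t - zeta_s) + ((sigma . D) sigma)(s, p) zeta2_st.
A path x is a controlled solution with derivative sigma(t, x_t) if and only if
x_0 = y and
   x_t - x_s = G_t - G_s + A_st(x_s) + O(|t - s|^(3 k)),      3 k > 1.      (E)
The key is that the defect A_st(p) - A_su(p) - A_ut(q) is O(|t - s|^(3 k)) when
q - p agrees with sigma(s, p) (zeta_u - zeta_s) up to order 2 k: Chen's relation
cancels the quadratic terms, and Taylor remainders of sigma are left. Moreover the
difference of the defects of two pairs of points at distance V is
O(V |t - s|^(3 k)), which is where three derivatives of sigma are used
([davie_step_germ]). Then the sums defining the rough integral are almost
additive, and comparing dyadic partitions shows that a controlled solution
satisfies (E) ([davie_of_solution]); conversely, summing (E) over a partition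
makes these sums converge ([sewn_of_expansion]).

Uniqueness ([davie_unique]). Let V bound the distance of two solutions of (E)
on a short interval on which they start from the same point, and let E V bound
the difference of their remainders relative to |t - s|^(3 k). Splitting at midpoints
replaces E by 2^(1 - 3 k) E + const, because halving an interval divides its
3 k-th power by more than 2. So for E large both bounds shrink by a factor
mu < 1, and iteration gives V = 0.

Existence ([davie_exists]). For the Euler scheme that replaces (E) by an equality on
each step of a uniform grid, the same halving argument, by induction on the
number of steps, bounds the remainders between any two grid points by
N |t - s|^(3 k), uniformly in the grid ([euler_rem_bound]). Hence the polygons
are bounded and uniformly Hoelder, and their limit along an ultrafilter of grids
satisfies (E) with some Lipschitz drift G. As B is continuous, the drift of the
scheme has increments close to (t - s) B(s, x_s) near s, so that G has derivative
B(s, x_s) and is the required integral.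

The properties of B used here come from those of b: it is bounded and Lipschitz
in p, and it is continuous in s because b is uniformly continuous in time, while the
integral of a function Lipschitz in the control is Lipschitz in the measure for
W2, and gamma is Hoelder ([W2_Rintegral_le], [mean_drift_time_continuous]). *)

Set Implicit Arguments.
Unset Strict Implicit.
Unset Printing Implicit Defensive.

Import Order.TTheory GRing.Theory Num.Theory.
Import numFieldNormedType.Exports.

Local Open Scope classical_set_scope.
Local Open Scope ring_scope.

(** * Coordinates and mean value inequalities *)

Section coordinates.
Context {R : realType}.

Lemma coord_le_norm m n (v : 'M[R]_(m, n)) i j : `|v i j| <= `|v|.
Proof.
rewrite [leRHS]/Num.norm/= mx_normrE.
exact: (@le_bigmax _ _ _ 0 (fun ij => `|v ij.1 ij.2|) (i, j)).
Qed.

Lemma norm_le_coord m n (v : 'M[R]_(m, n)) (c : R) : 0 <= c ->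
  (forall i j, `|v i j| <= c) -> `|v| <= c.
Proof.
move=> c0 h; rewrite [leLHS]/Num.norm/= mx_normrE.
by apply/bigmax_leP; split=> // -[i j] _ /=.
Qed.

Lemma cv_norm_le m (v : 'cV[R]_m) (c : R) : 0 <= c ->
  (forall i, `|v i 0| <= c) -> `|v| <= c.
Proof. by move=> c0 h; apply: norm_le_coord => // i j; rewrite ord1. Qed.

Lemma ler_norm_sum_ord n (F : 'I_n -> R) (c : R) :
  (forall i, `|F i| <= c) -> `|\sum_i F i| <= n%:R * c.
Proof.
move=> h; apply: le_trans (ler_norm_sum _ _ _) _.
apply: le_trans (ler_sum _ (fun i _ => h i)) _.
by rewrite sumr_const card_ord mulr_natl.
Qed.

End coordinates.

Section mean_value.
Context {R : realType}.

Lemma is_derive_line (V : normedModType R) (g : V -> R) (p v : V) (s : R) :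
  derivable g (p + s *: v) v ->
  is_derive s 1 (fun r : R => g (p + r *: v)) ('D_v g (p + s *: v)).
Proof.
move=> dg.
have E : (fun h : R => h^-1 *: (((fun r : R => g (p + r *: v)) \o shift s) (h *: 1)
      - g (p + s *: v))) =
    (fun h : R => h^-1 *: ((g \o shift (p + s *: v)) (h *: v) - g (p + s *: v))).
  apply/funext => h /=; congr (_ *: (g _ - _)).
  by rewrite [h *: 1]mulr1 scalerDl addrCA.
apply: DeriveDef; first by rewrite /derivable E.
by rewrite /derive E.
Qed.

Lemma mvt_line_pos (V : normedModType R) (g : V -> R) (p v : V) (K c : R) :
  0 <= c ->
  (forall s, 0 <= s <= c -> derivable g (p + s *: v) v /\
     `|'D_v g (p + s *: v)| <= K) ->
  `|g (p + c *: v) - g p| <= K * c.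
Proof.
move=> c0 h.
have [s sc E] : exists2 s, s \in `[0, c]%R &
    g (p + c *: v) - g (p + 0 *: v) = 'D_v g (p + s *: v) * (c - 0).
  apply: (@MVT_segment _ (fun r => g (p + r *: v))) => //.
    move=> s; rewrite in_itv/= => /andP[/ltW s0 /ltW s1].
    have [|dg _] := h s; first by rewrite s0.
    exact: is_derive_line.
  apply: derivable_within_continuous => s; rewrite in_itv/= => s1.
  by have [dg _] := h s s1; have /= [] := is_derive_line dg.
rewrite scale0r addr0 subr0 in E; rewrite E normrM (ger0_norm c0).
rewrite in_itv/= in sc; have [_ ?] := h s sc.
by rewrite ler_wpM2r.
Qed.

Lemma mvt_line (V : normedModType R) (g : V -> R) (p v : V) (K c : R) :
  (forall s, Num.min 0 c <= s <= Num.max 0 c -> derivable g (p + s *: v) v /\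
     `|'D_v g (p + s *: v)| <= K) ->
  `|g (p + c *: v) - g p| <= K * `|c|.
Proof.
have [c0|c0] := leP 0 c => h.
  rewrite (ger0_norm c0); exact: mvt_line_pos.
rewrite (ltr0_norm c0) distrC.
have -> : g p = g ((p + c *: v) + (- c) *: v).
  by rewrite scaleNr addrK.
apply: mvt_line_pos; first by rewrite oppr_ge0 ltW.
move=> s /andP[s0 sc]; rewrite -addrA -scalerDl; apply: h.
by apply/andP; split; lra.
Qed.

(** The coordinates of x are replaced one after the other by those of y. In
   the max norm every intermediate point stays at distance at most |y - x| from
   x, so bounds on the partial derivatives are needed on that ball only. *)
Lemma lipschitz_of_partials m (g : 'cV[R]_m -> R) (x y : 'cV[R]_m) (K : R) :
  0 <= K ->
  (forall p j, `|p - x| <= `|y - x| -> derivable g p (basis_vec j) /\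
     `|'D_(basis_vec j) g p| <= K) ->
  `|g y - g x| <= m%:R * K * `|y - x|.
Proof.
move=> K0 h.
pose mix n : 'cV[R]_m := \col_i (if (i < n)%N then y i 0 else x i 0).
have mix0 : mix 0%N = x by apply/matrixP => i j; rewrite !mxE ord1.
have mixm : mix m = y by apply/matrixP => i j; rewrite !mxE ord1 ltn_ord.
have step n : (n <= m)%N -> `|g (mix n) - g x| <= n%:R * K * `|y - x|.
  elim: n => [|n ih] nm; first by rewrite mix0 subrr normr0 !mul0r.
  pose j := Ordinal nm; pose c := y j 0 - x j 0.
  have E : mix n.+1 = mix n + c *: basis_vec j.
    apply/matrixP => i k; rewrite !mxE ord1 eqxx andbT ltnS leq_eqVlt.
    have [->|ij] := eqVneq i j; first by rewrite eqxx ltnn/= mulr1 addrC subrK.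
    have -> : (nat_of_ord i == n) = false.
      by apply/negbTE; apply: contra ij => /eqP e; apply/eqP/val_inj.
    by rewrite mulr0 addr0.
  have cle : `|c| <= `|y - x|.
    by have := coord_le_norm (y - x) j 0; rewrite !mxE.
  have st : `|g (mix n.+1) - g (mix n)| <= K * `|y - x|.
    rewrite E; apply: (@le_trans _ _ (K * `|c|)); last by rewrite ler_wpM2l.
    apply: mvt_line => s sc; apply: h.
    apply: cv_norm_le => // i; rewrite !mxE eqxx andbT.
    have [->|ij] := eqVneq i j.
      rewrite ltnn/= mulr1 addrAC subrr add0r; apply: le_trans cle.
      move: sc; case: (leP 0 c) => c0.
        by rewrite (ger0_norm c0) => /andP[s0 s1]; rewrite ger0_norm.
      rewrite (ltr0_norm c0) => /andP[s0 s1].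
      by rewrite ler0_norm//; lra.
    rewrite mulr0 addr0; case: ifP => _; last by rewrite subrr normr0.
    by have := coord_le_norm (y - x) i 0; rewrite !mxE.
  rewrite -(subrK (g (mix n)) (g (mix n.+1))) -addrA.
  apply: le_trans (ler_normD _ _) _; rewrite -natr1 !mulrDl mul1r [leRHS]addrC.
  by apply: lerD => //; exact: (ih (ltnW nm)).
by have := step m (leqnn m); rewrite mixm.
Qed.

End mean_value.

(** * Functions with Lipschitz partial derivatives, Taylor remainders *)

Section smooth_class.
Context {R : realType} {m : nat} (T : R).
Implicit Types (f g : R -> 'cV[R]_m -> R) (x y z h k : 'cV[R]_m) (s t : R).

(** The functions all of whose iterated partial derivatives of order at most l
   are bounded and Lipschitz in time. This follows from membership in [Cb], and
   stability under sums and products is a direct induction, which gives the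
   coefficient (sigma . D) sigma of the second-order term. *)
Fixpoint smooth l f : Prop :=
  [/\ exists K : R, forall t x, 0 <= t <= T -> `|f t x| <= K,
      exists K : R, forall s t x, 0 <= s <= T -> 0 <= t <= T ->
        `|f t x - f s x| <= K * `|t - s| &
      if l is l'.+1 then
        forall j, x_derivable T j f /\ smooth l' (partial_x j f)
      else True].

Lemma smoothW l f : smooth l.+1 f -> smooth l f.
Proof.
elim: l f => [|l ih] f; first by case.
move=> [bf lf df]; split=> // j; have [? /ih ?] := df j; by split.
Qed.

Lemma eq_smooth l f g : (forall t x, 0 <= t <= T -> f t x = g t x) ->
  smooth l f -> smooth l g.
Proof.
elim: l f g => [|l ih] f g fg [[K bf] [K' lf]] df; split=> //.
- by exists K => t x tT; rewrite -fg//; exact: bf.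
- by exists K' => s t x sT tT; rewrite -!fg//; exact: lf.
- by exists K => t x tT; rewrite -fg//; exact: bf.
- by exists K' => s t x sT tT; rewrite -!fg//; exact: lf.
have E t : 0 <= t <= T -> f t = g t by move=> tT; apply/funext => x; exact: fg.
move=> j; have [xf sf] := df j; split.
  by move=> t x tT; rewrite -E//; exact: xf.
by apply: ih sf => t x tT; rewrite /partial_x E.
Qed.

Lemma smooth0 l : smooth l (fun _ _ => 0).
Proof.
elim: l => [|l ih]; split=> //; try (by exists 0 => *; rewrite normr0);
  try (by exists 0 => *; rewrite subrr normr0 mul0r).
move=> j; split; first by move=> t x _; exact: derivable_cst.
by apply: eq_smooth ih => t x _; rewrite /partial_x derive_cst.
Qed.

Lemma smoothD l f g : smooth l f -> smooth l g ->
  smooth l (fun t x => f t x + g t x).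
Proof.
elim: l f g => [|l ih] f g [[K bf] [K' lf] df] [[H bg] [H' lg] dg].
  split=> //.
    exists (K + H) => t x tT; apply: le_trans (ler_normD _ _) _.
    by apply: lerD; [exact: bf|exact: bg].
  exists (K' + H') => s t x sT tT; rewrite opprD addrACA mulrDl.
  by apply: le_trans (ler_normD _ _) _; apply: lerD; [exact: lf|exact: lg].
split.
- exists (K + H) => t x tT; apply: le_trans (ler_normD _ _) _.
  by apply: lerD; [exact: bf|exact: bg].
- exists (K' + H') => s t x sT tT; rewrite opprD addrACA mulrDl.
  by apply: le_trans (ler_normD _ _) _; apply: lerD; [exact: lf|exact: lg].
move=> j; have [xf sf] := df j; have [xg sg] := dg j; split.
  by move=> t x tT; apply: derivableD; [exact: xf|exact: xg].
apply: eq_smooth (ih _ _ sf sg) => t x tT.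
by rewrite /partial_x deriveD//; [exact: xf|exact: xg].
Qed.

Lemma smoothM l f g : smooth l f -> smooth l g ->
  smooth l (fun t x => f t x * g t x).
Proof.
elim: l f g => [|l ih] f g sF sG; have [[K bf] [K' lf] df] := sF;
  have [[H bg] [H' lg] dg] := sG.
all: have bfg : exists K, forall t x, 0 <= t <= T -> `|f t x * g t x| <= K
  by exists (K * H) => t x tT; rewrite normrM ler_pM ?bf ?bg.
all: have lfg : exists K, forall s t x, 0 <= s <= T -> 0 <= t <= T ->
    `|f t x * g t x - f s x * g s x| <= K * `|t - s|
  by exists (K * H' + K' * H) => s t x sT tT;
    rewrite (_ : f t x * g t x - f s x * g s x =
      f t x * (g t x - g s x) + (f t x - f s x) * g s x); [|ring];
    apply: le_trans (ler_normD _ _) _; rewrite !normrM mulrDl; apply: lerD;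
    [rewrite -mulrA ler_pM ?bf ?lg|rewrite mulrAC ler_pM ?lf ?bg].
  by split.
split=> // j; have [xf sf] := df j; have [xg sg] := dg j; split.
  by move=> t x tT; apply: derivableM; [exact: xf|exact: xg].
apply: eq_smooth (smoothD (ih _ _ (smoothW sF) sg) (ih _ _ sf (smoothW sG))).
move=> t x tT; rewrite /partial_x deriveM//; [|exact: xf|exact: xg].
by rewrite [_ *: _ + _ *: _]/(_ * _ + _ * _) [X in _ = _ + X]mulrC.
Qed.

Lemma smooth_sum l (I : finType) (F : I -> R -> 'cV[R]_m -> R) :
  (forall i, smooth l (F i)) -> smooth l (fun t x => \sum_i F i t x).
Proof.
move=> sF; elim: (index_enum I) => [|i r ih].
  by apply: eq_smooth (smooth0 l) => t x _; rewrite big_nil.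
by apply: eq_smooth (smoothD (sF i) ih) => t x _; rewrite big_cons.
Qed.

End smooth_class.

Section taylor.
Context {R : realType} {m : nat} (T : R).
Implicit Types (f g : R -> 'cV[R]_m -> R) (x y z h k : 'cV[R]_m) (s t : R).

(** Constants obtained separately for finitely many coefficients or partial
   derivatives are merged into one. *)
Lemma common_bound (I : finType) (P : I -> R -> Prop) :
  (forall i K K', K <= K' -> P i K -> P i K') -> (forall i, exists K, P i K) ->
  exists2 K, 0 <= K & forall i, P i K.
Proof.
move=> mono ex; have [F FP] := choice ex.
exists (\sum_i `|F i|); first by rewrite sumr_ge0.
move=> i; apply: mono (FP i); apply: le_trans (ler_norm _) _.
by rewrite (bigD1 i)//= lerDl sumr_ge0.
Qed.

Lemma partials_bounded f l : smooth T l.+1 f ->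
  exists2 K, 0 <= K & forall j t x, 0 <= t <= T -> `|partial_x j f t x| <= K.
Proof.
move=> [_ _ df]; apply: (@common_bound _ (fun j K => forall t x, 0 <= t <= T -> `|partial_x j f t x| <= K)).
  by move=> j K K' KK' h t x tT; apply: le_trans KK'; exact: h.
move=> j; have [_ sf] := df j; case: l {df} sf => [|l] [[K bK] _ _]; by exists K.
Qed.

Lemma smooth_lipschitz f : smooth T 1 f ->
  exists2 K, 0 <= K & forall t x y, 0 <= t <= T ->
    `|f t y - f t x| <= K * `|y - x|.
Proof.
move=> sf; have [K K0 bK] := partials_bounded sf.
exists (m%:R * K); first by rewrite mulr_ge0.
move=> t x y tT; apply: lipschitz_of_partials => // p j _; split; last exact: bK.
by have [_ _ df] := sf; have [xf _] := df j; exact: xf.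
Qed.

Lemma smooth_time_lipschitz f : smooth T 1 f ->
  exists2 K, 0 <= K & forall s t x y, 0 <= s <= T -> 0 <= t <= T ->
    `|(f t y - f s y) - (f t x - f s x)| <= K * `|t - s| * `|y - x|.
Proof.
move=> sf; have [_ _ df] := sf.
have [K K0 bK] : exists2 K, 0 <= K & forall j s t x, 0 <= s <= T -> 0 <= t <= T ->
    `|partial_x j f t x - partial_x j f s x| <= K * `|t - s|.
  apply: (@common_bound _ (fun j K => forall s t x, 0 <= s <= T -> 0 <= t <= T ->
    `|partial_x j f t x - partial_x j f s x| <= K * `|t - s|)).
    move=> j K K' KK' h s t x sT tT; apply: le_trans (h _ _ _ sT tT) _.
    by rewrite ler_wpM2r.
  by move=> j; have [_ [_ [K lK] _]] := df j; exists K.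
exists (m%:R * K); first by rewrite mulr_ge0.
move=> s t x y sT tT; rewrite -(mulrA m%:R).
apply: (@lipschitz_of_partials _ _ (fun x => f t x - f s x)) => //.
  by rewrite mulr_ge0.
move=> p j _; have [xf _] := df j; split.
  by apply: derivableB; exact: xf.
by rewrite deriveB; [exact: bK|exact: xf|exact: xf].
Qed.

Lemma partials_lipschitz f : smooth T 2 f ->
  exists2 K, 0 <= K & forall j t x y, 0 <= t <= T ->
    `|partial_x j f t y - partial_x j f t x| <= K * `|y - x|.
Proof.
move=> [_ _ df].
apply: (@common_bound _ (fun j K => forall t x y, 0 <= t <= T ->
    `|partial_x j f t y - partial_x j f t x| <= K * `|y - x|)).
  move=> j K K' KK' h t x y tT; apply: le_trans (h _ _ _ tT) _.
  by rewrite ler_wpM2r.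
by move=> j; have [_ /smooth_lipschitz[K _ lK]] := df j; exists K.
Qed.

Lemma is_derive_translate f t x h j : 0 <= t <= T -> x_derivable T j f ->
  is_derive h (basis_vec j) (fun h => f t (x + h)) (partial_x j f t (x + h)).
Proof.
move=> tT xf.
have E : (fun a : R => a^-1 *: (((fun h => f t (x + h)) \o shift h)
            (a *: basis_vec j) - f t (x + h))) =
    (fun a : R => a^-1 *: ((f t \o shift (x + h)) (a *: basis_vec j) - f t (x + h))).
  by apply/funext => a /=; rewrite (addrCA x).
apply: DeriveDef; first by rewrite /derivable E; exact: xf.
by rewrite /derive E.
Qed.

(** The derivative in x of f(x + h) - f(x) is an increment of the partial
   derivatives, of order |h|; hence two derivatives of f suffice. *)
Lemma smooth_increment f : smooth T 2 f ->
  exists2 K, 0 <= K & forall t x z h, 0 <= t <= T ->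
    `|(f t (x + h) - f t x) - (f t (z + h) - f t z)| <= K * `|h| * `|x - z|.
Proof.
move=> sf; have [_ _ df] := sf.
have [K K0 bK] := partials_lipschitz sf.
exists (m%:R * K); first by rewrite mulr_ge0.
move=> t x z h tT; rewrite -(mulrA m%:R).
apply: (@lipschitz_of_partials _ _ (fun x => f t (x + h) - f t x)) => //.
  by rewrite mulr_ge0.
move=> p j _; have [xf _] := df j.
have sh : is_derive p (basis_vec j) (fun x => f t (x + h)) (partial_x j f t (p + h)).
  have := is_derive_translate h p tT xf; under eq_fun do rewrite addrC.
  by rewrite (addrC h).
have xp := xf _ p tT.
split; first exact: derivableB.
rewrite deriveB// derive_val.
by apply: le_trans (bK _ _ _ _ tT) _; rewrite addrAC subrr add0r.
Qed.

Definition gradient f t x h : R := \sum_j partial_x j f t x * h j 0.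
Definition remainder f t x h : R := f t (x + h) - f t x - gradient f t x h.

Lemma is_derive_coord x v (j : 'I_m) :
  is_derive x v (fun y : 'cV[R]_m => y j 0) (v j 0).
Proof.
have did : derivable (fun y : 'cV[R]_m => y) x v by exact: derivable_id.
have dx := (derivable_mxP _ _ _).1 did j 0.
apply: DeriveDef => //.
have := derive_mx did; rewrite derive_id => /matrixP/(_ j 0).
by rewrite mxE.
Qed.

Lemma is_derive_gradient f t x h j :
  is_derive h (basis_vec j) (gradient f t x) (partial_x j f t x).
Proof.
have -> : gradient f t x =
    \sum_i (partial_x i f t x *: (fun h : 'cV[R]_m => h i 0)).
  by apply/funext => h'; rewrite fct_sumE.
have H i : is_derive h (basis_vec j) (partial_x i f t x *: (fun h : 'cV[R]_m => h i 0)) (partial_x i f t x *: basis_vec j i 0).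
  by apply: is_deriveZ; exact: is_derive_coord.
apply: is_derive_eq (is_derive_sum H) _.
rewrite (bigD1 j)//= big1 ?addr0; last first.
  by move=> i ij; rewrite /basis_vec mxE (negbTE ij)/= scaler0.
by rewrite /basis_vec mxE !eqxx [_ *: _]mulr1.
Qed.

Lemma is_derive_remainder f t x h j : 0 <= t <= T -> x_derivable T j f ->
  is_derive h (basis_vec j) (remainder f t x)
    (partial_x j f t (x + h) - partial_x j f t x).
Proof.
move=> tT xf.
have -> : remainder f t x =
    (fun h => f t (x + h)) - cst (f t x) - gradient f t x by [].
apply: is_derive_eq.
  apply: is_deriveB; last exact: is_derive_gradient.
  by apply: is_deriveB; exact: is_derive_translate.
by rewrite subr0.
Qed.

Lemma remainder_lipschitz f : smooth T 2 f ->
  exists2 K, 0 <= K & forall t x h k, 0 <= t <= T ->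
    `|remainder f t x h - remainder f t x k| <= K * (`|h| + `|k|) * `|h - k|.
Proof.
move=> sf; have [_ _ df] := sf.
have [K K0 bK] := partials_lipschitz sf.
exists (m%:R * (K * 2)); first by rewrite !mulr_ge0.
move=> t x h k tT; rewrite -(mulrA m%:R).
apply: lipschitz_of_partials => //; first by rewrite !mulr_ge0// addr_ge0.
move=> p j hp; have [xf _] := df j.
have [? ->] := is_derive_remainder x p tT xf; split=> //.
apply: le_trans (bK _ _ _ _ tT) _; rewrite addrAC subrr add0r -mulrA ler_wpM2l//.
have := ler_normD (p - k) k; rewrite subrK.
have := ler_normB h k; have := normr_ge0 h; have := normr_ge0 k; lra.
Qed.

Lemma remainder0 f t x : remainder f t x 0 = 0.
Proof.
rewrite /remainder /gradient addr0 subrr big1 ?subr0// => j _.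
by rewrite mxE mulr0.
Qed.

Lemma remainder_quadratic f : smooth T 2 f ->
  exists2 K, 0 <= K & forall t x h, 0 <= t <= T ->
    `|remainder f t x h| <= K * `|h| ^+ 2.
Proof.
move=> /remainder_lipschitz[K K0 bK]; exists K => // t x h tT.
have := bK t x h 0 tT.
by rewrite remainder0 !subr0 normr0 addr0 expr2 mulrA.
Qed.

(** Both remainders vanish at h = 0, and the derivative in h of their difference
   is controlled by [smooth_increment]. Differentiating in h rather than in the
   base point avoids exchanging the order of partial derivatives. *)
Lemma remainder_base_lipschitz f : smooth T 3 f ->
  exists2 K, 0 <= K & forall t x z h, 0 <= t <= T ->
    `|remainder f t x h - remainder f t z h| <= K * `|h| ^+ 2 * `|x - z|.
Proof.
move=> sf; have [_ _ df] := sf.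
have [K K0 bK] : exists2 K, 0 <= K & forall j t x z h, 0 <= t <= T ->
    `|(partial_x j f t (x + h) - partial_x j f t x)
      - (partial_x j f t (z + h) - partial_x j f t z)| <= K * `|h| * `|x - z|.
  apply: (@common_bound _ (fun j K => forall t x z h, 0 <= t <= T ->
    `|(partial_x j f t (x + h) - partial_x j f t x)
      - (partial_x j f t (z + h) - partial_x j f t z)| <= K * `|h| * `|x - z|)).
    move=> j K K' KK' H t x z h tT; apply: le_trans (H _ _ _ _ tT) _.
    by rewrite !ler_wpM2r.
  by move=> j; have [_ /smooth_increment[K _ lK]] := df j; exists K.
exists (m%:R * K); first by rewrite mulr_ge0.
move=> t x z h tT.
have -> : m%:R * K * `|h| ^+ 2 * `|x - z| =
    m%:R * (K * `|h| * `|x - z|) * `|h - 0| by rewrite subr0; ring.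
have -> : remainder f t x h - remainder f t z h =
  (remainder f t x h - remainder f t z h) - (remainder f t x 0 - remainder f t z 0).
  by rewrite !remainder0 subr0 subr0.
apply: (@lipschitz_of_partials _ _ (fun h => remainder f t x h - remainder f t z h)).
  by rewrite !mulr_ge0.
move=> p j; rewrite !subr0 => hp; have [xf _] := df j.
have [d1 e1] := is_derive_remainder x p tT xf.
have [d2 e2] := is_derive_remainder z p tT xf.
split; first exact: derivableB.
rewrite deriveB// e1 e2; apply: le_trans (bK _ _ _ _ _ tT) _.
by rewrite ler_wpM2r// ler_wpM2l.
Qed.

End taylor.

Section smooth_of_Cb.
Context {R : realType} {m : nat} (T : R).

Lemma bounded_continuous_bound (X : topologicalType) (V : normedModType R)
    (A : set X) (f : X -> V) :
  bounded_continuous A f -> exists K : R, forall p, A p -> `|f p| <= K.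
Proof. by move=> [_ /pinfty_ex_gt0[K _ bK]]; exists K => p; exact: bK. Qed.

(** Makes the mean value theorem applicable to the time derivatives of [Cb_t],
   which are one-sided at the end points only. *)
Lemma near_time_interior (r : R) : 0 < r < T -> near_time T r = 0^'.
Proof.
move=> /andP[r0 rT].
have H0 : \forall h \near 0^', 0 <= r + h <= T.
  apply: nbhs_dnbhs; apply/nbhs_ballP; exists (Num.min r (T - r)).
    by rewrite /= lt_min r0 subr_gt0.
  move=> h; rewrite /ball/= sub0r normrN lt_min !ltr_norml.
  by move=> /andP[/andP[? ?] /andP[? ?]]; apply/andP; split; lra.
rewrite /near_time predeqE => A; rewrite /within/=; split.
  by move=> h; apply: filterS2 H0 h => a ra /(_ ra).
by apply: filterS => a.
Qed.

Lemma time_derivative p q (f : R -> 'cV[R]_m -> 'M[R]_(p, q)) (r : R) x i j :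
  0 < r < T -> t_derivable T f ->
  is_derive r 1 (fun t => f t x i j) (partial_t T f r x i j).
Proof.
move=> r0T df; have /andP[r0 rT] := r0T.
have : cvg (quotient_t f r x h @[h --> near_time T r]).
  by apply: df; rewrite !ltW.
rewrite /partial_t (near_time_interior r0T) => cq.
have hl : (fun h => h^-1 *: (((fun t => f t x i j) \o shift r) (h *: 1) - f r x i j))
    @ 0^' --> (lim (quotient_t f r x h @[h --> 0^'])) i j.
  have -> : (fun h => h^-1 *: (((fun t => f t x i j) \o shift r) (h *: 1) - f r x i j))
     = (fun M : 'M[R]_(p, q) => M i j) \o (quotient_t f r x).
    by apply/funext => h /=; rewrite !mxE [h *: 1]mulr1 (addrC h).
  apply: cvg_comp cq _; exact: coord_continuous.
apply: DeriveDef; first by apply/cvg_ex; eexists; exact: hl.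
exact: cvg_lim hl.
Qed.

Lemma Cb_t_time_lipschitz p q (f : R -> 'cV[R]_m -> 'M[R]_(p, q)) i j :
  Cb_t T 1 f -> exists K : R, forall s t x, 0 <= s <= T -> 0 <= t <= T ->
     `|f t x i j - f s x i j| <= K * `|t - s|.
Proof.
move=> [bf [df [/bounded_continuous_bound[K bK] _]]].
exists K.
have ordered s t x : 0 <= s -> s <= t -> t <= T ->
    `|f t x i j - f s x i j| <= K * `|t - s|.
  move=> s0 st tT.
  have [c cst ->] : exists2 c, c \in `[s, t]%R &
      f t x i j - f s x i j = partial_t T f c x i j * (t - s).
    apply: (@MVT_segment _ (fun t => f t x i j)) => //.
      move=> c; rewrite in_itv/= => /andP[sc ct]; apply: time_derivative => //.
      by rewrite (le_lt_trans s0 sc) (lt_le_trans ct tT).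
    apply/subspace_continuousP => r /=; rewrite in_itv/= => /andP[sr rt].
    have [/subspace_continuousP cf _] := bf.
    have := cf (r, x) => /=; rewrite (le_trans s0 sr) (le_trans rt tT).
    move=> /(_ isT) cfr.
    suff tD : (fun t => (t, x)) @ within `[s, t] (nbhs r) -->
        within [set p : R * 'cV[R]_m | 0 <= p.1 <= T] (nbhs (r, x)).
      have := cvg_comp _ _ (cvg_comp _ _ tD cfr) (@coord_continuous _ _ _ i j (f r x)).
      exact.
    move=> A /=; rewrite /within/= => hA.
    have hp : (fun t : R => (t, x)) @ nbhs r --> nbhs (r, x).
      exact: (cvg_pair (@cvg_id _ (nbhs r)) (cvg_cst x)).
    have hA' : nbhs r (fun u => 0 <= u <= T -> A (u, x)) := hp _ hA.
    apply: filterS hA' => u /= h; rewrite in_itv/= => /andP[su ut].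
    by apply: h; rewrite (le_trans s0 su) (le_trans ut tT).
  rewrite normrM; apply: ler_wpM2r => //; apply: le_trans (coord_le_norm _ _ _) _.
  move: cst; rewrite in_itv/= => /andP[sc ct].
  by apply: (bK (c, x)); rewrite /= (le_trans s0 sc) (le_trans ct tT).
move=> s t x /andP[s0 sT] /andP[t0 tT]; have [st|/ltW ts] := leP s t.
  exact: ordered.
by rewrite distrC (distrC t); exact: ordered.
Qed.

Lemma Cb_smooth l p q (f : R -> 'cV[R]_m -> 'M[R]_(p, q)) i j :
  Cb T 1 l f -> smooth T l (fun t x => f t x i j).
Proof.
elim: l f => [|l ih] f [ct dx]; have [bf _] := ct.
all: have bfij : exists K, forall t x, 0 <= t <= T -> `|f t x i j| <= K
  by have [K bK] := bounded_continuous_bound bf; exists K => t x tT;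
     apply: le_trans (coord_le_norm _ _ _) _; exact: (bK (t, x)).
all: have lf := Cb_t_time_lipschitz i j ct.
  by split.
split=> // k; have [xf sf] := dx k; split.
  by move=> t x tT; apply: (derivable_mxP _ _ _).1 (xf t x tT) i j.
apply: eq_smooth (ih _ sf) => t x tT.
by rewrite /partial_x derive_mx ?mxE//; exact: xf.
Qed.

End smooth_of_Cb.

(** * Taylor defects along one-step increments *)

Section taylor_defect.
Context {R : realType} {m : nat} (T : R).
Implicit Types (f : R -> 'cV[R]_m -> R) (p q v : 'cV[R]_m) (s u r V : R).

Lemma gradientB f s p v w :
  gradient f s p (v - w) = gradient f s p v - gradient f s p w.
Proof.
by rewrite /gradient -sumrB; apply: eq_bigr => j _; rewrite !mxE mulrBr.
Qed.

Lemma gradient_bound f : smooth T 1 f ->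
  exists2 K, 0 <= K & forall s p v, 0 <= s <= T -> `|gradient f s p v| <= K * `|v|.
Proof.
move=> sf; have [K K0 bK] := partials_bounded sf.
exists (m%:R * K) => [|s p v sT]; first by rewrite mulr_ge0.
have := @ler_norm_sum_ord R m (fun j => partial_x j f s p * v j 0) (K * `|v|).
rewrite mulrA; apply=> j; rewrite normrM ler_pM//; first exact: bK.
exact: coord_le_norm.
Qed.

Lemma gradient_lipschitz f : smooth T 2 f ->
  exists2 K, 0 <= K & forall s p p' v, 0 <= s <= T ->
    `|gradient f s p v - gradient f s p' v| <= K * `|p - p'| * `|v|.
Proof.
move=> sf; have [K K0 bK] := partials_lipschitz sf.
exists (m%:R * K) => [|s p p' v sT]; first by rewrite mulr_ge0.
rewrite /gradient -sumrB.
have := @ler_norm_sum_ord R m (fun j => partial_x j f s p * v j 0 - partial_x j f s p' * v j 0) (K * `|p - p'| * `|v|).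
rewrite !mulrA; apply=> j; rewrite -mulrBl normrM ler_pM//; first exact: bK.
exact: coord_le_norm.
Qed.

Lemma increment_le_step c r p q v : 0 <= r <= c ->
  `|v| <= c * r -> `|q - p - v| <= c * r ^+ 2 -> `|q - p| <= (c + c ^+ 2) * r.
Proof.
move=> /andP[r0 rc] hv hr.
have := ler_normD (q - p - v) v; rewrite subrK => h.
have : c * r ^+ 2 <= c ^+ 2 * r.
  have : c * r * r <= c * r * c by rewrite ler_wpM2l// mulr_ge0// (le_trans r0).
  by lra.
by rewrite mulrDl; lra.
Qed.

(** Time counts twice: |u - s| is of order r^2, so that one time derivative
   matches two space derivatives. *)
Lemma taylor_defect f c : smooth T 2 f -> 0 <= c ->
  exists2 K, 0 <= K & forall s u p q v r, 0 <= s <= T -> 0 <= u <= T ->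
    0 <= r <= c -> `|u - s| <= c * r ^+ 2 -> `|v| <= c * r ->
    `|q - p - v| <= c * r ^+ 2 ->
    `|f u q - f s p - gradient f s p v| <= K * r ^+ 2.
Proof.
move=> sf c0; have [_ [K1 lK1] _] := sf.
have [K2 K20 bK2] := remainder_quadratic sf.
have [K3 K30 bK3] := gradient_bound (smoothW sf).
set H := c + c ^+ 2; have H0 : 0 <= H by rewrite addr_ge0// exprn_ge0.
exists (`|K1| * c + K2 * H ^+ 2 + K3 * c).
  by rewrite !addr_ge0 ?mulr_ge0 ?exprn_ge0.
move=> s u p q v r sT uT rc us vr rho.
have hq := increment_le_step rc vr rho; rewrite -/H in hq.
have /andP[r0 _] := rc.
have -> : f u q - f s p - gradient f s p v =
   (f u q - f s q) + remainder f s p (q - p) + gradient f s p (q - p - v).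
  by rewrite gradientB /remainder addrC [p + _]addrC subrK; ring.
rewrite !mulrDl; apply: le_trans (ler_normD _ _) _.
apply: lerD; first (apply: le_trans (ler_normD _ _) _; apply: lerD).
- apply: le_trans (lK1 _ _ _ sT uT) _; rewrite -mulrA.
  by apply: le_trans (ler_wpM2r _ (ler_norm K1)) _ => //; rewrite ler_wpM2l.
- apply: le_trans (bK2 _ _ _ sT) _; rewrite -mulrA ler_wpM2l// -exprMn.
  by rewrite lerXn2r ?nnegrE ?mulr_ge0.
- by apply: le_trans (bK3 _ _ _ sT) _; rewrite -mulrA ler_wpM2l.
Qed.

Lemma increment_bound f c : smooth T 1 f -> 0 <= c ->
  exists2 K, 0 <= K & forall s u p q v r, 0 <= s <= T -> 0 <= u <= T ->
    0 <= r <= c -> `|u - s| <= c * r ^+ 2 -> `|v| <= c * r ->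
    `|q - p - v| <= c * r ^+ 2 ->
    `|f u q - f s p| <= K * r.
Proof.
move=> sf c0; have [_ [K1 lK1] _] := sf.
have [K2 K20 lK2] := smooth_lipschitz sf.
set H := c + c ^+ 2; have H0 : 0 <= H by rewrite addr_ge0// exprn_ge0.
exists (`|K1| * c ^+ 2 + K2 * H).
  by rewrite !addr_ge0 ?mulr_ge0 ?exprn_ge0.
move=> s u p q v r sT uT rc us vr rho.
have hq := increment_le_step rc vr rho; rewrite -/H in hq.
have /andP[r0 rc'] := rc.
rewrite -(subrK (f s q) (f u q)) -addrA mulrDl.
apply: le_trans (ler_normD _ _) _; apply: lerD.
  apply: le_trans (lK1 _ _ _ sT uT) _.
  apply: (@le_trans _ _ (`|K1| * (c * r ^+ 2))).
    by apply: le_trans (ler_wpM2r _ (ler_norm K1)) _ => //; rewrite ler_wpM2l.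
  rewrite -mulrA; apply: ler_wpM2l => //.
  have : c * r * r <= c * r * c by rewrite ler_wpM2l// mulr_ge0.
  by lra.
by apply: le_trans (lK2 _ _ _ sT) _; rewrite -mulrA ler_wpM2l.
Qed.

(** In this lemma and in [taylor_defect_diff], p -> q and p' -> q' are steps of
   two paths with first-order parts v and v', r is the size of the driver over
   the step and V the distance of the two paths. Every bound has to be linear in
   V: this is what the uniqueness argument feeds on, and what costs one
   derivative more than the estimates for a single path. *)
Lemma increment_diff_bound f c : smooth T 2 f -> 0 <= c ->
  exists2 K, 0 <= K & forall s u p q v p' q' v' r V,
    0 <= s <= T -> 0 <= u <= T ->
    0 <= r <= c -> `|u - s| <= c * r ^+ 2 -> `|v| <= c * r ->
    `|q - p - v| <= c * r ^+ 2 ->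
    `|p - p'| <= V -> `|q - q'| <= V -> `|v - v'| <= c * r * V ->
    `|(q - p - v) - (q' - p' - v')| <= V * r ^+ 2 ->
    `|(f u q - f s p) - (f u q' - f s p')| <= K * V * r.
Proof.
move=> sf c0.
have [K1 K10 lK1] := smooth_time_lipschitz (smoothW sf).
have [K2 K20 lK2] := smooth_increment sf.
have [K3 K30 lK3] := smooth_lipschitz (smoothW sf).
set H := c + c ^+ 2; have H0 : 0 <= H by rewrite addr_ge0// exprn_ge0.
exists (K1 * c ^+ 2 + K2 * H + K3 * (c * 2)).
  by rewrite !addr_ge0 ?mulr_ge0 ?exprn_ge0.
move=> s u p q v p' q' v' r V sT uT rc us vr rho pV qV vV rhoV.
have hq := increment_le_step rc vr rho; rewrite -/H in hq.
have /andP[r0 rc'] := rc.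
have V0 : 0 <= V := le_trans (normr_ge0 _) pV.
have hh : `|(q - p) - (q' - p')| <= 2 * c * (V * r).
  have := ler_normD ((q - p - v) - (q' - p' - v')) (v - v').
  rewrite (_ : q - p - v - _ + _ = (q - p) - (q' - p')); last first.
    by apply/matrixP => i j; rewrite !mxE; ring.
  have : V * r * r <= V * r * c by rewrite ler_wpM2l// mulr_ge0.
  by lra.
have -> : (f u q - f s p) - (f u q' - f s p') =
  ((f u q - f s q) - (f u q' - f s q'))
  + ((f s (p + (q - p)) - f s p) - (f s (p' + (q - p)) - f s p'))
  + (f s (p' + (q - p)) - f s (p' + (q' - p'))).
  by rewrite [p + _]addrC subrK [p' + (q' - _)]addrC subrK; ring.
rewrite !mulrDl; apply: le_trans (ler_normD _ _) _.
apply: lerD; first (apply: le_trans (ler_normD _ _) _; apply: lerD).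
- apply: le_trans (lK1 _ _ _ _ sT uT) _.
  rewrite -!mulrA ler_wpM2l// mulrA [V * r]mulrC mulrA ler_pM//.
  apply: le_trans us _; have : c * r * r <= c * r * c by rewrite ler_wpM2l// mulr_ge0.
  by lra.
- apply: le_trans (lK2 _ _ _ _ sT) _.
  by rewrite -!mulrA ler_wpM2l// [V * r]mulrC mulrA ler_pM.
- apply: le_trans (lK3 _ _ _ sT) _.
  rewrite (_ : p' + _ - _ = (q - p) - (q' - p')); last first.
    by apply/matrixP => i j; rewrite !mxE; ring.
  by apply: le_trans (ler_wpM2l K30 hh) _; lra.
Qed.

Lemma taylor_defect_diff f c : smooth T 3 f -> 0 <= c ->
  exists2 K, 0 <= K & forall s u p q v p' q' v' r V,
    0 <= s <= T -> 0 <= u <= T ->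
    0 <= r <= c -> `|u - s| <= c * r ^+ 2 ->
    `|v| <= c * r -> `|v'| <= c * r ->
    `|q - p - v| <= c * r ^+ 2 -> `|q' - p' - v'| <= c * r ^+ 2 ->
    `|p - p'| <= V -> `|q - q'| <= V -> `|v - v'| <= c * r * V ->
    `|(q - p - v) - (q' - p' - v')| <= V * r ^+ 2 ->
    `|(f u q - f s p - gradient f s p v)
      - (f u q' - f s p' - gradient f s p' v')| <= K * V * r ^+ 2.
Proof.
move=> sf c0.
have [K1 K10 lK1] := smooth_time_lipschitz (smoothW (smoothW sf)).
have [K2 K20 lK2] := remainder_base_lipschitz sf.
have [K3 K30 lK3] := remainder_lipschitz (smoothW sf).
have [K4 K40 lK4] := gradient_bound (smoothW (smoothW sf)).
have [K5 K50 lK5] := gradient_lipschitz (smoothW sf).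
set H := c + c ^+ 2; have H0 : 0 <= H by rewrite addr_ge0// exprn_ge0.
exists (K1 * c + K2 * H ^+ 2 + K3 * (H * 2) * (c * 2) + K4 + K5 * c).
  by rewrite !addr_ge0 ?mulr_ge0 ?exprn_ge0.
move=> s u p q v p' q' v' r V sT uT rc us vr vr' rho rho' pV qV vV rhoV.
have hq := increment_le_step rc vr rho; rewrite -/H in hq.
have hq' := increment_le_step rc vr' rho'; rewrite -/H in hq'.
clearbody H.
have /andP[r0 rc'] := rc.
have V0 : 0 <= V := le_trans (normr_ge0 _) pV.
have hh : `|(q - p) - (q' - p')| <= 2 * c * (V * r).
  have := ler_normD ((q - p - v) - (q' - p' - v')) (v - v').
  rewrite (_ : q - p - v - _ + _ = (q - p) - (q' - p')); last first.
    by apply/matrixP => i j; rewrite !mxE; ring.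
  have : V * r * r <= V * r * c by rewrite ler_wpM2l// mulr_ge0.
  by lra.
set h := q - p; set h' := q' - p'.
have -> : (f u q - f s p - gradient f s p v)
      - (f u q' - f s p' - gradient f s p' v') =
  ((f u q - f s q) - (f u q' - f s q'))
  + (remainder f s p h - remainder f s p' h)
  + (remainder f s p' h - remainder f s p' h')
  + gradient f s p ((h - v) - (h' - v'))
  + (gradient f s p (h' - v') - gradient f s p' (h' - v')).
  have e (a b : 'cV[R]_m) : a + (b - a) = b by rewrite addrC subrK.
  rewrite /remainder /h /h' !e !gradientB; ring.
rewrite !mulrDl; apply: le_trans (ler_normD _ _) _; apply: lerD;
  first (apply: le_trans (ler_normD _ _) _; apply: lerD;
  first (apply: le_trans (ler_normD _ _) _; apply: lerD;
  first (apply: le_trans (ler_normD _ _) _; apply: lerD))).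
- apply: le_trans (lK1 _ _ _ _ sT uT) _.
  by rewrite -!mulrA ler_wpM2l// [V * _]mulrC mulrA ler_pM.
- apply: le_trans (lK2 _ _ _ _ sT) _.
  rewrite -!(mulrA K2) ler_wpM2l// [H ^+ 2 * V * _]mulrAC -exprMn ler_pM//.
  by rewrite lerXn2r ?nnegrE ?mulr_ge0.
- apply: le_trans (lK3 _ _ _ _ sT) _.
  apply: (@le_trans _ _ (K3 * ((H * r + H * r) * (2 * c * (V * r))))); last first.
    by rewrite le_eqVlt; apply/orP; left; apply/eqP; ring.
  rewrite -mulrA ler_wpM2l// ler_pM// ?addr_ge0//.
  exact: lerD.
- by apply: le_trans (lK4 _ _ _ sT) _; rewrite -mulrA ler_wpM2l.
- apply: le_trans (lK5 _ _ _ _ sT) _.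
  by rewrite -!mulrA ler_wpM2l// [c * _]mulrCA ler_pM.
Qed.

End taylor_defect.

(** * Powers of interval lengths *)

Section powers.
Context {R : realType}.
Implicit Types (s t u L T kappa alpha : R).

(** The order of magnitude of an increment of the driving path. *)
Definition pw kappa s t : R := (t - s) `^ kappa.

Lemma pw_ge0 kappa s t : 0 <= pw kappa s t.
Proof. exact: powR_ge0. Qed.

Lemma pw_homo kappa s t s' t' : 0 <= kappa -> s <= t -> t - s <= t' - s' ->
  pw kappa s t <= pw kappa s' t'.
Proof.
move=> k0 st h; apply: ge0_ler_powR => //; rewrite ?nnegrE ?subr_ge0//.
by rewrite -subr_ge0; apply: le_trans h; rewrite subr_ge0.
Qed.

Lemma powRMn kappa n L : 0 <= L -> L `^ (n%:R * kappa) = (L `^ kappa) ^+ n.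
Proof.
by move=> L0; rewrite mulrC powRrM powR_mulrn// powR_ge0.
Qed.

Lemma powR_le_scaled T L kappa alpha : 0 <= L -> L <= T -> 0 < kappa -> kappa <= alpha ->
  L `^ alpha <= T `^ (alpha - kappa) * L `^ kappa.
Proof.
move=> L0 LT k0 ka; have a0 := lt_le_trans k0 ka.
have [->|Ln0] := eqVneq L 0; first by rewrite !powR0 ?gt_eqF// mulr0.
have -> : L `^ alpha = L `^ (alpha - kappa) * L `^ kappa.
  by rewrite -powRD ?subrK// Ln0 implybT.
rewrite ler_wpM2r ?powR_ge0//; apply: ge0_ler_powR; rewrite ?nnegrE ?subr_ge0//.
exact: le_trans LT.
Qed.

Lemma time_le_pw2 T kappa : 0 < kappa -> kappa <= 2^-1 ->
  exists2 c, 0 <= c & forall s t, 0 <= s -> s <= t -> t <= T ->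
    t - s <= c * pw kappa s t ^+ 2.
Proof.
move=> k0 k2; exists (T `^ (1 - 2 * kappa)) => [|s t s0 st tT]; first exact: powR_ge0.
have := @powR_le_scaled T (t - s) (2 * kappa) 1.
rewrite powRr1 ?subr_ge0// powRMn ?subr_ge0//; apply=> //; lra.
Qed.

Lemma pw_le T kappa s t : 0 <= kappa -> 0 <= s -> s <= t -> t <= T ->
  pw kappa s t <= T `^ kappa.
Proof.
move=> k0 s0 st tT; apply: ge0_ler_powR; rewrite ?nnegrE ?subr_ge0//; lra.
Qed.

Lemma pwxx kappa t : 0 < kappa -> pw kappa t t = 0.
Proof. by move=> k0; rewrite /pw subrr powR0// gt_eqF. Qed.

(** Halving an interval divides the cube of [pw] by 2^(3 kappa), which exceeds 2 when
   1/3 < kappa; the cost of replacing an interval by its two halves is thus a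
   factor below 1. *)
Definition half_rate kappa : R := 2 * (2^-1 `^ kappa) ^+ 3.

Lemma half_rate_lt1 kappa : 3^-1 < kappa -> half_rate kappa < 1.
Proof.
move=> k3; rewrite /half_rate -powRMn; last by lra.
have -> : (2^-1 : R) `^ (3 * kappa) = 2^-1 `^ (3 * kappa - 1) * 2^-1.
  by rewrite -[X in _ = _ * X]powRr1// -powRD ?subrK// invr_eq0 pnatr_eq0 implybT.
rewrite mulrCA mulfV ?pnatr_eq0// mulr1 /powR invr_eq0 pnatr_eq0/= expR_lt1.
by rewrite pmulr_rlt0; [rewrite ln_lt0//; apply/andP; split; lra|lra].
Qed.

Lemma half_rate_ge0 kappa : 0 <= half_rate kappa.
Proof. by rewrite mulr_ge0// exprn_ge0// powR_ge0. Qed.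

Lemma pw_half kappa s t s' t' : 0 <= kappa -> s <= t -> t - s <= 2^-1 * (t' - s') ->
  2 * pw kappa s t ^+ 3 <= half_rate kappa * pw kappa s' t' ^+ 3.
Proof.
move=> k0 st h; rewrite /half_rate -mulrA -exprMn.
have h' : 0 <= t' - s' by lra.
rewrite ler_wpM2l// lerXn2r ?nnegrE ?mulr_ge0 ?powR_ge0// /pw -powRM//.
by apply: ge0_ler_powR; rewrite ?nnegrE ?subr_ge0// mulr_ge0.
Qed.

Lemma small_pw kappa e : 0 < kappa -> 0 < e -> exists2 h, 0 < h <= 1 & h `^ kappa <= e.
Proof.
move=> k0 e0; exists (Num.min 1 (e `^ kappa^-1)).
  by rewrite lt_min ltr01 powR_gt0//= ge_min lexx.
have eE : (e `^ kappa^-1) `^ kappa = e.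
  by rewrite -powRrM mulVf ?gt_eqF// powRr1// ltW.
rewrite -[leRHS]eE; apply: ge0_ler_powR; rewrite ?nnegrE ?powR_ge0//.
- exact: ltW.
- by rewrite le_min ler01 powR_ge0.
- by rewrite ge_min lexx orbT.
Qed.

End powers.

(** * The local expansion of the rough equation *)

Section sequences_along_filters.
Context {R : realType} (F : set_system nat) {FF : ProperFilter F}.

Lemma cvg_of_bound (V : normedModType R) (f : nat -> V) (g : nat -> R) (l : V) :
  (forall n, `|f n - l| <= g n) -> g @ F --> 0 -> f @ F --> l.
Proof.
move=> fg /cvgrPdist_le g0; apply/cvgrPdist_le => e e0.
have := g0 e e0; apply: filterS => n; rewrite sub0r normrN => ge.
by rewrite distrC; apply: le_trans (fg n) (le_trans (ler_norm _) ge).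
Qed.

Lemma cvg_coordinates m (v : nat -> 'cV[R]_m) (w : 'cV[R]_m) :
  (forall i, v n i 0 @[n --> F] --> w i 0) -> v @ F --> w.
Proof.
move=> vw; apply/cvgrPdist_le => e e0.
have : \forall n \near F, forall i, `|w i 0 - v n i 0| <= e.
  by apply: filter_forall => i; move/cvgrPdist_le: (vw i); exact.
apply: filterS => n h; apply: cv_norm_le => [|i]; first exact: ltW.
by rewrite !mxE.
Qed.

Lemma cvg_sum_ord n (f : 'I_n -> nat -> R) (l : 'I_n -> R) :
  (forall i, f i @ F --> l i) -> \sum_i f i k @[k --> F] --> \sum_i l i.
Proof.
move=> fl; elim: (index_enum _) => [|i r ih].
  by rewrite big_nil; under eq_fun do rewrite big_nil; exact: cvg_cst.
by rewrite big_cons; under eq_fun do rewrite big_cons; apply: cvgD.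
Qed.

Lemma cvg_powR0 (kappa : R) (g : nat -> R) : 0 < kappa ->
  (forall n, 0 <= g n) -> g @ F --> 0 -> g n `^ kappa @[n --> F] --> 0.
Proof.
move=> k0 gp /cvgrPdist_le g0; apply/cvgrPdist_le => e e0.
have [h /andP[h0 _] he] := small_pw k0 e0.
have := g0 h h0; apply: filterS => n; rewrite !sub0r !normrN ger0_norm// => gh.
rewrite ger0_norm ?powR_ge0//; apply: le_trans he.
by apply: ge0_ler_powR; rewrite ?nnegrE ?gp ?(ltW k0) ?(ltW h0).
Qed.

End sequences_along_filters.

Section germ_axioms.
Context {R : realType} {m : nat}.
Variables (T kappa : R) (A S : R -> R -> 'cV[R]_m -> 'cV[R]_m).
Implicit Types (s u t c V : R) (p q : 'cV[R]_m).

Definition simplex s t := [/\ 0 <= s, s <= t & t <= T].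

Lemma simplexL s t : simplex s t -> 0 <= s <= T.
Proof. by move=> [s0 st tT]; rewrite s0 (le_trans st). Qed.

Lemma simplexR s t : simplex s t -> 0 <= t <= T.
Proof. by move=> [s0 st tT]; rewrite (le_trans s0). Qed.

(** What uniqueness and existence use of the expansion A, a germ with first-order
   part S. The defect A_st(p) - A_su(p) - A_ut(q) is of order 3 kappa > 1 as soon
   as p -> q is compatible with S up to order 2 kappa; [germ_defect_diff] makes it Lipschitz
   in (p, q), distances being measured by V together with the difference of the
   first-order remainders. *)
Record rough_germ : Prop := RoughGerm {
  germ_bound : exists2 K, 0 <= K & forall s t p, simplex s t ->
    `|S s t p| <= K * pw kappa s t /\
    `|A s t p - S s t p| <= K * pw kappa s t ^+ 2;
  germ_lipschitz : exists2 K, 0 <= K & forall s t p q, simplex s t ->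
    `|S s t p - S s t q| <= K * pw kappa s t * `|p - q| /\
    `|(A s t p - S s t p) - (A s t q - S s t q)|
      <= K * pw kappa s t ^+ 2 * `|p - q|;
  germ_defect : forall c, 0 <= c -> exists2 K, 0 <= K &
    forall s u t p q, simplex s u -> simplex u t ->
    `|q - p - S s u p| <= c * pw kappa s u ^+ 2 ->
    `|A s t p - A s u p - A u t q| <= K * pw kappa s t ^+ 3;
  germ_defect_diff : forall c, 0 <= c -> exists2 K, 0 <= K &
    forall s u t p q p' q' V, simplex s u -> simplex u t ->
    `|q - p - S s u p| <= c * pw kappa s u ^+ 2 ->
    `|q' - p' - S s u p'| <= c * pw kappa s u ^+ 2 ->
    `|p - p'| <= V -> `|q - q'| <= V ->
    `|(q - p - S s u p) - (q' - p' - S s u p')| <= V * pw kappa s u ^+ 2 ->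
    `|(A s t p - A s u p - A u t q) - (A s t p' - A s u p' - A u t q')|
      <= K * V * pw kappa s t ^+ 3;
  germ_continuous : forall (F : set_system nat) (us ts : nat -> R)
      (ps : nat -> 'cV[R]_m) s t p, ProperFilter F ->
    (forall n, simplex (us n) (ts n)) -> simplex s t ->
    us @ F --> s -> ts @ F --> t -> ps @ F --> p ->
    A (us n) (ts n) (ps n) @[n --> F] --> A s t p }.

End germ_axioms.

Section rough_driver.
Context {R : realType} {m d : nat}.
Variables (T kappa : R) (zeta : R -> 'cV[R]_d) (zeta2 : R -> R -> 'M[R]_d).
Variable (sig : 'I_m -> 'I_d -> R -> 'cV[R]_m -> R).
Hypotheses (k0 : 0 < kappa) (k2 : kappa <= 2^-1).
Hypothesis ssig : forall i l, smooth T 3 (sig i l).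
Implicit Types (s u t c V : R) (p q : 'cV[R]_m).

Definition sig2 i l k s p : R :=
  \sum_j partial_x j (sig i l) s p * sig j k s p.

Lemma smooth_sig2 i l k : smooth T 2 (sig2 i l k).
Proof.
apply: smooth_sum => j; apply: smoothM; last exact/smoothW/ssig.
by have [_ _ /(_ j)[]] := ssig i l.
Qed.

Definition first_step s t p : 'cV[R]_m :=
  \col_i \sum_l sig i l s p * (zeta t - zeta s) l 0.

Definition second_step s t p : 'cV[R]_m :=
  \col_i \sum_l \sum_k sig2 i l k s p * zeta2 s t k l.

Definition davie_step s t p := first_step s t p + second_step s t p.

(** The first-order change of sigma along a step of the equation is the
   coefficient of the second-order term; this is why the defect of [davie_step]
   consists of Taylor remainders only. *)
Lemma gradient_first_step i l s t p :
  gradient (sig i l) s p (first_step s t p) =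
  \sum_k sig2 i l k s p * (zeta t - zeta s) k 0.
Proof.
rewrite /gradient /sig2.
under eq_bigr do rewrite mxE mulr_sumr.
rewrite exchange_big/=; apply: eq_bigr => k _; rewrite mulr_suml.
by apply: eq_bigr => j _; rewrite mulrA.
Qed.

Definition taylor_part i l s u p q :=
  sig i l u q - sig i l s p - gradient (sig i l) s p (first_step s u p).

Hypothesis chen : forall s u t, simplex T s u -> simplex T u t -> forall i j,
  zeta2 s t i j - zeta2 s u i j - zeta2 u t i j =
  (zeta u - zeta s) i 0 * (zeta t - zeta u) j 0.

(** The quadratic terms cancel by Chen's relation. *)
Lemma davie_step_defect s u t p q i : simplex T s u -> simplex T u t ->
  (davie_step s t p - davie_step s u p - davie_step u t q) i 0 =
  - \sum_l (taylor_part i l s u p q * (zeta t - zeta u) l 0 +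
            \sum_k (sig2 i l k u q - sig2 i l k s p) * zeta2 u t k l).
Proof.
move=> su ut; rewrite !mxE.
have -> (a b c e f g : R) : (a + b - (c + e) - (f + g)) =
   - ((f - (a - c)) + (g - (b - e))) by ring.
congr (- _); rewrite -!sumrB -big_split/=; apply: eq_bigr => l _.
rewrite /taylor_part gradient_first_step.
have -> : \sum_k (sig2 i l k u q - sig2 i l k s p) * zeta2 u t k l =
  \sum_k sig2 i l k u q * zeta2 u t k l - \sum_k sig2 i l k s p * zeta2 u t k l.
  by rewrite -sumrB; apply: eq_bigr => k _; rewrite mulrBl.
have -> : \sum_k sig2 i l k s p * zeta2 s t k l = \sum_k sig2 i l k s p * zeta2 s u k l +
   \sum_k sig2 i l k s p * zeta2 u t k l +
   (\sum_k sig2 i l k s p * (zeta u - zeta s) k 0) * (zeta t - zeta u) l 0.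
  rewrite mulr_suml -!big_split/=; apply: eq_bigr => k _.
  have := chen su ut k l => h.
  have -> : zeta2 s t k l = zeta2 s u k l + zeta2 u t k l +
     (zeta u - zeta s) k 0 * (zeta t - zeta u) l 0 by rewrite -h; ring.
  by rewrite !mulrDr !mulrA.
rewrite !mxE; ring.
Qed.

Variable C : R.
Hypothesis C0 : 0 <= C.
Hypothesis zetaC : forall s t, simplex T s t ->
  `|zeta t - zeta s| <= C * pw kappa s t.
Hypothesis zeta2C : forall s t, simplex T s t ->
  `|zeta2 s t| <= C * pw kappa s t ^+ 2.

Lemma zeta_coord s t l : simplex T s t ->
  `|(zeta t - zeta s) l 0| <= C * pw kappa s t.
Proof. by move=> st; apply: le_trans (coord_le_norm _ _ _) (zetaC st). Qed.

Lemma zeta2_coord s t k l : simplex T s t ->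
  `|zeta2 s t k l| <= C * pw kappa s t ^+ 2.
Proof. by move=> st; apply: le_trans (coord_le_norm _ _ _) (zeta2C st). Qed.

Lemma first_pairing_bound (e : 'I_d -> R) a s t : 0 <= a -> simplex T s t ->
  (forall l, `|e l| <= a) ->
  `|\sum_l e l * (zeta t - zeta s) l 0| <= d%:R * a * C * pw kappa s t.
Proof.
move=> a0 st ea; rewrite -!mulrA; apply: ler_norm_sum_ord => l.
by rewrite normrM ler_pM// zeta_coord.
Qed.

Lemma second_pairing_bound (f : 'I_d -> 'I_d -> R) b s t : 0 <= b ->
  simplex T s t -> (forall l k, `|f l k| <= b) ->
  `|\sum_l \sum_k f l k * zeta2 s t k l|
    <= d%:R * (d%:R * b) * C * pw kappa s t ^+ 2.
Proof.
move=> b0 st fb.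
have -> : d%:R * (d%:R * b) * C * pw kappa s t ^+ 2 =
  d%:R * (d%:R * (b * (C * pw kappa s t ^+ 2))) by ring.
apply: ler_norm_sum_ord => l; apply: ler_norm_sum_ord => k.
by rewrite normrM ler_pM// zeta2_coord.
Qed.

Lemma rough_pairing_bound (e : 'I_d -> R) (f : 'I_d -> 'I_d -> R) a b s u t :
  0 <= a -> 0 <= b -> simplex T s u -> simplex T u t ->
  (forall l, `|e l| <= a * pw kappa s u ^+ 2) ->
  (forall l k, `|f l k| <= b * pw kappa s u) ->
  `|\sum_l (e l * (zeta t - zeta u) l 0 + \sum_k f l k * zeta2 u t k l)|
    <= (d%:R * a * C + d%:R * (d%:R * b) * C) * pw kappa s t ^+ 3.
Proof.
move=> a0 b0 su ut ea fb; have [s0 su' _] := su; have [u0 ut' tT] := ut.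
have h1 := pw_ge0 kappa s u; have h2 := pw_ge0 kappa u t.
have r1 : pw kappa s u <= pw kappa s t.
  by apply: pw_homo => //; [exact: ltW|lra].
have r2 : pw kappa u t <= pw kappa s t.
  by apply: pw_homo => //; [exact: ltW|lra].
rewrite big_split/= mulrDl; apply: le_trans (ler_normD _ _) _; apply: lerD.
  apply: le_trans (first_pairing_bound _ ut ea) _.
    by rewrite mulr_ge0 ?exprn_ge0.
  have -> : d%:R * (a * pw kappa s u ^+ 2) * C * pw kappa u t =
    d%:R * a * C * (pw kappa s u ^+ 2 * pw kappa u t) by ring.
  rewrite (exprSr _ 2); apply: ler_wpM2l; first by rewrite !mulr_ge0.
  by apply: ler_pM; rewrite ?exprn_ge0// lerXn2r ?nnegrE// (le_trans h1).
apply: le_trans (second_pairing_bound _ ut fb) _; first by rewrite mulr_ge0.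
have -> : d%:R * (d%:R * (b * pw kappa s u)) * C * pw kappa u t ^+ 2 =
  d%:R * (d%:R * b) * C * (pw kappa s u * pw kappa u t ^+ 2) by ring.
rewrite (exprS _ 2); apply: ler_wpM2l; first by rewrite !mulr_ge0.
by apply: ler_pM; rewrite ?exprn_ge0// lerXn2r ?nnegrE// (le_trans h1).
Qed.

Lemma sig_common_bound (P : 'I_m -> 'I_d -> R -> Prop) :
  (forall i l K K', K <= K' -> P i l K -> P i l K') ->
  (forall i l, exists K, P i l K) ->
  exists2 K, 0 <= K & forall i l, P i l K.
Proof.
move=> mono ex; have [K K0 PK] := @common_bound R ('I_m * 'I_d)%type
  (fun il => P il.1 il.2) (fun il => mono il.1 il.2) (fun il => ex il.1 il.2).
by exists K => // i l; exact: (PK (i, l)).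
Qed.

Lemma sig2_common_bound (P : 'I_m -> 'I_d -> 'I_d -> R -> Prop) :
  (forall i l k K K', K <= K' -> P i l k K -> P i l k K') ->
  (forall i l k, exists K, P i l k K) ->
  exists2 K, 0 <= K & forall i l k, P i l k K.
Proof.
move=> mono ex; have [K K0 PK] := @common_bound R ('I_m * 'I_d * 'I_d)%type
  (fun ilk => P ilk.1.1 ilk.1.2 ilk.2) (fun il => mono il.1.1 il.1.2 il.2)
  (fun il => ex il.1.1 il.1.2 il.2).
by exists K => // i l k; exact: (PK (i, l, k)).
Qed.

Lemma davie_step_bound : exists2 K, 0 <= K & forall s t p, simplex T s t ->
  `|first_step s t p| <= K * pw kappa s t /\
  `|second_step s t p| <= K * pw kappa s t ^+ 2.
Proof.
have [K1 K10 b1] : exists2 K, 0 <= K & forall i l t x, 0 <= t <= T -> `|sig i l t x| <= K.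
  apply: (@sig_common_bound (fun i l K => forall t x, 0 <= t <= T -> `|sig i l t x| <= K)).
    by move=> i l K K' KK' h t x tT; apply: le_trans (h t x tT) KK'.
  by move=> i l; have [] := ssig i l.
have [K2 K20 b2] : exists2 K, 0 <= K & forall i l k t x, 0 <= t <= T -> `|sig2 i l k t x| <= K.
  apply: (@sig2_common_bound (fun i l k K => forall t x, 0 <= t <= T -> `|sig2 i l k t x| <= K)).
    by move=> i l k K K' KK' h t x tT; apply: le_trans (h t x tT) KK'.
  by move=> i l k; have [] := smooth_sig2 i l k.
exists (d%:R * K1 * C + d%:R * (d%:R * K2) * C).
  by rewrite addr_ge0 ?mulr_ge0.
move=> s t p st; have sT := simplexL st.
have r0 := pw_ge0 kappa s t.
have n1 : 0 <= d%:R * K1 * C by rewrite !mulr_ge0.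
have n2 : 0 <= d%:R * (d%:R * K2) * C by rewrite !mulr_ge0.
split; apply: cv_norm_le; rewrite ?mulr_ge0 ?addr_ge0 ?exprn_ge0// => i; rewrite mxE.
  apply: le_trans (first_pairing_bound K10 st (fun l => b1 i l s p sT)) _.
  by rewrite ler_wpM2r// lerDl.
apply: le_trans (second_pairing_bound K20 st (fun l k => b2 i l k s p sT)) _.
by rewrite ler_wpM2r ?exprn_ge0// lerDr.
Qed.

Lemma davie_step_lipschitz : exists2 K, 0 <= K & forall s t p q, simplex T s t ->
  `|first_step s t p - first_step s t q| <= K * pw kappa s t * `|p - q| /\
  `|second_step s t p - second_step s t q| <= K * pw kappa s t ^+ 2 * `|p - q|.
Proof.
have [K1 K10 b1] : exists2 K, 0 <= K & forall i l t x y, 0 <= t <= T ->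
    `|sig i l t y - sig i l t x| <= K * `|y - x|.
  apply: (@sig_common_bound (fun i l K => forall t x y, 0 <= t <= T ->
    `|sig i l t y - sig i l t x| <= K * `|y - x|)).
    move=> i l K K' KK' h t x y tT; apply: le_trans (h t x y tT) _.
    by rewrite ler_wpM2r.
  by move=> i l; have [K ? ?] := smooth_lipschitz (smoothW (smoothW (ssig i l))); exists K.
have [K2 K20 b2] : exists2 K, 0 <= K & forall i l k t x y, 0 <= t <= T ->
    `|sig2 i l k t y - sig2 i l k t x| <= K * `|y - x|.
  apply: (@sig2_common_bound (fun i l k K => forall t x y, 0 <= t <= T ->
    `|sig2 i l k t y - sig2 i l k t x| <= K * `|y - x|)).
    move=> i l k K K' KK' h t x y tT; apply: le_trans (h t x y tT) _.
    by rewrite ler_wpM2r.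
  by move=> i l k; have [K ? ?] := smooth_lipschitz (smoothW (smooth_sig2 i l k)); exists K.
exists (d%:R * K1 * C + d%:R * (d%:R * K2) * C).
  by rewrite addr_ge0 ?mulr_ge0.
move=> s t p q st; have sT := simplexL st.
have r0 := pw_ge0 kappa s t.
have n1 : 0 <= d%:R * K1 * C by rewrite !mulr_ge0.
have n2 : 0 <= d%:R * (d%:R * K2) * C by rewrite !mulr_ge0.
split; apply: cv_norm_le; rewrite ?mulr_ge0 ?addr_ge0 ?exprn_ge0// => i.
  rewrite !mxE -sumrB; under eq_bigr do rewrite -mulrBl.
  apply: le_trans (first_pairing_bound _ st (fun l => b1 i l s q p sT)) _.
    by rewrite mulr_ge0.
  have := n2; set c := d%:R * (d%:R * K2) * C => c0.
  have : 0 <= c * pw kappa s t * `|p - q| by rewrite !mulr_ge0.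
  by lra.
rewrite !mxE -sumrB; under eq_bigr do (rewrite -sumrB; under eq_bigr do rewrite -mulrBl).
apply: le_trans (second_pairing_bound _ st (fun l k => b2 i l k s q p sT)) _.
  by rewrite mulr_ge0.
have : 0 <= d%:R * K1 * C * pw kappa s t ^+ 2 * `|p - q|.
  by rewrite !mulr_ge0 ?exprn_ge0.
by lra.
Qed.

(** One constant dominating all the scales that enter the Taylor estimates. *)
Lemma step_scales c : 0 <= c -> exists2 c', 0 <= c' &
  [/\ c <= c', forall s t, simplex T s t -> 0 <= pw kappa s t <= c',
      forall s t, simplex T s t -> `|t - s| <= c' * pw kappa s t ^+ 2,
      forall s t p, simplex T s t -> `|first_step s t p| <= c' * pw kappa s t &
      forall s t p q, simplex T s t ->
        `|first_step s t p - first_step s t q| <= c' * pw kappa s t * `|p - q|].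
Proof.
move=> c0; have [c1 c10 h1] := @time_le_pw2 R T kappa k0 k2.
have [c2 c20 h2] := davie_step_bound; have [c3 c30 h3] := davie_step_lipschitz.
have c40 := powR_ge0 T kappa.
exists (c + c1 + c2 + c3 + T `^ kappa); first by rewrite !addr_ge0.
split; first by lra.
- move=> s t [s0 st tT]; rewrite pw_ge0/=.
  by have := pw_le (ltW k0) s0 st tT; lra.
- move=> s t [s0 st tT]; rewrite ger0_norm ?subr_ge0//.
  apply: le_trans (h1 _ _ s0 st tT) _; rewrite ler_wpM2r ?exprn_ge0 ?pw_ge0//; lra.
- move=> s t p st; have [h _] := h2 s t p st; apply: le_trans h _.
  by rewrite ler_wpM2r ?pw_ge0//; lra.
- move=> s t p q st; have [h _] := h3 s t p q st; apply: le_trans h _.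
  by rewrite ler_wpM2r// ler_wpM2r ?pw_ge0//; lra.
Qed.

(** Each term of [davie_step_defect] is a Taylor defect of order 2 times an increment
   of zeta, or an increment of order 1 times an increment of zeta2: order 3 in
   total. *)
Lemma davie_step_defect_bound c : 0 <= c -> exists2 K, 0 <= K &
  forall s u t p q, simplex T s u -> simplex T u t ->
    `|q - p - first_step s u p| <= c * pw kappa s u ^+ 2 ->
    `|davie_step s t p - davie_step s u p - davie_step u t q|
      <= K * pw kappa s t ^+ 3.
Proof.
move=> c0; have [c' c'0 [cc' sc1 sc2 sc3 _]] := step_scales c0.
have [K1 K10 b1] : exists2 K, 0 <= K & forall i l s u p q,
    simplex T s u -> `|q - p - first_step s u p| <= c * pw kappa s u ^+ 2 ->
    `|taylor_part i l s u p q| <= K * pw kappa s u ^+ 2.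
  apply: (@sig_common_bound (fun i l K => forall s u p q,
    simplex T s u -> `|q - p - first_step s u p| <= c * pw kappa s u ^+ 2 ->
    `|taylor_part i l s u p q| <= K * pw kappa s u ^+ 2)).
    move=> i l K K' KK' h s u p q su hp; apply: le_trans (h s u p q su hp) _.
    by rewrite ler_wpM2r ?exprn_ge0 ?pw_ge0.
  move=> i l; have [K _ bK] := taylor_defect (smoothW (ssig i l)) c'0.
  exists K => s u p q su hp.
  apply: bK; rewrite ?(simplexL su) ?(simplexR su)//; [exact: sc1|exact: sc2|exact: sc3|].
  by apply: le_trans hp _; rewrite ler_wpM2r ?exprn_ge0 ?pw_ge0.
have [K2 K20 b2] : exists2 K, 0 <= K & forall i l k s u p q,
    simplex T s u -> `|q - p - first_step s u p| <= c * pw kappa s u ^+ 2 ->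
    `|sig2 i l k u q - sig2 i l k s p| <= K * pw kappa s u.
  apply: (@sig2_common_bound (fun i l k K => forall s u p q,
    simplex T s u -> `|q - p - first_step s u p| <= c * pw kappa s u ^+ 2 ->
    `|sig2 i l k u q - sig2 i l k s p| <= K * pw kappa s u)).
    move=> i l k K K' KK' h s u p q su hp; apply: le_trans (h s u p q su hp) _.
    by rewrite ler_wpM2r ?pw_ge0.
  move=> i l k; have [K _ bK] := increment_bound (smoothW (smooth_sig2 i l k)) c'0.
  exists K => s u p q su hp.
  apply: (bK _ _ _ _ (first_step s u p)); rewrite ?(simplexL su) ?(simplexR su)//; [exact: sc1|exact: sc2|exact: sc3|].
  by apply: le_trans hp _; rewrite ler_wpM2r ?exprn_ge0 ?pw_ge0.
exists (d%:R * K1 * C + d%:R * (d%:R * K2) * C).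
  by rewrite addr_ge0 ?mulr_ge0.
move=> s u t p q su ut hp; apply: cv_norm_le => [|i].
  by rewrite !mulr_ge0 ?addr_ge0 ?exprn_ge0 ?pw_ge0 ?mulr_ge0.
rewrite davie_step_defect// normrN; apply: rough_pairing_bound => // [l|l k].
  exact: b1.
exact: b2.
Qed.

Lemma davie_step_defect_diff_bound c : 0 <= c -> exists2 K, 0 <= K &
  forall s u t p q p' q' V, simplex T s u -> simplex T u t ->
    `|q - p - first_step s u p| <= c * pw kappa s u ^+ 2 ->
    `|q' - p' - first_step s u p'| <= c * pw kappa s u ^+ 2 ->
    `|p - p'| <= V -> `|q - q'| <= V ->
    `|(q - p - first_step s u p) - (q' - p' - first_step s u p')|
      <= V * pw kappa s u ^+ 2 ->
    `|(davie_step s t p - davie_step s u p - davie_step u t q) -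
      (davie_step s t p' - davie_step s u p' - davie_step u t q')|
      <= K * V * pw kappa s t ^+ 3.
Proof.
move=> c0; have [c' c'0 [cc' sc1 sc2 sc3 sc4]] := step_scales c0.
pose close s u p q p' q' V := [/\ simplex T s u,
    `|q - p - first_step s u p| <= c * pw kappa s u ^+ 2 /\
    `|q' - p' - first_step s u p'| <= c * pw kappa s u ^+ 2,
    `|p - p'| <= V, `|q - q'| <= V &
    `|(q - p - first_step s u p) - (q' - p' - first_step s u p')|
      <= V * pw kappa s u ^+ 2].
have [K1 K10 b1] : exists2 K, 0 <= K & forall i l s u p q p' q' V,
    close s u p q p' q' V ->
    `|taylor_part i l s u p q - taylor_part i l s u p' q'| <= K * V * pw kappa s u ^+ 2.
  apply: (@sig_common_bound (fun i l K => forall s u p q p' q' V,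
    close s u p q p' q' V ->
    `|taylor_part i l s u p q - taylor_part i l s u p' q'| <= K * V * pw kappa s u ^+ 2)).
    move=> i l K K' KK' h s u p q p' q' V hp; apply: le_trans (h _ _ _ _ _ _ _ hp) _.
    have [_ _ hV _ _] := hp; have V0 := le_trans (normr_ge0 _) hV.
    by rewrite ler_wpM2r ?exprn_ge0 ?pw_ge0// ler_wpM2r.
  move=> i l; have [K _ bK] := taylor_defect_diff (ssig i l) c'0.
  exists K => s u p q p' q' V [su [hp hp'] pV qV rV].
  have V0 := le_trans (normr_ge0 _) pV.
  apply: bK; rewrite ?(simplexL su) ?(simplexR su)//;
    [exact: sc1|exact: sc2|exact: sc3|exact: sc3| | |].
  - by apply: le_trans hp _; rewrite ler_wpM2r ?exprn_ge0 ?pw_ge0.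
  - by apply: le_trans hp' _; rewrite ler_wpM2r ?exprn_ge0 ?pw_ge0.
  - by apply: le_trans (sc4 _ _ _ _ su) _; rewrite ler_wpM2l// mulr_ge0// pw_ge0.
have [K2 K20 b2] : exists2 K, 0 <= K & forall i l k s u p q p' q' V,
    close s u p q p' q' V ->
    `|(sig2 i l k u q - sig2 i l k s p) - (sig2 i l k u q' - sig2 i l k s p')|
       <= K * V * pw kappa s u.
  apply: (@sig2_common_bound (fun i l k K => forall s u p q p' q' V,
    close s u p q p' q' V ->
    `|(sig2 i l k u q - sig2 i l k s p) - (sig2 i l k u q' - sig2 i l k s p')|
       <= K * V * pw kappa s u)).
    move=> i l k K K' KK' h s u p q p' q' V hp; apply: le_trans (h _ _ _ _ _ _ _ hp) _.
    have [_ _ hV _ _] := hp; have V0 := le_trans (normr_ge0 _) hV.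
    by rewrite ler_wpM2r ?pw_ge0// ler_wpM2r.
  move=> i l k; have [K _ bK] := increment_diff_bound (smooth_sig2 i l k) c'0.
  exists K => s u p q p' q' V [su [hp hp'] pV qV rV].
  have V0 := le_trans (normr_ge0 _) pV.
  apply: (bK _ _ _ _ (first_step s u p) _ _ (first_step s u p')); rewrite ?(simplexL su) ?(simplexR su)//;
    [exact: sc1|exact: sc2|exact: sc3| |].
  - by apply: le_trans hp _; rewrite ler_wpM2r ?exprn_ge0 ?pw_ge0.
  - by apply: le_trans (sc4 _ _ _ _ su) _; rewrite ler_wpM2l// mulr_ge0// pw_ge0.
exists (d%:R * K1 * C + d%:R * (d%:R * K2) * C).
  by rewrite addr_ge0 ?mulr_ge0.
move=> s u t p q p' q' V su ut hp hp' pV qV rV.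
have V0 := le_trans (normr_ge0 _) pV.
have cl : close s u p q p' q' V by [].
apply: cv_norm_le => [|i].
  by rewrite !mulr_ge0 ?addr_ge0 ?exprn_ge0 ?pw_ge0 ?mulr_ge0.
have mxB (a b : 'cV[R]_m) : (a - b) i 0 = a i 0 - b i 0 by rewrite !mxE.
rewrite mxB !davie_step_defect// -opprD normrN -sumrB.
have E l : taylor_part i l s u p q * (zeta t - zeta u) l 0 +
    \sum_k (sig2 i l k u q - sig2 i l k s p) * zeta2 u t k l -
    (taylor_part i l s u p' q' * (zeta t - zeta u) l 0 +
    \sum_k (sig2 i l k u q' - sig2 i l k s p') * zeta2 u t k l) =
  (taylor_part i l s u p q - taylor_part i l s u p' q') * (zeta t - zeta u) l 0 +
  \sum_k ((sig2 i l k u q - sig2 i l k s p) - (sig2 i l k u q' - sig2 i l k s p'))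
    * zeta2 u t k l.
  rewrite opprD addrACA -mulrBl -sumrB; congr (_ + _).
  by apply: eq_bigr => k _; rewrite -mulrBl.
under eq_bigr do rewrite E.
have -> : (d%:R * K1 * C + d%:R * (d%:R * K2) * C) * V =
   d%:R * (K1 * V) * C + d%:R * (d%:R * (K2 * V)) * C by ring.
apply: rough_pairing_bound => // [||l|l k]; try exact: mulr_ge0.
  exact: b1.
exact: b2.
Qed.

Hypothesis zeta2_cont :
  {within [set w : R * R | 0 <= w.1 /\ w.1 <= w.2 /\ w.2 <= T],
     continuous (fun w : R * R => zeta2 w.1 w.2)}.

Lemma zeta_dist s t : 0 <= s <= T -> 0 <= t <= T ->
  `|zeta t - zeta s| <= C * `|t - s| `^ kappa.
Proof.
move=> /andP[s0 sT] /andP[t0 tT]; have [st|/ltW ts] := leP s t.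
  by rewrite ger0_norm ?subr_ge0//; exact: zetaC.
by rewrite distrC (distrC t) ger0_norm ?subr_ge0//; exact: zetaC.
Qed.

Lemma davie_step_continuous (F : set_system nat) (us ts : nat -> R)
    (ps : nat -> 'cV[R]_m) s t p : ProperFilter F ->
    (forall n, simplex T (us n) (ts n)) -> simplex T s t ->
    us @ F --> s -> ts @ F --> t -> ps @ F --> p ->
    davie_step (us n) (ts n) (ps n) @[n --> F] --> davie_step s t p.
Proof.
move=> FF ut st hu ht hp.
have sT := simplexL st; have tT := simplexR st.
have dist0 (v : nat -> R) a : v @ F --> a -> `|v n - a| @[n --> F] --> 0.
  by move=> va; rewrite -(@normr0 _ R) -(subrr a); apply: cvg_norm; apply: cvgB => //; exact: cvg_cst.
have hpn : `|ps n - p| @[n --> F] --> 0.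
  rewrite -(@normr0 _ 'cV[R]_m) -(subrr p); apply: cvg_norm.
  by apply: cvgB => //; exact: cvg_cst.
have csmooth f : smooth T 1 f -> f (us n) (ps n) @[n --> F] --> f s p.
  move=> sf; have [_ [K1 h1] _] := sf; have [K2 _ h2] := smooth_lipschitz sf.
  apply: (cvg_of_bound (g := fun n => K1 * `|us n - s| + K2 * `|ps n - p|)) => [n|].
    rewrite -(subrK (f s (ps n)) (f (us n) (ps n))) -addrA.
    apply: le_trans (ler_normD _ _) _; apply: lerD; last exact: h2.
    by apply: h1 => //; exact: simplexL (ut n).
  have -> : (0 : R) = K1 * 0 + K2 * 0 by rewrite !mulr0 addr0.
  by apply: cvgD; apply: cvgMl_tmp; [exact: dist0|exact: hpn].
have czeta (v : nat -> R) a : v @ F --> a -> (forall n, 0 <= v n <= T) -> 0 <= a <= T ->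
    zeta (v n) @[n --> F] --> zeta a.
  move=> va vT aT.
  apply: (cvg_of_bound (g := fun n => C * `|v n - a| `^ kappa)) => [n|].
    exact: zeta_dist.
  rewrite -(mulr0 C); apply: cvgMl_tmp; apply: cvg_powR0 => //; exact: dist0.
have ccoord n1 n2 (v : nat -> 'M[R]_(n1, n2)) (w : 'M[R]_(n1, n2)) i j : v @ F --> w ->
    v n i j @[n --> F] --> w i j.
  by move=> vw; have := cvg_comp _ _ vw (@coord_continuous _ _ _ i j w).
have czeta2 : zeta2 (us n) (ts n) @[n --> F] --> zeta2 s t.
  have /subspace_continuousP/(_ (s, t)) := zeta2_cont.
  case: st => s0 st tT'; move=> /(_ (conj s0 (conj st tT'))) h.
  suff hut : (us n, ts n) @[n --> F] --> within
      [set w : R * R | 0 <= w.1 /\ w.1 <= w.2 /\ w.2 <= T] (nbhs (s, t)).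
    exact: (cvg_trans (cvg_app _ hut) h).
  have hp' : (us n, ts n) @[n --> F] --> (s, t) by exact: (cvg_pair hu ht).
  move=> B hB; have hB' : F (fun n => 0 <= us n /\ us n <= ts n /\ ts n <= T ->
    B (us n, ts n)) := hp' _ hB.
  change (F (fun n => B (us n, ts n))).
  by apply: filterS hB' => n; apply; have [] := ut n.
apply: cvg_coordinates => i; rewrite !mxE.
under eq_fun do rewrite !mxE.
apply: cvgD.
  apply: cvg_sum_ord => l; apply: cvgM; first exact/csmooth/smoothW/smoothW.
  apply: (ccoord _ _ (fun n => zeta (ts n) - zeta (us n)) (zeta t - zeta s)).
  apply: cvgB; apply: czeta => // n; [exact: simplexR (ut n)|exact: simplexL (ut n)].
apply: cvg_sum_ord => l; apply: cvg_sum_ord => k.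
apply: cvgM; first exact/csmooth/smoothW/smooth_sig2.
exact: (ccoord _ _ (fun n => zeta2 (us n) (ts n))).
Qed.

Lemma davie_step_germ : rough_germ T kappa davie_step first_step.
Proof.
have E s t p : davie_step s t p - first_step s t p = second_step s t p.
  by rewrite /davie_step addrC addKr.
split.
- by have [K K0 h] := davie_step_bound; exists K => // s t p; rewrite E; exact: h.
- have [K K0 h] := davie_step_lipschitz; exists K => // s t p q; rewrite !E; exact: h.
- exact: davie_step_defect_bound.
- exact: davie_step_defect_diff_bound.
- exact: davie_step_continuous.
Qed.

End rough_driver.

(** * Uniqueness of Davie solutions *)

Section davie_uniqueness.
Context {R : realType} {m : nat}.
Variables (T kappa : R) (A S : R -> R -> 'cV[R]_m -> 'cV[R]_m).
Hypotheses (k3 : 3^-1 < kappa) (k2 : kappa <= 2^-1).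
Hypothesis germ : rough_germ T kappa A S.
Implicit Types (s t u V a h : R) (x z G H : R -> 'cV[R]_m).

(** Remainder of the expansion of x, G being the integral of the drift along
   x. *)
Definition davie_rem x G s t : 'cV[R]_m :=
  x t - x s - (G t - G s) - A s t (x s).

Definition davie_solution x G : Prop :=
  exists2 N, 0 <= N & forall s t, simplex T s t ->
    `|davie_rem x G s t| <= N * pw kappa s t ^+ 3.

Definition lipschitz_drift G : Prop :=
  exists2 M, 0 <= M & forall s t, simplex T s t -> `|G t - G s| <= M * (t - s).

Lemma davie_rem_split x G s u t :
  davie_rem x G s t = davie_rem x G s u + davie_rem x G u t
    - (A s t (x s) - A s u (x s) - A u t (x u)).
Proof. by apply/matrixP => i j; rewrite /davie_rem !mxE; ring. Qed.

Lemma midpoint s t : simplex T s t -> exists2 u, simplex T s u & simplex T u t /\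
  u - s = 2^-1 * (t - s) /\ t - u = 2^-1 * (t - s).
Proof.
move=> [s0 st tT]; exists ((s + t) / 2); first by split=> //; lra.
by split; [split=> //; lra|split; lra].
Qed.

Lemma geometric_bound0 (y mu V0 : R) : 0 <= mu < 1 ->
  (forall n, y <= mu ^+ n * V0) -> y <= 0.
Proof.
move=> /andP[mu0 mu1] h.
have c : mu ^+ n * V0 @[n --> \oo] --> 0.
  have := @cvg_geometric R V0 mu.
  rewrite ger0_norm// => /(_ mu1); apply: cvg_trans; apply: near_eq_cvg.
  by near=> n; rewrite /geometric/= mulrC.
by apply: (cvgr_to_ge c); near=> n; exact: h.
Unshelve. all: by end_near. Qed.

Let k0 : 0 < kappa. Proof. by apply: lt_trans k3; rewrite invr_gt0. Qed.

(** The drift, of order 1, and the remainder, of order 3 kappa, are both dominated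
   by order 2 kappa. *)
Lemma first_order_remainder x G : davie_solution x G -> lipschitz_drift G ->
  exists2 c, 0 <= c & forall s t, simplex T s t ->
    `|x t - x s - S s t (x s)| <= c * pw kappa s t ^+ 2.
Proof.
move=> [N N0 hN] [M M0 hM]; have [c1 c10 h1] := time_le_pw2 T k0 k2.
have [K K0 hK] := germ_bound germ.
exists (M * c1 + K + N * T `^ kappa).
  by rewrite !addr_ge0 ?mulr_ge0 ?powR_ge0.
move=> s t st; have [s0 st' tT] := st.
have -> : x t - x s - S s t (x s) =
    (G t - G s) + (A s t (x s) - S s t (x s)) + davie_rem x G s t.
  by apply/matrixP => i j; rewrite /davie_rem !mxE; ring.
rewrite !mulrDl; apply: le_trans (ler_normD _ _) _; apply: lerD.
  apply: le_trans (ler_normD _ _) _; apply: lerD; last by have [] := hK s t (x s) st.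
  by apply: le_trans (hM _ _ st) _; rewrite -mulrA ler_wpM2l ?h1.
apply: le_trans (hN _ _ st) _; rewrite exprS mulrA ler_wpM2r ?exprn_ge0 ?pw_ge0//.
by rewrite ler_wpM2l// pw_le// ltW.
Qed.

Lemma davie_bounded x G : davie_solution x G -> lipschitz_drift G ->
  exists2 c, 0 <= c & forall s t, simplex T s t ->
    `|x t - x s| <= c * pw kappa s t.
Proof.
move=> dx dG; have [c c0 hc] := first_order_remainder dx dG.
have [K K0 hK] := germ_bound germ.
exists (c * T `^ kappa + K); first by rewrite addr_ge0 ?mulr_ge0 ?powR_ge0.
move=> s t st; have [s0 st' tT] := st; rewrite -(subrK (S s t (x s)) (x t - x s)) mulrDl.
apply: le_trans (ler_normD _ _) _; apply: lerD; last by have [] := hK s t (x s) st.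
apply: le_trans (hc _ _ st) _; rewrite exprS mulrA ler_wpM2r ?pw_ge0//.
by rewrite ler_wpM2l// pw_le// ltW.
Qed.

Section two_solutions.
Variables (x z G H : R -> 'cV[R]_m).
Hypotheses (dx : davie_solution x G) (dz : davie_solution z H).
Hypotheses (lG : lipschitz_drift G) (lH : lipschitz_drift H).
Variable L : R.
Hypotheses (L0 : 0 <= L).
Hypothesis driftL : forall s t V, simplex T s t ->
  (forall u, s <= u <= t -> `|x u - z u| <= V) ->
  `|(G t - G s) - (H t - H s)| <= L * V * (t - s).

(** An a priori bound V on the distance of two solutions over [a, a + h],
   together with the corresponding bound on the difference of their
   remainders. *)
Definition block_estimate E a h V :=
  (forall t, a <= t <= a + h -> t <= T -> `|x t - z t| <= V) /\
  (forall s t, simplex T s t -> a <= s -> t <= a + h ->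
    `|davie_rem x G s t - davie_rem z H s t| <= E * V * pw kappa s t ^+ 3).

(** The two bounds improve simultaneously. At the midpoint of [s, t] the
   difference of the remainders splits into those over the two halves, which
   contribute the factor [half_rate kappa] < 1, and a difference of defects, which
   is at most a constant times V (t - s)^(3 kappa) by [germ_defect_diff]. For E
   large the bound E V therefore becomes mu E V; and on a short block the drift and
   the remainder together change x - z by at most mu V. *)
Lemma block_contraction : exists E h mu, [/\ 1 <= E, 0 < h, 0 <= mu < 1 &
  forall a V, 0 <= a -> 0 <= V -> x a = z a -> block_estimate E a h V ->
    block_estimate E a h (mu * V)].
Proof.
have [kl [kp [kp2 L0']]] := conj k3 (conj k0 (conj k2 L0)).
have [c1 c10 h1] := time_le_pw2 T k0 k2.
have [K2 K20 hK2] := germ_lipschitz germ.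
have [c2 c20 h2] := first_order_remainder dx lG.
have [c3 c30 h3] := first_order_remainder dz lH.
have [K3 K30 hK3] := germ_defect_diff germ (addr_ge0 c20 c30).
have l0 := half_rate_ge0 kappa; have l1 := half_rate_lt1 k3.
pose la := half_rate kappa; pose mu := (1 + la) / 2.
have lamu : 0 < mu - la by rewrite /mu /la; lra.
pose K4 := L * c1 + K2 + 1.
have K40 : 0 <= K4 by rewrite /K4 !addr_ge0// mulr_ge0.
pose E := K3 * (K4 + 1) / (mu - la) + 1.
have E1 : 1 <= E by rewrite lerDr divr_ge0 ?(ltW lamu)// mulr_ge0// addr_ge0.
have E0 : 0 <= E by rewrite (le_trans _ E1).
have mu01 : 0 < mu < 1 by rewrite /mu; apply/andP; split; rewrite /la; lra.
(* The midpoint of [la] and 1 leaves room for the defect once E is large. *)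
have muE : la * E + K3 * (K4 + 1) <= mu * E.
  rewrite -lerBrDl -mulrBl /E (mulrDr (mu - la)) [(mu - la) * (_ / _)]mulrC.
  by rewrite divfK ?gt_eqF// mulr1 lerDl ltW.
have /andP[mu0 mu1] := mu01.
have EL : 0 < E + L + 1 by lra.
have [h /andP[h0 h1'] he] := @small_pw _ kappa (mu / (E + L + 1)) k0 (divr_gt0 mu0 EL).
have hELmu : (E + L) * h `^ kappa <= mu.
  apply: (@le_trans _ _ ((E + L + 1) * h `^ kappa)).
    by rewrite ler_wpM2r ?powR_ge0//; lra.
  by apply: le_trans (ler_wpM2l (ltW EL) he) _; rewrite mulrCA mulfV ?gt_eqF// mulr1.
have hk0 := powR_ge0 h kappa.
have Eh : E * h `^ kappa <= 1.
  by have := mulr_ge0 L0 hk0; lra.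
have hk1 : h `^ kappa <= 1 by apply: le_trans Eh; rewrite ler_peMl.
have hh : h <= h `^ kappa by apply: ger1_powR; rewrite ?h0//; lra.
clear lamu EL he; clearbody E mu.
exists E, h, mu; split => //; first by rewrite (ltW mu0).
move=> a V a0 V0 xa [wV RV]; split.
  move=> t /andP[at' tah] tT.
  have sat : simplex T a t by split.
  have r0 := pw_ge0 kappa a t.
  have rh : pw kappa a t <= h `^ kappa.
    by apply: ge0_ler_powR; rewrite ?nnegrE ?(ltW k0) ?(ltW h0) ?subr_ge0// lerBlDl.
  have -> : x t - z t = ((G t - G a) - (H t - H a)) +
      (davie_rem x G a t - davie_rem z H a t).
    by apply/matrixP => i j; rewrite /davie_rem xa !mxE; ring.
  apply: (@le_trans _ _ (L * V * h + E * V * h `^ kappa)); last first.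
    by have := ler_wpM2r V0 hELmu; have := ler_wpM2l (mulr_ge0 L0 V0) hh; lra.
  apply: le_trans (ler_normD _ _) _; apply: lerD.
    apply: (@le_trans _ _ (L * V * (t - a))); last by rewrite ler_wpM2l ?mulr_ge0// lerBlDl.
    apply: driftL => // u /andP[au ut].
    by apply: wV; rewrite ?au/= (le_trans ut).
  apply: le_trans (RV _ _ sat _ tah) _ => //; rewrite ler_wpM2l ?mulr_ge0//.
  have r1 : pw kappa a t <= 1 := le_trans rh hk1.
  apply: le_trans rh.
  by rewrite exprS ler_piMr// exprn_ile1// r0 r1.
move=> s t st as' ta; have [s0 st' tT] := st.
have [u su [ut [us tu]]] : exists2 u, simplex T s u & simplex T u t /\
    u - s = 2^-1 * (t - s) /\ t - u = 2^-1 * (t - s).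
  exact: midpoint.
have [_ su' uT] := su; have [u0 ut' _] := ut.
have near_s r : s <= r -> r <= u -> `|x r - z r| <= V.
  move=> sr ru; apply: wV; last exact: le_trans uT.
  by rewrite (le_trans as')//= (le_trans ru)// (le_trans ut').
have uah : u <= a + h := le_trans ut' ta.
have r0 := pw_ge0 kappa s u.
have rh : pw kappa s u <= h `^ kappa.
  apply: ge0_ler_powR; rewrite ?nnegrE ?(ltW k0) ?(ltW h0) ?subr_ge0// lerBlDl.
  by apply: le_trans uah _; rewrite lerD2r.
rewrite (davie_rem_split x G s u t) (davie_rem_split z H s u t).
set dA := A s t (x s) - _ - _; set dA' := A s t (z s) - _ - _.
have -> : davie_rem x G s u + davie_rem x G u t - dA
     - (davie_rem z H s u + davie_rem z H u t - dA') =
   (davie_rem x G s u - davie_rem z H s u) + (davie_rem x G u t - davie_rem z H u t)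
   - (dA - dA').
  clearbody dA dA'; move: (davie_rem x G s u) (davie_rem x G u t)
    (davie_rem z H s u) (davie_rem z H u t) => d1 d2 d3 d4.
  by apply/matrixP => i j; rewrite !mxE; ring.
have V40 : V <= (K4 + 1) * V by rewrite ler_peMl// lerDr.
have hd : `|dA - dA'| <= K3 * ((K4 + 1) * V) * pw kappa s t ^+ 3.
  apply: hK3 => //.
  - by apply: le_trans (h2 _ _ su) _; rewrite ler_wpM2r ?exprn_ge0 ?pw_ge0// lerDl.
  - by apply: le_trans (h3 _ _ su) _; rewrite ler_wpM2r ?exprn_ge0 ?pw_ge0// lerDr.
  - by apply: le_trans V40; exact: near_s.
  - by apply: le_trans V40; exact: near_s.
  have -> : x u - x s - S s u (x s) - (z u - z s - S s u (z s)) =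
     ((G u - G s) - (H u - H s)) +
     ((A s u (x s) - S s u (x s)) - (A s u (z s) - S s u (z s))) +
     (davie_rem x G s u - davie_rem z H s u).
    by apply/matrixP => i j; rewrite /davie_rem !mxE; ring.
  have r20 : 0 <= pw kappa s u ^+ 2 by rewrite exprn_ge0.
  apply: (@le_trans _ _ (L * V * (c1 * pw kappa s u ^+ 2) + K2 * pw kappa s u ^+ 2 * V +
     1 * V * pw kappa s u ^+ 2)); last first.
    by have := mulr_ge0 V0 r20; rewrite /K4; lra.
  apply: le_trans (ler_normD _ _) _; apply: lerD; first
    (apply: le_trans (ler_normD _ _) _; apply: lerD).
  - apply: (@le_trans _ _ (L * V * (u - s))); last by rewrite ler_wpM2l ?mulr_ge0// h1.
    by apply: driftL => // r /andP[sr ru]; exact: near_s.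
  - have [_ hS] := hK2 s u (x s) (z s) su; apply: le_trans hS _.
    by rewrite ler_wpM2l ?mulr_ge0//; exact: near_s.
  - apply: le_trans (RV _ _ su as' uah) _.
    have -> : E * V * pw kappa s u ^+ 3 = (E * pw kappa s u) * V * pw kappa s u ^+ 2 by ring.
    rewrite ler_wpM2r// ler_wpM2r//.
    by apply: le_trans Eh; rewrite ler_wpM2l.
have p1 : 2 * pw kappa s u ^+ 3 <= la * pw kappa s t ^+ 3.
  by apply: pw_half; rewrite ?(ltW k0) ?us ?tu.
have p2 : 2 * pw kappa u t ^+ 3 <= la * pw kappa s t ^+ 3.
  by apply: pw_half; rewrite ?(ltW k0) ?us ?tu.
apply: (@le_trans _ _ (E * V * pw kappa s u ^+ 3 + E * V * pw kappa u t ^+ 3 +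
   K3 * ((K4 + 1) * V) * pw kappa s t ^+ 3)).
  apply: le_trans (ler_normB _ _) _; apply: lerD => //.
  apply: le_trans (ler_normD _ _) _; apply: lerD; apply: RV => //.
  exact: le_trans as' su'.
have EV : 0 <= E * V by rewrite mulr_ge0.
apply: (@le_trans _ _ ((la * E + K3 * (K4 + 1)) * V * pw kappa s t ^+ 3)).
  have := lerD (ler_wpM2l EV p1) (ler_wpM2l EV p2).
  move: (pw _ _ _ ^+ 3) (pw _ _ _ ^+ 3) (pw _ _ _ ^+ 3) => q1 q2 q3.
  lra.
rewrite (mulrCA E) (mulrA mu) ler_wpM2r ?exprn_ge0 ?pw_ge0// ler_wpM2r//.
Qed.

(** Iterating [block_contraction] gives x = z on a block starting from a common
   value; finitely many blocks of the same length cover [0, T]. *)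
Lemma davie_unique : x 0 = z 0 -> forall t, 0 <= t <= T -> x t = z t.
Proof.
move=> xz0; have [E [h [mu [E1 h0 mu01 contr]]]] := block_contraction.
have [N N0 hN] := dx; have [N' N'0 hN'] := dz.
have [c c0 hc] := davie_bounded dx lG; have [c' c'0 hc'] := davie_bounded dz lH.
have Tk := powR_ge0 T kappa.
have Tk3 : 0 <= (c + c') * T `^ kappa by rewrite mulr_ge0// addr_ge0.
pose V0 := (c + c') * T `^ kappa + N + N'.
have V00 : 0 <= V0 by rewrite /V0; lra.
have block a t : 0 <= a -> x a = z a -> a <= t <= a + h -> t <= T -> x t = z t.
  move=> a0 xa at' tT; apply/eqP; rewrite -subr_eq0 -normr_le0.
  have /andP[mu0 _] := mu01.
  apply: (geometric_bound0 mu01 (V0 := V0)) => n.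
  suff [w _] : block_estimate E a h (mu ^+ n * V0) by exact: w.
  elim: n => [|n ih]; last first.
    by rewrite exprS -mulrA; apply: contr => //; rewrite mulr_ge0 ?exprn_ge0.
  rewrite expr0 mul1r; split.
    move=> r /andP[ar _] rT; have s0r : simplex T 0 r by split=> //; exact: le_trans ar.
    have -> : x r - z r = (x r - x 0) - (z r - z 0) by rewrite xz0 opprB addrA subrK.
    apply: le_trans (ler_normB _ _) _.
    have h1 := hc _ _ s0r; have h2 := hc' _ _ s0r.
    have h3 : pw kappa 0 r <= T `^ kappa by have [? ? ?] := s0r; rewrite pw_le// ltW.
    have h4 := ler_wpM2l (addr_ge0 c0 c'0) h3.
    by rewrite /V0; lra.
  move=> s r sr _ _; apply: le_trans (ler_normB _ _) _.
  have h1 := hN _ _ sr; have h2 := hN' _ _ sr.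
  have p0 : 0 <= pw kappa s r ^+ 3 by rewrite exprn_ge0 ?pw_ge0.
  have h3 : N + N' <= E * V0 by rewrite /V0; nra.
  by have := ler_wpM2r p0 h3; lra.
have iter n : forall t, 0 <= t <= T -> t <= n%:R * h -> x t = z t.
  elim: n => [|n ih] t /andP[t0 tT].
    by rewrite mul0r => t0'; have -> : t = 0 by apply: le_anti; rewrite t0 t0'.
  rewrite -natr1 mulrDl mul1r => tn; have [tnh|nht] := leP t (n%:R * h).
    by apply: ih => //; rewrite t0.
  have nh0 : 0 <= n%:R * h by rewrite mulr_ge0// ltW.
  apply: (block (n%:R * h)) => //; last by rewrite (ltW nht).
  by apply: ih => //; rewrite nh0/= (le_trans (ltW nht)).
move=> t tT; apply: (iter (Num.truncn (T / h)).+1) => //.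
have /andP[_ tT'] := tT; apply: le_trans tT' _.
by rewrite -ler_pdivrMr// ltW// truncnS_gt.
Qed.

End two_solutions.

End davie_uniqueness.

(** * Euler schemes *)

Section ultrafilter_limits.
Context {R : realType} (F : set_system nat) {UF : UltraFilter F}.

(** Bounded sequences converge along an ultrafilter, by compactness. This
   replaces the extraction of a subsequence that is uniformly convergent. *)
Lemma ultra_bounded_cvg (u : nat -> R) (M : R) :
  (\forall n \near F, `|u n| <= M) -> cvg (u @ F).
Proof.
move=> uM; have FuM : (u @ F) `[- M, M]%classic.
  by apply: filterS uM => n; rewrite /= in_itv/= ler_norml.
have [l [_ cl]] := segment_compact (fmap_proper_filter u ultra_proper) FuM.
apply/cvg_ex; exists l => B Bl.
have [//|FB] := in_ultra_setVsetC (u @^-1` B) UF.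
by have [a [na Ba]] := cl (~` B) B FB Bl.
Qed.

End ultrafilter_limits.

(** An interval of an odd number of steps has no middle node. Removing a
   middle step [q, q + 1] leaves two pieces that are at most half as long, which
   is enough since Euler remainders vanish on single steps. *)
Lemma midpoint_index (i j : nat) : (i < j)%N -> exists q,
  [/\ (i <= q < j)%N, (2 * (q - i) <= j - i)%N, (2 * (j - q.+1) <= j - i)%N,
      (q - i < j - i)%N & (j - q.+1 < j - i)%N].
Proof.
move=> ij; exists (i + (j - i)./2)%N; have := odd_double_half (j - i).
by move: (odd _) (_./2) => b h; rewrite -muln2; case: b => /=; split; lia.
Qed.

Lemma half_rate_closure (R : realDomainType) (N la K x1 x2 P : R) :
  0 <= N -> N * la + 2 * K = N -> 2 * x1 <= la * P -> 2 * x2 <= la * P ->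
  N * x1 + (N * x2 + K * P) + K * P <= N * P.
Proof.
move=> N0 NE h1 h2; rewrite -{3}NE.
have := ler_wpM2l N0 h1; have := ler_wpM2l N0 h2; lra.
Qed.

Section euler_scheme.
Context {R : realType} {m : nat}.
Variables (T kappa : R) (A S : R -> R -> 'cV[R]_m -> 'cV[R]_m).
Hypotheses (T0 : 0 < T) (k3 : 3^-1 < kappa) (k2 : kappa <= 2^-1).
Hypothesis germ : rough_germ T kappa A S.
Variables (B : R -> 'cV[R]_m -> 'cV[R]_m) (M LB : R).
Hypotheses (M0 : 0 <= M) (BM : forall t x, 0 <= t <= T -> `|B t x| <= M).
Variable y : 'cV[R]_m.
Implicit Types (s t : R) (n i j k q : nat).

Let k0 : 0 < kappa. Proof. by apply: lt_trans k3; rewrite invr_gt0. Qed.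

(** The scheme on the uniform grid of [0, T] with n steps: e is the Euler
   polygon at the nodes g, and D its accumulated drift. *)
Record euler_grid n (tau : R) (g : nat -> R) (e D : nat -> 'cV[R]_m) : Prop :=
  EulerGrid {
    mesh_gt0 : 0 < tau;
    mesh_total : n%:R * tau = T;
    grid_node : forall k, g k = k%:R * tau;
    euler0 : e 0%N = y;
    drift0 : D 0%N = 0;
    drift_step : forall k, D k.+1 = D k + tau *: B (g k) (e k);
    euler_step : forall k, e k.+1 = e k + (D k.+1 - D k) + A (g k) (g k.+1) (e k) }.

Lemma euler_grid_ex n : exists g e D, euler_grid n.+1 (T / n.+1%:R) g e D.
Proof.
pose tau := T / n.+1%:R; pose g k := k%:R * tau.
pose step k (eD : 'cV[R]_m * 'cV[R]_m) := (eD.1 + tau *: B (g k) eD.1 + A (g k) (g k.+1) eD.1,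
  eD.2 + tau *: B (g k) eD.1).
pose run k := iteri k step (y, 0).
exists g, (fun k => (run k).1), (fun k => (run k).2); split=> //.
- by rewrite divr_gt0.
- by rewrite mulrCA mulfV ?mulr1// pnatr_eq0.
- by move=> k /=; congr (_ + _ + _); rewrite addrAC subrr add0r.
Qed.

Section fixed_grid.
Variables (n : nat) (tau : R) (g : nat -> R) (e D : nat -> 'cV[R]_m).
Hypothesis grid : euler_grid n tau g e D.

Definition euler_rem i j : 'cV[R]_m :=
  e j - e i - (D j - D i) - A (g i) (g j) (e i).

Lemma gridB i j : (i <= j)%N -> g j - g i = (j - i)%:R * tau.
Proof. by move=> ij; rewrite !(grid_node grid) -mulrBl natrB. Qed.

Lemma grid_le i j : (i <= j)%N -> g i <= g j.
Proof.
by move=> ij; rewrite -subr_ge0 gridB// mulr_ge0// ltW// (mesh_gt0 grid).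
Qed.

Lemma grid_simplex i j : (i <= j)%N -> (j <= n)%N -> simplex T (g i) (g j).
Proof.
move=> ij jn; split; [|exact: grid_le|].
  by rewrite (grid_node grid) mulr_ge0// ltW// (mesh_gt0 grid).
by rewrite -(mesh_total grid) -(grid_node grid) grid_le.
Qed.

Lemma euler_rem_split i q j :
  euler_rem i j = euler_rem i q + euler_rem q j
   - (A (g i) (g j) (e i) - A (g i) (g q) (e i) - A (g q) (g j) (e q)).
Proof. by apply/matrixP => a c; rewrite /euler_rem !mxE; ring. Qed.

Lemma euler_rem_succ i : euler_rem i i.+1 = 0.
Proof.
rewrite /euler_rem (euler_step grid).
by apply/matrixP => a c; rewrite !mxE; ring.
Qed.

(** Both parts of the germ vanish on the diagonal since [pw kappa t t] = 0. *)
Lemma germ_diag t p : 0 <= t <= T -> A t t p = 0.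
Proof.
move=> /andP[t0 tT]; have [K K0 hK] := germ_bound germ.
have [] := hK t t p; first by split.
rewrite pwxx// expr2 !mulr0 !normr_le0 subr_eq0 => /eqP St /eqP.
by rewrite St.
Qed.

Lemma euler_rem_diag i : (i <= n)%N -> euler_rem i i = 0.
Proof.
move=> iN; rewrite /euler_rem germ_diag; last exact: simplexL (grid_simplex (leqnn i) iN).
by rewrite !subrr.
Qed.

Lemma euler_drift_approx i j (v : 'cV[R]_m) (eta : R) : (i <= j)%N ->
  (forall k, (i <= k < j)%N -> `|B (g k) (e k) - v| <= eta) ->
  `|(D j - D i) - (g j - g i) *: v| <= eta * (g j - g i).
Proof.
have tau0 := mesh_gt0 grid.
move=> ij; rewrite gridB//; have [l jE] : exists l, j = (i + l)%N.
  by exists (j - i)%N; rewrite subnKC.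
rewrite jE addKn; elim: l {j ij jE} => [|l ih] h.
  by rewrite addn0 subrr mul0r scale0r subrr normr0 mulr0.
rewrite addnS (drift_step grid).
have -> : D (i + l)%N + tau *: B (g (i + l)%N) (e (i + l)%N) - D i - (l.+1%:R * tau) *: v =
  (D (i + l)%N - D i - (l%:R * tau) *: v) + tau *: (B (g (i + l)%N) (e (i + l)%N) - v).
  by apply/matrixP => a c; rewrite !mxE -natr1; ring.
apply: le_trans (ler_normD _ _) _; rewrite -natr1 mulrDl mulrDr mul1r.
apply: lerD.
  by apply: ih => k /andP[ik kl]; apply: h; rewrite ik addnS ltnS ltnW.
rewrite normrZ gtr0_norm// mulrC ler_wpM2r ?(ltW tau0)//.
by apply: h; rewrite leq_addr addnS ltnSn.
Qed.

Lemma euler_drift_lipschitz i j : (i <= j)%N -> (j <= n)%N ->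
  `|D j - D i| <= M * (g j - g i).
Proof.
move=> ij jn; have := @euler_drift_approx i j 0 M ij.
rewrite scaler0 subr0; apply=> k /andP[ik kj]; rewrite subr0; apply: BM.
exact: simplexL (grid_simplex (ltnW kj) jn).
Qed.

End fixed_grid.

(** Discrete sewing. The bound for [i, j] follows from those for the pieces
   [i, q] and [q + 1, j] of half length, which together cost a factor
   [half_rate kappa] < 1, and from the two defects of the splitting. The defects are
   small because the bounds on shorter intervals yield the first-order
   expansion of the scheme, with the constant c: this holds on intervals of length
   at most h, where N h^kappa <= 1 keeps c independent of N. *)
Lemma euler_rem_bound : exists N h, [/\ 0 <= N, 0 < h &
  forall n tau g e D, euler_grid n tau g e D ->
  forall i j, (i <= j)%N -> (j <= n)%N -> g j - g i <= h ->
    `|euler_rem g e D i j| <= N * pw kappa (g i) (g j) ^+ 3 /\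
    `|e j - e i - S (g i) (g j) (e i)| <= N * pw kappa (g i) (g j) ^+ 2].
Proof.
have [c1 c10 h1] := time_le_pw2 T k0 k2.
have [K K0 hK] := germ_bound germ.
pose c := M * c1 + K + 1.
have c0 : 0 <= c by rewrite /c !addr_ge0// mulr_ge0.
have [K3 K30 hK3] := germ_defect germ c0.
have la0 := half_rate_ge0 kappa; have la1 := half_rate_lt1 k3.
pose la := half_rate kappa; rewrite -/la in la0 la1.
pose N := 2 * K3 / (1 - la).
have N0 : 0 <= N by rewrite divr_ge0// ?mulr_ge0// subr_ge0 ltW.
have NE : N * la + 2 * K3 = N.
  have : N * (1 - la) = 2 * K3 by rewrite /N divfK// gt_eqF// subr_gt0.
  by lra.
have N1 : 0 < N + 1 by lra.
have [h /andP[h0 _] he] := @small_pw _ kappa (N + 1)^-1 k0 ltac:(by rewrite invr_gt0).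
have Nh : N * h `^ kappa <= 1.
  apply: le_trans (ler_wpM2l N0 he) _; rewrite ler_pdivrMr// mul1r; lra.
have first_order n tau g e D (grid : euler_grid n tau g e D) i j : (i <= j)%N -> (j <= n)%N -> g j - g i <= h ->
    `|euler_rem g e D i j| <= N * pw kappa (g i) (g j) ^+ 3 ->
    `|e j - e i - S (g i) (g j) (e i)|
       <= c * pw kappa (g i) (g j) ^+ 2.
  move=> ij jn jh hr; have st := grid_simplex grid ij jn; have [s0 st' tT] := st.
  have -> : e j - e i - S (g i) (g j) (e i) =
    (D j - D i) + (A (g i) (g j) (e i) -
     S (g i) (g j) (e i)) + euler_rem g e D i j.
    by apply/matrixP => a a'; rewrite /euler_rem !mxE; ring.
  rewrite !mulrDl; apply: le_trans (ler_normD _ _) _; apply: lerD.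
    apply: le_trans (ler_normD _ _) _; apply: lerD; last by have [] := hK _ _ (e i) st.
    by apply: le_trans (euler_drift_lipschitz grid ij jn) _; rewrite -mulrA ler_wpM2l ?h1.
  apply: le_trans hr _; rewrite exprS mulrA ler_wpM2r ?exprn_ge0 ?pw_ge0//.
  apply: le_trans Nh; rewrite ler_wpM2l//.
  by apply: ge0_ler_powR; rewrite ?nnegrE ?(ltW k0) ?(ltW h0) ?subr_ge0.
have main n tau g e D (grid : euler_grid n tau g e D) l : forall i j, (i <= j)%N -> (j <= n)%N -> (j - i <= l)%N ->
    g j - g i <= h ->
    `|euler_rem g e D i j| <= N * pw kappa (g i) (g j) ^+ 3.
  elim: l => [|l ih] i j ij jn jil jh.
    have -> : j = i by apply/eqP; rewrite eqn_leq ij andbT -subn_eq0 -leqn0.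
    rewrite (euler_rem_diag grid) ?(leq_trans ij)// normr0 mulr_ge0// exprn_ge0// pw_ge0//.
  have [jEi|ji] := eqVneq j i.
    by rewrite jEi (euler_rem_diag grid) -?jEi// normr0 mulr_ge0// exprn_ge0// pw_ge0.
  have ltij : (i < j)%N by rewrite ltn_neqAle eq_sym ji.
  have [q [/andP[iq qj] q1 q2 qi jq]] := midpoint_index ltij.
  have qn : (q.+1 <= n)%N := leq_trans qj jn.
  have st := grid_simplex grid ij jn; have [s0 st' tT] := st.
  have p1 : 2 * pw kappa (g i) (g q) ^+ 3 <=
      la * pw kappa (g i) (g j) ^+ 3.
    apply: pw_half; [exact: ltW|exact: (grid_le grid)|].
    rewrite !(gridB grid)// [2^-1 * _]mulrA ler_wpM2r ?(ltW (mesh_gt0 grid))//.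
    by rewrite ler_pdivlMl// -natrM ler_nat.
  have p2 : 2 * pw kappa (g q.+1) (g j) ^+ 3 <=
      la * pw kappa (g i) (g j) ^+ 3.
    apply: pw_half; [exact: ltW|exact: (grid_le grid)|].
    rewrite !(gridB grid)// [2^-1 * _]mulrA ler_wpM2r ?(ltW (mesh_gt0 grid))//.
    by rewrite ler_pdivlMl// -natrM ler_nat.
  have n1 := @grid_le _ _ _ _ _ grid i q iq; have n2 := @grid_le _ _ _ _ _ grid q q.+1 (leqnSn q).
  have n3 := @grid_le _ _ _ _ _ grid q.+1 j qj.
  have r1 : `|euler_rem g e D i q| <= N * pw kappa (g i) (g q) ^+ 3.
    apply: ih; rewrite ?(ltnW qn)//; first by rewrite -ltnS (leq_trans qi).
    by apply: le_trans jh; rewrite lerD2r (le_trans n2).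
  have r2 : `|euler_rem g e D q.+1 j| <= N * pw kappa (g q.+1) (g j) ^+ 3.
    apply: ih => //; first by rewrite -ltnS (leq_trans jq).
    by apply: le_trans jh; rewrite lerB// (le_trans n1).
  have sq := grid_simplex grid iq (ltnW qn).
  have qj' := grid_simplex grid (ltnW qj) jn.
  have d1 : `|A (g i) (g j) (e i) - A (g i) (g q) (e i)
      - A (g q) (g j) (e q)| <= K3 * pw kappa (g i) (g j) ^+ 3.
    apply: hK3 => //.
    apply: (first_order _ _ _ _ _ grid) => //; first exact: ltnW.
    by apply: le_trans jh; rewrite lerD2r (le_trans n2).
  have d2 : `|A (g q) (g j) (e q) - A (g q) (g q.+1) (e q)
      - A (g q.+1) (g j) (e q.+1)| <= K3 * pw kappa (g i) (g j) ^+ 3.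
    apply: (@le_trans _ _ (K3 * pw kappa (g q) (g j) ^+ 3)); last first.
      rewrite ler_wpM2l// lerXn2r ?nnegrE ?pw_ge0//; apply: pw_homo; [exact: ltW|exact: le_trans n3|].
      by rewrite lerD2l lerN2.
    apply: hK3; [exact: (grid_simplex grid (leqnSn q) qn)|exact: (grid_simplex grid qj jn)|].
    apply: (first_order _ _ _ _ _ grid) => //; first by apply: le_trans jh; apply: lerB.
    by rewrite (euler_rem_succ grid) normr0 mulr_ge0// exprn_ge0// pw_ge0.
  rewrite (euler_rem_split _ _ _ i q j) (euler_rem_split _ _ _ q q.+1 j) (euler_rem_succ grid) add0r.
  apply: le_trans (half_rate_closure N0 NE p1 p2).
  apply: le_trans (ler_normB _ _) _; apply: lerD => //.
  apply: le_trans (ler_normD _ _) _; apply: lerD => //.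
  by apply: le_trans (ler_normB _ _) _; apply: lerD.
exists (N + c), h; split=> //; first by rewrite addr_ge0.
move=> n tau g e D grid i j ij jn jh.
have hr := main _ _ _ _ _ grid _ _ _ ij jn (leqnn _) jh.
have hf := first_order _ _ _ _ _ grid _ _ ij jn jh hr.
split; [apply: le_trans hr _|apply: le_trans hf _];
  by rewrite ler_wpM2r ?exprn_ge0 ?pw_ge0// ?lerDl ?lerDr.
Qed.

End euler_scheme.

(** * Existence of Davie solutions *)

(** Shares of eps for an L-Lipschitz function at distance at most
   K q + eps / (3 (L + 1)) and for a modulus of continuity in time. *)
Lemma error_thirds (R : realFieldType) (L K eps q : R) :
  0 <= L -> 0 <= K -> 0 < eps -> q <= eps / (3 * (L + 1) * (K + 1)) ->
  L * (K * q + eps / (3 * (L + 1))) + eps / 3 <= eps.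
Proof.
move=> L0 K0 e0; have L1 : 0 < L + 1 by lra.
have K1 : 0 < K + 1 by lra.
have -> : eps / (3 * (L + 1) * (K + 1)) = eps / (3 * (L + 1)) / (K + 1).
  by rewrite invfM mulrA.
have : eps / (3 * (L + 1)) * (L + 1) = eps / 3.
  by rewrite invfM mulrA divfK// gt_eqF.
have : 0 <= eps / (3 * (L + 1)) by rewrite divr_ge0 ?mulr_ge0 ?(ltW e0) ?(ltW L1).
move: (eps / _) => a a0 aE; rewrite ler_pdivlMr// => hq.
have Kq : K * q <= a.
  have [q0|q0] := leP 0 q; first lra.
  by apply: le_trans a0; rewrite mulr_ge0_le0// ltW.
have := ler_wpM2l L0 Kq; lra.
Qed.

Section euler_limit.
Context {R : realType} {m : nat}.
Variables (T kappa : R) (A S : R -> R -> 'cV[R]_m -> 'cV[R]_m).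
Hypotheses (T0 : 0 < T) (k3 : 3^-1 < kappa) (k2 : kappa <= 2^-1).
Hypothesis germ : rough_germ T kappa A S.
Variables (B : R -> 'cV[R]_m -> 'cV[R]_m) (M LB : R).
Hypotheses (M0 : 0 <= M) (BM : forall t x, 0 <= t <= T -> `|B t x| <= M).
Hypotheses (LB0 : 0 <= LB)
  (BL : forall t x z, 0 <= t <= T -> `|B t x - B t z| <= LB * `|x - z|).
Hypothesis Bcont : forall t x (e : R), 0 <= t <= T -> 0 < e ->
  exists2 r, 0 < r & forall u, 0 <= u <= T -> `|u - t| < r ->
    `|B u x - B t x| <= e.
Variable y : 'cV[R]_m.
Implicit Types (s t : R) (n i j k q : nat).

Let k0 : 0 < kappa. Proof. by apply: lt_trans k3; rewrite invr_gt0. Qed.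

Notation grid := (euler_grid T A B y).

Lemma grid_floor n tau g e D t : grid n tau g e D -> 0 <= t <= T ->
  (Num.truncn (t / tau) <= n)%N /\
  g (Num.truncn (t / tau)) <= t < g (Num.truncn (t / tau)) + tau.
Proof.
move=> gr /andP[t0 tT]; have tau0 := mesh_gt0 gr.
have /andP[h1 h2] := truncn_itv (divr_ge0 t0 (ltW tau0)).
split; last first.
  rewrite (grid_node gr) -ler_pdivlMr// h1/=.
  by rewrite -[X in _ < _ + X]mul1r -mulrDl natr1 -ltr_pdivrMr.
rewrite -(ler_nat R); apply: le_trans h1 _.
by rewrite ler_pdivrMr// (mesh_total gr).
Qed.

Lemma euler_local_holder : exists K h, [/\ 0 <= K, 0 < h &
  forall n tau g e D, grid n tau g e D ->
  forall i j, (i <= j)%N -> (j <= n)%N -> g j - g i <= h ->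
    `|e j - e i| <= K * pw kappa (g i) (g j)].
Proof.
have [N [h [N0 h0 hN]]] := euler_rem_bound k3 k2 germ M0 BM y.
have [K K0 hK] := germ_bound germ.
exists (N * T `^ kappa + K), h; split => //; first by rewrite addr_ge0// mulr_ge0// powR_ge0.
move=> n tau g e D gr i j ij jn jh; have st := grid_simplex gr ij jn; have [s0 st' tT] := st.
have [_ hr] := hN _ _ _ _ _ gr _ _ ij jn jh.
rewrite -(subrK (S (g i) (g j) (e i)) (e j - e i)) mulrDl.
apply: le_trans (ler_normD _ _) _; apply: lerD; last by have [] := hK _ _ (e i) st.
apply: le_trans hr _; rewrite exprS mulrA ler_wpM2r ?pw_ge0//.
by rewrite ler_wpM2l// pw_le// ltW.
Qed.

(** The length on which the local estimate holds is doubled until it exceeds T;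
   each doubling concatenates two increments and a single step, whence the
   factor 3. *)
Lemma euler_bounded : exists Mx h, 0 < h /\
  forall n tau g e D, grid n tau g e D -> tau <= h ->
  forall k, (k <= n)%N -> `|e k| <= Mx.
Proof.
have [K [h [K0 h0 hK]]] := euler_local_holder.
pose C := K * T `^ kappa; have C0 : 0 <= C by rewrite mulr_ge0// powR_ge0.
have main n tau g e D (gr : grid n tau g e D) (tauh : tau <= h) l :
    forall i j, (i <= j)%N -> (j <= n)%N -> g j - g i <= 2 ^+ l * h ->
    `|e j - e i| <= 3 ^+ l * C.
  elim: l => [|l ih] i j ij jn jh.
    rewrite expr0 mul1r in jh; rewrite expr0 mul1r.
    apply: le_trans (hK _ _ _ _ _ gr _ _ ij jn jh) _; rewrite ler_wpM2l//.
    by have [? ? ?] := grid_simplex gr ij jn; rewrite pw_le// ltW.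
  have [jEi|ji] := eqVneq j i.
    by rewrite jEi subrr normr0 mulr_ge0// exprn_ge0.
  have ltij : (i < j)%N by rewrite ltn_neqAle eq_sym ji.
  have [q [/andP[iq qj] q1 q2 qi jq]] := midpoint_index ltij.
  have tau0 := mesh_gt0 gr.
  have half a : (2 * a <= j - i)%N -> a%:R * tau <= 2 ^+ l * h.
    move=> ha; rewrite -(ler_pM2l (ltr0Sn R 1)) mulrA -natrM mulrA -exprS.
    by apply: le_trans jh; rewrite (gridB gr)// ler_wpM2r ?ler_nat// ltW.
  have e1 : `|e q - e i| <= 3 ^+ l * C.
    by apply: ih => //; [exact: leq_trans (ltnW qj) jn|rewrite (gridB gr)// half].
  have e2 : `|e q.+1 - e q| <= 3 ^+ l * C.
    apply: ih => //; first exact: leq_trans qj jn.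
    rewrite (gridB gr)// subSnn mul1r (le_trans tauh)// ler_peMl ?(ltW h0)//.
    by rewrite exprn_ege1// ler1n.
  have e3 : `|e j - e q.+1| <= 3 ^+ l * C.
    by apply: ih => //; rewrite (gridB gr)// half.
  have -> : e j - e i = (e j - e q.+1) + (e q.+1 - e q) + (e q - e i).
    by apply/matrixP => a c; rewrite !mxE; ring.
  apply: le_trans (ler_normD _ _) _.
  have := ler_normD (e j - e q.+1) (e q.+1 - e q); rewrite exprS => ?; lra.
have [l hl] : exists l : nat, T <= 2 ^+ l * h.
  exists (Num.truncn (T / h)).+1; rewrite -ler_pdivrMr//.
  apply: le_trans (ltW (truncnS_gt _)) _.
  by rewrite -natrX ler_nat ltnW// ltn_expl.
exists (`|y| + 3 ^+ l * C), h; split=> // n tau g e D gr th k kn.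
rewrite -(subrK y (e k)) addrC; apply: le_trans (ler_normD _ _) _; rewrite lerD2l.
rewrite -(euler0 gr); apply: (main _ _ _ _ _ gr th _ _ _ (leq0n k) kn).
apply: le_trans hl; have [g0 gk gT] := grid_simplex gr (leq0n k) kn.
by rewrite lerBlDr (le_trans gT)// lerDl.
Qed.

(** Along an ultrafilter of grids of mesh tending to 0, the Euler polygons and their
   accumulated drifts, evaluated at the last node before t, converge for every t.
   The uniform bounds on remainders pass to the limit by continuity of the
   germ. That the limit drift G has derivative B(s, x s) at s is seen before
   passing to the limit: for grid points near s the Euler points are near x s by
   the uniform Hoelder estimate. *)
Lemma davie_exists : exists x G : R -> 'cV[R]_m,
  [/\ x 0 = y, G 0 = 0, davie_solution T kappa A x G, lipschitz_drift T G &
    forall s (eps : R), 0 <= s <= T -> 0 < eps -> exists2 r, 0 < r &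
      forall t, 0 <= t <= T -> `|t - s| < r ->
        `|G t - G s - (t - s) *: B s (x s)| <= eps * `|t - s|].
Proof.
have [T0' [kp [k2' LB0']]] := conj T0 (conj k0 (conj k2 LB0)).
have [Nr [h1 [Nr0 h10 hrem]]] := euler_rem_bound k3 k2 germ M0 BM y.
have [K [h2 [K0 h20 hhol]]] := euler_local_holder.
have [Mx [h3 [h30 hbd]]] := euler_bounded.
pose tau n : R := T / n.+1%:R.
have [g [e [D gr]]] : exists (g : nat -> nat -> R) (e D : nat -> nat -> 'cV[R]_m),
    forall n, grid n.+1 (tau n) (g n) (e n) (D n).
  have /choice[seqs hseqs] : forall n,
      exists p : (nat -> R) * (nat -> 'cV[R]_m) * (nat -> 'cV[R]_m),
        grid n.+1 (tau n) p.1.1 p.1.2 p.2.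
    by move=> n; have [g [e [D gr]]] := euler_grid_ex A T0 B y n; exists (g, e, D).
  by exists (fun n => (seqs n).1.1), (fun n => (seqs n).1.2), (fun n => (seqs n).2).
have [F [UF sF]] := ultraFilterLemma (_ : ProperFilter (\oo : set_system nat)).
have tauF : tau n @[n --> F] --> 0.
  have : tau n @[n --> \oo] --> 0.
    by rewrite -(mulr0 T); apply: cvgMl_tmp; exact: cvg_harmonic.
  by apply: cvg_trans; exact: cvg_app sF.
have tau_le c : 0 < c -> \forall n \near F, tau n <= c.
  move=> c0; have /cvgrPdist_le/(_ c c0) := tauF; apply: filterS => n.
  by rewrite sub0r normrN; apply: le_trans; exact: ler_norm.
pose idx n t := Num.truncn (t / tau n).
pose X n t := e n (idx n t); pose Gm n t := D n (idx n t); pose gt n t := g n (idx n t).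
have idx_le n t : 0 <= t <= T -> (idx n t <= n.+1)%N.
  by move=> tT; have [] := grid_floor (gr n) tT.
have gt_itv n t : 0 <= t <= T -> gt n t <= t < gt n t + tau n.
  by move=> tT; have [] := grid_floor (gr n) tT.
have idx_homo n s t : s <= t -> (idx n s <= idx n t)%N.
  by move=> st; apply: le_truncn; rewrite ler_pM2r// invr_gt0 (mesh_gt0 (gr n)).
have gt_simplex n s t : simplex T s t -> simplex T (gt n s) (gt n t).
  move=> st; have [_ st' _] := st; apply: (grid_simplex (gr n)).
    exact: idx_homo.
  by apply: idx_le; exact: simplexR st.
have gtF t : 0 <= t <= T -> gt n t @[n --> F] --> t.
  move=> tT; apply: (cvg_of_bound (g := tau)) => // n.
  by have /andP[a1 a2] := gt_itv n t tT; rewrite ler0_norm ?subr_le0//; lra.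
have XM t : 0 <= t <= T -> \forall n \near F, `|X n t| <= Mx.
  move=> tT; apply: filterS (tau_le _ h30) => n th.
  by apply: (hbd _ _ _ _ _ (gr n)) => //; exact: idx_le.
have GM n t : 0 <= t <= T -> `|Gm n t| <= M * T.
  move=> tT; have := euler_drift_lipschitz BM (gr n) (leq0n (idx n t)) (idx_le n t tT).
  rewrite (drift0 (gr n)) subr0 => h; apply: le_trans h _; rewrite ler_wpM2l//.
  have [q1 q2 q3] := grid_simplex (gr n) (leq0n (idx n t)) (idx_le n t tT); lra.
pose x t : 'cV[R]_m := \col_i lim (X n t i 0 @[n --> F]).
pose G t : 'cV[R]_m := \col_i lim (Gm n t i 0 @[n --> F]).
have Xx t : 0 <= t <= T -> X n t @[n --> F] --> x t.
  move=> tT; apply: cvg_coordinates => i; rewrite mxE.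
  apply: (@ultra_bounded_cvg _ _ _ _ Mx); apply: filterS (XM t tT) => n.
  by apply: le_trans; exact: coord_le_norm.
have GG t : 0 <= t <= T -> Gm n t @[n --> F] --> G t.
  move=> tT; apply: cvg_coordinates => i; rewrite mxE.
  apply: (@ultra_bounded_cvg _ _ _ _ (M * T)); near=> n.
  by apply: le_trans (GM n t tT); exact: coord_le_norm.
have idx0 n : idx n 0 = 0%N by rewrite /idx mul0r truncn0.
have lGM s t : simplex T s t -> `|G t - G s| <= M * (t - s).
  move=> st.
  have c1 : `|Gm n t - Gm n s| @[n --> F] --> `|G t - G s|.
    by apply: cvg_norm; apply: cvgB; apply: GG; [exact: simplexR st|exact: simplexL st].
  have c2 : M * (gt n t - gt n s) @[n --> F] --> M * (t - s).
    by apply: cvgMl_tmp; apply: cvgB; apply: gtF; [exact: simplexR st|exact: simplexL st].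
  apply: (ler_cvg_to c1 c2); have [_ st' _] := st; near=> n.
  apply: (euler_drift_lipschitz BM (gr n)); first exact: idx_homo.
  by apply: idx_le; exact: simplexR st.
have lG : lipschitz_drift T G by exists M.
have xM t : 0 <= t <= T -> `|x t| <= Mx.
  by move=> tT; apply: (cvgr_to_le (cvg_norm (Xx t tT))); exact: XM.
exists x, G; split=> //.
- apply/matrixP => i j; rewrite mxE ord1.
  under eq_fun do rewrite /X idx0 (euler0 (gr _)).
  exact: lim_cst.
- apply/matrixP => i j; rewrite !mxE.
  under eq_fun do rewrite /Gm idx0 (drift0 (gr _)) mxE.
  exact: lim_cst.
- (* The local bound is extended to long intervals by enlarging the constant. *)
  pose h := Num.min h1 (T + 1).
  have hh0 : 0 < h by rewrite lt_min h10; lra.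
  have loc s t : simplex T s t -> t - s < h ->
      `|davie_rem A x G s t| <= 8 * Nr * pw kappa s t ^+ 3.
    move=> st; have [s0 st' tT] := st; rewrite lt_min => /andP[th _].
    have sT := simplexL st; have tT' := simplexR st.
    have [stE|snt] := eqVneq s t.
      rewrite -stE /davie_rem (germ_diag k3 germ)// !subrr normr0.
      by rewrite mulr_ge0 ?exprn_ge0 ?pw_ge0// mulr_ge0.
    have lt_st : s < t by rewrite lt_neqAle snt.
    have c1 : `|X n t - X n s - (Gm n t - Gm n s) - A (gt n s) (gt n t) (X n s)|
        @[n --> F] --> `|davie_rem A x G s t|.
      apply: cvg_norm; apply: cvgB.
        by apply: cvgB; apply: cvgB; [exact: Xx|exact: Xx|exact: GG|exact: GG].
      exact: (germ_continuous germ _ (fun n => gt_simplex n s t st) st (gtF _ sT)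
        (gtF _ tT') (Xx _ sT)).
    apply: (cvgr_to_le c1).
    have e1 := tau_le (t - s) ltac:(by rewrite subr_gt0).
    have e2 := tau_le (h1 - (t - s)) ltac:(by rewrite subr_gt0).
    apply: filterS2 e1 e2 => n te1 te2.
    have /andP[a1 a2] := gt_itv n s sT; have /andP[a3 a4] := gt_itv n t tT'.
    have [_ g1 _] := gt_simplex n s t st.
    have gh : gt n t - gt n s <= h1 by lra.
    have [hr _] := hrem _ _ _ _ _ (gr n) _ _ (idx_homo n s t st') (idx_le n t tT') gh.
    apply: le_trans hr _; rewrite -/(gt n s) -/(gt n t).
    (* Rounding to the grid at most doubles t - s once the step is below it. *)
    have p2 : pw kappa (gt n s) (gt n t) <= 2 * pw kappa s t.
      apply: (@le_trans _ _ ((2 * (t - s)) `^ kappa)).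
        by apply: ge0_ler_powR; rewrite ?nnegrE ?(ltW k0)//; lra.
      rewrite powRM//; last by rewrite subr_ge0.
      by rewrite ler_wpM2r ?powR_ge0// ler1_powR// ?ler1n//; lra.
    have -> : 8 * Nr * pw kappa s t ^+ 3 = Nr * (2 * pw kappa s t) ^+ 3 by ring.
    by rewrite ler_wpM2l// lerXn2r ?nnegrE ?mulr_ge0 ?pw_ge0.
  have [KA KA0 hKA] := germ_bound germ.
  have Mx0 : 0 <= Mx by apply: le_trans (xM 0 _) => //; rewrite lexx ltW.
  have Tk := powR_ge0 T kappa.
  pose Cb := 2 * Mx + M * T + (KA * T `^ kappa + KA * T `^ kappa ^+ 2).
  have Cb0 : 0 <= Cb by rewrite /Cb !addr_ge0 ?mulr_ge0 ?exprn_ge0 ?(ltW T0).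
  have hk0 : 0 < h `^ kappa ^+ 3 by rewrite exprn_gt0// powR_gt0.
  exists (8 * Nr + Cb / h `^ kappa ^+ 3).
    by rewrite addr_ge0 ?mulr_ge0 ?invr_ge0 ?(ltW hk0).
  move=> s t st; rewrite mulrDl; have p0 := exprn_ge0 3 (pw_ge0 kappa s t).
  have [th|ht] := ltP (t - s) h.
    apply: le_trans (loc s t st th) _; rewrite lerDl mulr_ge0// divr_ge0//.
    exact: ltW.
  have [s0 st' tT] := st.
  apply: (@le_trans _ _ Cb); last first.
    apply: (@le_trans _ _ (Cb / h `^ kappa ^+ 3 * pw kappa s t ^+ 3)); last first.
      by rewrite lerDr mulr_ge0// mulr_ge0.
    rewrite mulrAC ler_pdivlMr// ler_wpM2l//.
    rewrite lerXn2r ?nnegrE ?powR_ge0//.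
    by apply: ge0_ler_powR; rewrite ?nnegrE ?(ltW k0) ?(ltW hh0) ?subr_ge0.
  have -> : davie_rem A x G s t = (x t - x s) - (G t - G s) -
     (S s t (x s) + (A s t (x s) - S s t (x s))).
    by apply/matrixP => i j; rewrite /davie_rem !mxE; ring.
  have [b1 b2] := hKA s t (x s) st.
  have pT := pw_le (ltW k0) s0 st' tT.
  apply: le_trans (ler_normB _ _) _; apply: lerD.
    apply: le_trans (ler_normB _ _) _; apply: lerD.
      apply: le_trans (ler_normB _ _) _; rewrite mulr_natl mulr2n.
      by apply: lerD; apply: xM; [exact: simplexR st|exact: simplexL st].
    by apply: le_trans (lGM _ _ st) _; rewrite ler_wpM2l//; lra.
  apply: le_trans (ler_normD _ _) _; apply: lerD.
    by apply: le_trans b1 _; rewrite ler_wpM2l.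
  by apply: le_trans b2 _; rewrite ler_wpM2l// lerXn2r ?nnegrE ?pw_ge0.
- move=> s eps sT e0; pose v := B s (x s).
  have e3 : 0 < eps / 3 by rewrite divr_gt0.
  have [r1 r10 hr1] := Bcont (x s) sT e3.
  have LK : 0 < 3 * (LB + 1) * (K + 1) by rewrite !mulr_gt0//; lra.
  have LK' : 0 < 3 * (LB + 1) by rewrite !mulr_gt0//; lra.
  have [h4 /andP[h40 _] hh4] := @small_pw _ kappa (eps / (3 * (LB + 1) * (K + 1))) k0 (divr_gt0 e0 LK).
  pose r := Num.min r1 (Num.min h2 h4) / 2.
  have r0 : 0 < r by rewrite divr_gt0// !lt_min r10 h20 h40.
  have [rr1 rh2 rh4] : [/\ r + r <= r1, r + r <= h2 & r + r <= h4].
    have E : r + r = Num.min r1 (Num.min h2 h4) by rewrite /r; lra.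
    by rewrite E !ge_min !lexx !orbT.
  exists r => // t tT ts.
  have c1 : `|Gm n t - Gm n s - (gt n t - gt n s) *: v| @[n --> F] -->
      `|G t - G s - (t - s) *: v|.
    apply: cvg_norm; apply: cvgB; first by apply: cvgB; exact: GG.
    by apply: cvgZr_tmp; apply: cvgB; exact: gtF.
  have c2 : eps * `|gt n t - gt n s| @[n --> F] --> eps * `|t - s|.
    by apply: cvgMl_tmp; apply: cvg_norm; apply: cvgB; exact: gtF.
  apply: (ler_cvg_to c1 c2).
  have f1 := tau_le r r0.
  have f2 : \forall n \near F, `|x s - X n s| <= eps / (3 * (LB + 1)).
    by have /cvgrPdist_le := Xx s sT; apply; rewrite divr_gt0.
  apply: filterS2 f1 f2 => n tr xs.
  (* Three errors: from the polygon to its value at s, from there to x s, and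
     the time dependence of B. *)
  have small k : (k <= n.+1)%N -> `|g n k - s| < r1 ->
      `|e n k - X n s| <= K * h4 `^ kappa -> `|B (g n k) (e n k) - v| <= eps.
    move=> kn gks eks.
    have gT : 0 <= g n k <= T by apply: simplexL (grid_simplex (gr n) (leqnn k) kn).
    have t1 := BL (e n k) (x s) gT; have t2 := hr1 (g n k) gT gks.
    have t3 : `|e n k - x s| <= `|e n k - X n s| + `|x s - X n s|.
      have -> : e n k - x s = (e n k - X n s) - (x s - X n s).
        by apply/matrixP => i j; rewrite !mxE; ring.
      exact: ler_normB.
    have -> : B (g n k) (e n k) - v =
        (B (g n k) (e n k) - B (g n k) (x s)) + (B (g n k) (x s) - v).
      by apply/matrixP => i j; rewrite !mxE; ring.
    apply: le_trans (ler_normD _ _) _; apply: le_trans (error_thirds LB0 K0 e0 hh4).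
    apply: lerD => //; apply: le_trans t1 _; rewrite ler_wpM2l//.
    by apply: le_trans t3 _; exact: lerD.
  have /andP[a1 a2] := gt_itv n s sT; have /andP[a3 a4] := gt_itv n t tT.
  have hold i k : (i <= k)%N -> (k <= n.+1)%N -> g n k - g n i <= r + r ->
      `|e n k - e n i| <= K * h4 `^ kappa.
    move=> ik kn gki; have [_ gik _] := grid_simplex (gr n) ik kn.
    apply: le_trans (hhol _ _ _ _ _ (gr n) _ _ ik kn (le_trans gki rh2)) _.
    rewrite ler_wpM2l//; apply: ge0_ler_powR; rewrite ?nnegrE ?(ltW k0) ?(ltW h40) ?subr_ge0//.
    exact: le_trans rh4.
  have [st|/ltW ts'] := leP s t.
    have ij := idx_homo n s t st; have jn := idx_le n t tT.
    have gij := grid_le (gr n) ij.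
    rewrite [`|gt n t - _|]ger0_norm ?subr_ge0//.
    apply: (euler_drift_approx (gr n)) => // k /andP[ik /ltnW kj].
    have g1 := grid_le (gr n) ik; have g2 := grid_le (gr n) kj.
    have kn := leq_trans kj jn.
    rewrite -/(gt n s) in g1; rewrite -/(gt n t) in g2.
    rewrite ger0_norm ?subr_ge0// in ts.
    apply: small => //.
      by rewrite ltr_norml; apply/andP; split; lra.
    by apply: hold => //; rewrite -/(gt n s); lra.
  have ij := idx_homo n t s ts'; have jn := idx_le n s sT.
  have gij := grid_le (gr n) ij.
  rewrite [`|gt n t - _|]distrC [`|gt n s - _|]ger0_norm ?subr_ge0//.
  have -> : Gm n t - Gm n s - (gt n t - gt n s) *: v =
      - ((D n (idx n s) - D n (idx n t)) - (g n (idx n s) - g n (idx n t)) *: v).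
    by apply/matrixP => i j; rewrite /Gm /gt !mxE; ring.
  rewrite normrN.
  apply: (euler_drift_approx (gr n)) => // k /andP[ik /ltnW kj].
  have g1 := grid_le (gr n) ik; have g2 := grid_le (gr n) kj.
  have kn := leq_trans kj jn.
  rewrite -/(gt n t) in g1; rewrite -/(gt n s) in g2.
  rewrite ler0_norm ?subr_le0// in ts.
  apply: small => //.
    by rewrite ltr_norml; apply/andP; split; lra.
  by rewrite distrC; apply: hold => //; rewrite -/(gt n s); lra.
Unshelve. all: by end_near. Qed.

End euler_limit.

(** * Expectations and the Wasserstein metric *)

Section lower_integral.
Context d (X : measurableType d) {R : realType} (mu : {measure set X -> \bar R}).
Local Open Scope ereal_scope.

(** The integral of a nonnegative function is a lower integral, hence monotone
   even when the larger function is not measurable. This matters for the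
   squared distance on U x U, which need not be measurable for the product of the
   Borel sigma-algebras when U is not separable. *)
Lemma ge0_integral_mono (f g : X -> \bar R) :
  (forall x, 0 <= f x) -> (forall x, f x <= g x) ->
  \int[mu]_x f x <= \int[mu]_x g x.
Proof.
move=> f0 fg; have g0 x : 0 <= g x by exact: le_trans (fg x).
rewrite !ge0_integralTE//; apply: le_ereal_sup => _ [h hf <-].
by exists h => // x; exact: le_trans (fg x).
Qed.

End lower_integral.

Section bounded_expectation.
Context d (X : measurableType d) {R : realType} (P : probability X R).
Implicit Types f g : X -> R.

Lemma bounded_integrable f (c : R) : measurable_fun setT f ->
  (forall x, `|f x| <= c) -> P.-integrable setT (EFin \o f).
Proof.
move=> mf fc; apply: measurable_bounded_integrable => //.
  by apply: le_lt_trans (ltry 1); exact: probability_le1.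
by exists c; split; [exact: num_real|move=> z cz x _ /=; exact: le_trans (fc x) (ltW cz)].
Qed.

Lemma expectation_diff_bound f g (c e : R) :
  measurable_fun setT f -> measurable_fun setT g ->
  (forall x, `|f x| <= c) -> (forall x, `|g x| <= c) ->
  (forall x, `|f x - g x| <= e) ->
  `|\int[P]_x f x - \int[P]_x g x| <= e.
Proof.
move=> mf mg fc gc fge.
have If := bounded_integrable mf fc; have Ig := bounded_integrable mg gc.
rewrite -RintegralB//.
have mfg : measurable_fun setT (fun x => f x - g x) by exact: measurable_funB.
have Ifg := bounded_integrable mfg fge.
apply: le_trans (le_normr_Rintegral _ _) _ => //.
have -> : e = \int[P]_x (cst e x).
  rewrite Rintegral_cst// [X in fine X](_ : _ = 1%E) ?mulr1//.
  exact: probability_setT.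
apply: le_Rintegral => //.
  apply: (@bounded_integrable _ e) => [|x]; last by rewrite normr_id.
  by apply: measurableT_comp.
by apply: (@bounded_integrable _ `|e|).
Qed.

Lemma expectation_bound f (c : R) : measurable_fun setT f ->
  (forall x, `|f x| <= c) -> `|\int[P]_x f x| <= c.
Proof.
move=> mf fc; have c0 : 0 <= c by exact: le_trans (fc point).
have := @expectation_diff_bound f (cst 0) c c mf (measurable_cst _) fc.
rewrite Rintegral_cst// mul0r subr0; apply=> x; rewrite ?normr0//.
by rewrite subr0.
Qed.

End bounded_expectation.

Section wasserstein_lipschitz.
Context {R : realType} {k : nat} {U : control_space R k}.
Implicit Types (mu nu : probability (borel U) R).

Lemma lipschitz_measurable (f : borel U -> R) (C : R) :
  (forall a a' : U, `|f a' - f a| <= C * mdist a a') -> measurable_fun setT f.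
Proof.
move=> fC; apply: (measurability _ (RGenOpens.measurableE R)).
move=> _ [_ [u [v ->] <-]]; apply: sub_sigma_algebra; rewrite setTI.
have C0 : 0 < `|C| + 1 by rewrite ltr_wpDl.
suff : @open U ((f : U -> R) @^-1` `]u, v[%classic) by [].
rewrite openE => a /=; rewrite in_itv/= => /andP[ufa fav].
pose e := Num.min (f a - u) (v - f a).
have e0 : 0 < e by rewrite lt_min !subr_gt0 ufa.
apply/nbhs_ballP; exists (e / (`|C| + 1)); first by rewrite /= divr_gt0.
move=> a' aa'; rewrite /= in_itv/=.
have {}aa' : mdist (a : U) a' < e / (`|C| + 1) by rewrite ballEmdist in aa'.
have h : `|f a' - f a| < e.
  apply: le_lt_trans (fC a a') _.
  apply: (@le_lt_trans _ _ ((`|C| + 1) * mdist (a : U) a')).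
    by rewrite ler_wpM2r ?mdist_ge0// (le_trans (ler_norm _))// lerDl.
  by rewrite mulrC -ltr_pdivlMr.
move: h; rewrite /e lt_min !ltr_norml => /andP[/andP[? ?] /andP[? ?]].
by apply/andP; split; lra.
Qed.

(** For a coupling pi of mu and nu the difference of the two integrals is the
   integral of f(z.1) - f(z.2) against pi, at most C times the integral of the
   distance. To avoid integrating the distance itself, it is replaced by the
   measurable minorant h = |f(z.1) - f(z.2)| / C. *)
Lemma W2_Rintegral_le mu nu (f : borel U -> R) (C c r : R) :
  0 < C -> (forall a a' : U, `|f a' - f a| <= C * mdist a a') ->
  (forall a, `|f a| <= c) -> 0 < r -> (W2 mu nu < r%:E)%E ->
  `|\int[mu]_a f a - \int[nu]_a f a| <= C * r.
Proof.
move=> C0 fC fc r0 /ereal_inf_lt[_ [pi cpl <-]] Ir.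
have mf := lipschitz_measurable fC.
pose I := (\int[pi]_z ((mdist (z.1 : U) (z.2 : U)) ^+ 2)%:E)%E.
have I0 : (0 <= I)%E by apply: integral_ge0 => z _; rewrite lee_fin exprn_ge0// mdist_ge0.
have Ir2 : (I < (r ^+ 2)%:E)%E.
  rewrite ltNge; apply/negP => rI; move: Ir; rewrite ltNge => /negP; apply.
  have -> : r%:E = ((r ^+ 2)%:E `^ 2^-1)%E.
    by rewrite poweR_EFin powR12_sqrt ?exprn_ge0 ?(ltW r0)// sqrtr_sqr gtr0_norm.
  apply: gt0_ler_poweR => //; rewrite ?in_itv/= ?leey ?andbT// lee_fin exprn_ge0//.
  exact: ltW.
have mf1 : measurable_fun setT (fun z : borel U * borel U => f z.1).
  exact: measurableT_comp mf measurable_fst.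
have mf2 : measurable_fun setT (fun z : borel U * borel U => f z.2).
  exact: measurableT_comp mf measurable_snd.
have i1 := bounded_integrable pi mf1 (fun z => fc z.1).
have i2 := bounded_integrable pi mf2 (fun z => fc z.2).
have E1 : \int[mu]_a f a = \int[pi]_z f z.1.
  rewrite /Rintegral -(preimage_setT (@fst (borel U) (borel U))).
  rewrite -(@integral_pushforward _ _ _ _ _ _ measurable_fst pi setT (EFin \o f))//.
  - congr fine; apply: eq_measure_integral => A mA _.
    exact: (esym (cpl A mA).1).
  - exact/measurable_EFinP.
have E2 : \int[nu]_a f a = \int[pi]_z f z.2.
  rewrite /Rintegral -(preimage_setT (@snd (borel U) (borel U))).
  rewrite -(@integral_pushforward _ _ _ _ _ _ measurable_snd pi setT (EFin \o f))//.
  - congr fine; apply: eq_measure_integral => A mA _.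
    exact: (esym (cpl A mA).2).
  - exact/measurable_EFinP.
rewrite E1 E2 -RintegralB//.
have C1 := ltW C0.
pose h (z : borel U * borel U) : R := `|f z.1 - f z.2| / C.
have h0 z : 0 <= h z by rewrite divr_ge0// ltW.
have hd z : h z <= mdist (z.1 : U) (z.2 : U).
  rewrite ler_pdivrMr// mulrC distrC; exact: fC.
have mh : measurable_fun setT h.
  apply: measurable_funM => //; apply: measurableT_comp => //.
  exact: measurable_funB.
have c0 : 0 <= c by exact: le_trans (fc point).
have hc z : `|h z| <= (c + c) / C.
  rewrite ger0_norm// ler_pM2r ?invr_gt0//.
  by apply: le_trans (ler_normB _ _) _; apply: lerD.
have h2c z : `|h z ^+ 2| <= ((c + c) / C) ^+ 2.
  by rewrite normrX lerXn2r ?nnegrE// (le_trans (normr_ge0 (h z))).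
have ih := bounded_integrable pi mh hc.
have mh2 : measurable_fun setT (fun z => h z ^+ 2) by exact: measurable_funX.
have ih2 := bounded_integrable pi mh2 h2c.
have J : \int[pi]_z (h z ^+ 2) <= r ^+ 2.
  rewrite -lee_fin fineK; last exact: integrable_fin_num.
  apply: ltW; apply: le_lt_trans Ir2; apply: ge0_integral_mono => z.
    by rewrite lee_fin exprn_ge0.
  by rewrite lee_fin lerXn2r ?nnegrE ?mdist_ge0.
(* Young's inequality h <= h^2 / (2 r) + r / 2 replaces Cauchy-Schwarz. *)
have K : \int[pi]_z h z <= r.
  have r2 : 0 < 2 * r by rewrite mulr_gt0.
  have iq : pi.-integrable setT (EFin \o (fun z => (2 * r)^-1 * h z ^+ 2)).
    apply: (bounded_integrable pi (c := (2 * r)^-1 * ((c + c) / C) ^+ 2)).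
      exact: measurable_funM.
    move=> z; rewrite normrM gtr0_norm ?invr_gt0// ler_wpM2l// ?invr_ge0 ?ltW//.
  have ic : pi.-integrable setT (EFin \o (fun z : borel U * borel U => r / 2)).
    exact: (bounded_integrable pi (c := `|r / 2|)).
  apply: (@le_trans _ _ (\int[pi]_z ((2 * r)^-1 * h z ^+ 2 + r / 2))).
    apply: le_Rintegral => //; last first.
      move=> z _; rewrite -subr_ge0.
      have -> : (2 * r)^-1 * h z ^+ 2 + r / 2 - h z = (h z - r) ^+ 2 / (2 * r).
        by field; rewrite gt_eqF.
      by rewrite divr_ge0 ?sqr_ge0// ltW.
    by have := integrableD measurableT iq ic.
  rewrite RintegralD// [X in _ + X <= _]Rintegral_cst// RintegralZl//.
  rewrite [X in fine X](_ : _ = 1%E) ?mulr1; last exact: probability_setT.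
  apply: (@le_trans _ _ ((2 * r)^-1 * r ^+ 2 + r / 2)).
    by rewrite lerD2r ler_wpM2l// invr_ge0 ltW.
  rewrite invfM -mulrA expr2 mulKf ?gt_eqF//; lra.
apply: (@le_trans _ _ (C * \int[pi]_z h z)); last by rewrite ler_wpM2l.
have i12 : pi.-integrable setT (EFin \o (fun z => f z.1 - f z.2)).
  by have := integrableB measurableT i1 i2.
apply: le_trans (le_normr_Rintegral _ i12) _ => //.
rewrite -RintegralZl// le_eqVlt; apply/orP; left; apply/eqP.
apply: eq_Rintegral => z _.
by rewrite /h mulrC divfK// gt_eqF.
Qed.

End wasserstein_lipschitz.

(** * The averaged drift and its integral *)

Section mean_drift.
Context {R : realType} {k m : nat} {U : control_space R k}.
Variables (T eps L : R) (gamma : R -> P2 U) (b : R -> 'cV[R]_m -> U -> 'cV[R]_m).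
Hypotheses (eps0 : 0 < eps) (L0 : 0 < L).
Hypothesis gammaL : forall s t, 0 <= s <= T -> 0 <= t <= T ->
  (W2 (gamma s) (gamma t) <= (L * `|t - s| `^ eps)%:E)%E.
Hypotheses (hb : Cb011 T b) (hbu : unif_continuous_time T b).
Implicit Types (s t u : R) (x z : 'cV[R]_m).

Definition mean_drift s x : 'cV[R]_m :=
  \col_i \int[gamma s]_(a in [set: borel U]) b s x a i 0.

Lemma b_bounded : exists2 M, 0 <= M &
  forall t x (a : U), 0 <= t <= T -> `|b t x a| <= M.
Proof.
have [/bounded_continuous_bound[M hM] _ _ _] := hb.
by exists `|M| => // t x a tT; apply: le_trans (ler_norm M); exact: (hM (t, x, a)).
Qed.

Lemma b_lipschitz_state : exists2 C, 0 <= C &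
  forall t x z (a : U), 0 <= t <= T -> `|b t x a - b t z a| <= C * `|x - z|.
Proof.
have [_ dx _ _] := hb.
have [C C0 hC] : exists2 C, 0 <= C & forall j t x (a : U), 0 <= t <= T ->
    `|'D_(basis_vec j) (b t ^~ a) x| <= C.
  apply: (@common_bound _ _ (fun j C => forall t x (a : U), 0 <= t <= T ->
    `|'D_(basis_vec j) (b t ^~ a) x| <= C)).
    by move=> j C C' CC' h t x a tT; apply: le_trans (h t x a tT) CC'.
  move=> j; have [_ /bounded_continuous_bound[C hC]] := dx j.
  by exists C => t x a tT; exact: (hC (t, x, a)).
exists (m%:R * C) => [|t x z a tT]; first by rewrite mulr_ge0.
apply: cv_norm_le => [|i]; first by rewrite !mulr_ge0.
rewrite !mxE; apply: (@lipschitz_of_partials _ _ (fun x => b t x a i 0)) => // p j _.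
have [/(_ t p a tT) df _] := dx j; split; first exact: (derivable_mxP _ _ _).1.
have -> : 'D_(basis_vec j) (fun x => b t x a i 0) p =
    ('D_(basis_vec j) (b t ^~ a) p) i 0 by rewrite derive_mx// mxE.
by apply: le_trans (hC j t p a tT); exact: coord_le_norm.
Qed.

Lemma b_lipschitz_control : exists2 C, 0 < C &
  forall t x i (a a' : U), 0 <= t <= T ->
    `|b t x a' i 0 - b t x a i 0| <= C * mdist a a'.
Proof.
have [_ _ _ [C hC]] := hb; exists (`|C| + 1); first by rewrite ltr_wpDl.
move=> t x i a a' tT; have := coord_le_norm (b t x a' - b t x a) i 0.
rewrite !mxE => h; apply: le_trans h _; apply: le_trans (hC t x a a' tT) _.
by rewrite ler_wpM2r ?mdist_ge0// (le_trans (ler_norm _))// lerDl.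
Qed.

Lemma b_measurable t x i : 0 <= t <= T ->
  measurable_fun [set: borel U] (fun a : borel U => b t x a i 0).
Proof.
move=> tT; have [C _ hC] := b_lipschitz_control.
by apply: (lipschitz_measurable (C := C)) => a a'; exact: hC.
Qed.

Lemma mean_drift_bounded : exists2 M, 0 <= M &
  forall t x, 0 <= t <= T -> `|mean_drift t x| <= M.
Proof.
have [M M0 hM] := b_bounded; exists M => // t x tT.
apply: cv_norm_le => // i; rewrite mxE.
apply: expectation_bound; first exact: b_measurable.
by move=> a; apply: le_trans (coord_le_norm _ _ _) _; exact: hM.
Qed.

Lemma mean_drift_lipschitz : exists2 C, 0 <= C &
  forall t x z, 0 <= t <= T -> `|mean_drift t x - mean_drift t z| <= C * `|x - z|.
Proof.
have [M M0 hM] := b_bounded; have [C C0 hC] := b_lipschitz_state.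
exists C => // t x z tT; apply: cv_norm_le => [|i]; first by rewrite mulr_ge0.
rewrite !mxE; apply: (expectation_diff_bound _ (c := M)); try exact: b_measurable.
- by move=> a; apply: le_trans (coord_le_norm _ _ _) _; exact: hM.
- by move=> a; apply: le_trans (coord_le_norm _ _ _) _; exact: hM.
- move=> a; have := coord_le_norm (b t x a - b t z a) i 0; rewrite !mxE => h.
  by apply: le_trans h _; exact: hC.
Qed.

(** The two ways in which time enters are separated: b varies
   uniformly in the control, and gamma varies in [W2] while b is Lipschitz in the
   control. *)
Lemma mean_drift_time_continuous t x (e : R) : 0 <= t <= T -> 0 < e ->
  exists2 r, 0 < r & forall u, 0 <= u <= T -> `|u - t| < r ->
    `|mean_drift u x - mean_drift t x| <= e.
Proof.
move=> tT e0; have [M M0 hM] := b_bounded.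
have [C C0 hC] := b_lipschitz_control.
have e2 : 0 < e / 2 by rewrite divr_gt0.
have [r1 r10 hr1] := hbu x e2.
pose rho := e / 2 / C; have rho0 : 0 < rho by rewrite divr_gt0.
have L2 : 0 < rho / (2 * L) by rewrite divr_gt0// mulr_gt0.
have [h /andP[h0 _] hh] := small_pw eps0 L2.
exists (Num.min r1 h); first by rewrite lt_min r10.
move=> u uT; rewrite lt_min => /andP[ur1 uh].
have W : (W2 (gamma u) (gamma t) < rho%:E)%E.
  apply: le_lt_trans (gammaL uT tT) _; rewrite lte_fin.
  apply: (@le_lt_trans _ _ (L * (rho / (2 * L)))).
    rewrite ler_wpM2l ?(ltW L0)//; apply: le_trans hh.
    by apply: ge0_ler_powR; rewrite ?nnegrE ?(ltW eps0) ?(ltW h0)// distrC ltW.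
  by rewrite invfM (mulrA rho) mulrCA mulfV ?gt_eqF// mulr1 ltr_pdivrMr// ltr_pMr// ltr1n.
apply: cv_norm_le => [|i]; first by rewrite ltW.
have ub a : `|b u x a i 0| <= M by apply: le_trans (coord_le_norm _ _ _) _; exact: hM.
have tb a : `|b t x a i 0| <= M by apply: le_trans (coord_le_norm _ _ _) _; exact: hM.
rewrite !mxE.
have -> : \int[gamma u]_(a in [set: borel U]) b u x a i 0 -
    \int[gamma t]_(a in [set: borel U]) b t x a i 0 =
  (\int[gamma u]_(a in [set: borel U]) b u x a i 0 -
    \int[gamma u]_(a in [set: borel U]) b t x a i 0) +
  (\int[gamma u]_(a in [set: borel U]) b t x a i 0 -
    \int[gamma t]_(a in [set: borel U]) b t x a i 0) by ring.
have rhoE : C * rho = e / 2 by rewrite /rho mulrC divfK ?gt_eqF.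
apply: le_trans (ler_normD _ _) _.
have eE : e / 2 + C * rho = e by rewrite rhoE; lra.
rewrite -[leRHS]eE; apply: lerD.
  apply: (expectation_diff_bound _ (c := M)) => //; try exact: b_measurable.
  move=> a; have := coord_le_norm (b u x a - b t x a) i 0; rewrite !mxE => h'.
  by apply: le_trans h' _; exact: hr1.
apply: (W2_Rintegral_le (c := M)) => // a a'; exact: hC.
Qed.

End mean_drift.

Section integrated_drift.
Context {R : realType} {m : nat}.
Variables (T : R).
Hypothesis T0 : 0 < T.
Notation mu := (@lebesgue_measure R).

Lemma continuous_integrable (f : R -> R) t : t <= T ->
  {within `[0, T], continuous f} -> mu.-integrable `[0, t] (EFin \o f).
Proof.
move=> tT cf; apply: continuous_compact_integrable; first exact: segment_compact.
by apply: continuous_subspaceW cf; apply: subset_itvl; rewrite bnd_simp.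
Qed.

Lemma Rintegral_increment_bound (f : R -> R) s t (c : R) : simplex T s t ->
  {within `[0, T], continuous f} -> (forall u, s <= u <= t -> `|f u| <= c) ->
  `|\int[mu]_(u in `[0, t]) f u - \int[mu]_(u in `[0, s]) f u| <= c * (t - s).
Proof.
move=> [s0 st tT] cf fc; have It := continuous_integrable tT cf.
rewrite Rintegral_itvB ?bnd_simp//.
have sub : (`]s, t]%classic : set R) `<=` `[0, t]%classic.
  by move=> u; rewrite /= !in_itv/= => /andP[su ->]; rewrite (le_trans s0 (ltW su)).
have Ist : mu.-integrable `]s, t] (EFin \o f) by apply: integrableS It.
have mst : mu `]s, t]%classic = (t - s)%:E.
  rewrite lebesgue_measure_itv/= lte_fin.
  by case: ltgtP st => // -> _; rewrite subrr.
apply: le_trans (le_normr_Rintegral _ Ist) _ => //.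
have -> : c * (t - s) = \int[mu]_(u in `]s, t]) cst c u.
  rewrite Rintegral_cst// [X in fine X](_ : _ = (t - s)%:E)//; exact: mst.
apply: le_Rintegral => //.
- exact: integrable_norm.
- have : mu.-integrable `[0, t] (EFin \o cst c).
    by apply: continuous_integrable => //; apply: continuous_subspaceT => ?; exact: cst_continuous.
  exact: integrableS.
- move=> u; rewrite /= in_itv/= => /andP[su ut]; apply: fc; rewrite (ltW su)//.
Qed.

(** The expansion is ordinary differentiability inside ]0, T[, so this is the
   fundamental theorem of calculus; the Lipschitz bound gives continuity at the
   end points. *)
Lemma Rintegral_of_expansion (f F : R -> R) (M : R) :
  {within `[0, T], continuous f} -> F 0 = 0 ->
  (forall s t, simplex T s t -> `|F t - F s| <= M * (t - s)) ->
  (forall s (e : R), 0 <= s <= T -> 0 < e -> exists2 r, 0 < r &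
      forall t, 0 <= t <= T -> `|t - s| < r ->
        `|F t - F s - (t - s) * f s| <= e * `|t - s|) ->
  forall t, 0 <= t <= T -> \int[mu]_(u in `[0, t]) f u = F t.
Proof.
move=> cf F0 FM Fe t /andP[t0 tT].
have [<-|tn0] := eqVneq 0 t; first by rewrite set_itv1 Rintegral_set1 F0.
have lt0t : 0 < t by rewrite lt_neqAle tn0.
have dF s : 0 < s < T -> is_derive s 1 F (f s).
  move=> /andP[s0 sT].
  have lim_q : (fun h => h^-1 *: ((F \o shift s) (h *: 1) - F s)) @ 0^' --> f s.
    apply/cvgrPdist_le => e e0.
    have [|r r0 hr] := Fe s e _ e0; first by rewrite !ltW.
    have := @nbhs_dnbhs R 0 _ (nbhsx_ballx 0 (Num.min r (Num.min s (T - s))) _).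
    rewrite !lt_min r0 s0 subr_gt0 sT => /(_ isT) near0.
    have hn0 := @nbhs_dnbhs_neq R 0.
    apply: filterS2 near0 hn0 => h; rewrite /ball/= sub0r normrN !lt_min => /and3P[hr' hs hT] h0.
    have := hr (h + s); rewrite addrK => /(_ _ hr') H.
    rewrite [h *: 1]mulr1 [_ *: _]mulrC distrC.
    have -> : (F (h + s) - F s) / h - f s = (F (h + s) - F s - h * f s) / h.
      by rewrite [RHS]mulrBl [h * f s]mulrC mulfK.
    rewrite normrM normfV ler_pdivrMr ?normr_gt0//; apply: H.
    by move: hs hT; rewrite !ltr_norml => /andP[? ?] /andP[? ?]; apply/andP; split; lra.
  by apply: DeriveDef; [apply/cvg_ex; exists (f s)|exact: cvg_lim lim_q].
have M1 : 0 < `|M| + 1 by rewrite ltr_wpDl.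
have ctF s u (e : R) : 0 <= s <= T -> 0 <= u <= T -> 0 < e ->
    `|s - u| < e / (`|M| + 1) -> `|F s - F u| <= e.
  have ord s' u' : simplex T s' u' -> `|F u' - F s'| <= (`|M| + 1) * `|s' - u'|.
    move=> su; apply: le_trans (FM _ _ su) _; have [_ su' _] := su.
    rewrite (distrC s') (@ger0_norm _ (u' - s')) ?subr_ge0// ler_wpM2r ?subr_ge0//.
    by rewrite (le_trans (ler_norm _))// lerDl.
  move=> /andP[s0 sT] /andP[u0 uT] e0; rewrite ltr_pdivlMr// mulrC => /ltW h.
  apply: le_trans h; have [su|us] := leP s u; last by rewrite (distrC s); apply: ord; split=> //; exact: ltW.
  by rewrite (distrC (F s)); exact: ord.
have e1 (e : R) : 0 < e -> 0 < e / (`|M| + 1) by move=> e0; rewrite divr_gt0.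
rewrite /Rintegral (@continuous_FTC2 _ f F 0 t)//.
- by rewrite F0 /= subr0.
- by apply: continuous_subspaceW cf; apply: subset_itvl; rewrite bnd_simp.
- split.
  + move=> s; rewrite in_itv/= => /andP[s0 st].
    by have [|//] := dF s; rewrite s0 (lt_le_trans st).
  + apply/cvgrPdist_le => e e0; near=> u.
    have u0 : 0 < u by near: u; exact: nbhs_right_gt.
    have uT : u < T by near: u; exact: nbhs_right_lt.
    apply: ctF => //; rewrite ?lexx ?(ltW T0) ?ltW// sub0r normrN gtr0_norm//.
    by near: u; apply: nbhs_right_lt; exact: e1.
  + apply/cvgrPdist_le => e e0; near=> u.
    have ut : u < t by near: u; exact: nbhs_left_lt.
    have u0 : 0 < u by near: u; exact: nbhs_left_gt.
    apply: ctF => //; rewrite ?t0 ?tT ?(ltW u0) ?(le_trans (ltW ut))//.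
    rewrite gtr0_norm ?subr_gt0// ltrBlDr addrC -ltrBlDr.
    by near: u; apply: nbhs_left_gt; rewrite ltrBlDr ltrDl e1.
- move=> s; rewrite in_itv/= => /andP[s0 st]; rewrite derive1E.
  by have [|_ ->//] := dF s; rewrite s0 (lt_le_trans st).
Unshelve. all: by end_near. Qed.

End integrated_drift.

(** * Sewing *)

Section partition_sums.
Context {R : realType}.
Implicit Types (s t u e : R) (p : seq R) (Xi : R -> R -> R).

(** The sum of Xi over the consecutive intervals of the partition s :: p,
   recursive in p so that concatenation is immediate. *)
Fixpoint psum Xi s p : R :=
  if p is u :: p' then Xi s u + psum Xi u p' else 0.

Lemma psum_cat Xi s p1 p2 :
  psum Xi s (p1 ++ p2) = psum Xi s p1 + psum Xi (last s p1) p2.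
Proof.
by elim: p1 s => [|u p1 ih] s /=; rewrite ?add0r// ih addrA.
Qed.

Lemma big_psum Xi s p :
  \sum_(q < size p) Xi (s :: p)`_q (s :: p)`_q.+1 = psum Xi s p.
Proof.
elim: p s => [|u p ih] s /=; first by rewrite big_ord0.
by rewrite big_ord_recl/= -ih.
Qed.

Lemma partition_cons s u t p :
  itv_partition s t (u :: p) <-> s < u /\ itv_partition u t p.
Proof.
rewrite /itv_partition/=; split; first by move=> [/andP[su up] ut].
by move=> [su [up ut]]; rewrite su.
Qed.

Lemma mesh_cons e s u p :
  (forall q, (q < size (u :: p))%N -> (s :: u :: p)`_q.+1 - (s :: u :: p)`_q < e) <->
  u - s < e /\ (forall q, (q < size p)%N -> (u :: p)`_q.+1 - (u :: p)`_q < e).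
Proof.
split=> [h|[h1 h2] [|q]//=]; last by rewrite ltnS; exact: h2.
by split=> [|q qp]; [exact: (h 0%N)|exact: (h q.+1)].
Qed.

Lemma eq_psum T Xi Xi' s t p : (forall u v, simplex T u v -> Xi u v = Xi' u v) ->
  0 <= s -> t <= T -> itv_partition s t p -> psum Xi s p = psum Xi' s p.
Proof.
move=> eX + tT; elim: p s => [|u p ih] s s0 //= /partition_cons[su ut].
rewrite ih ?(le_trans s0 (ltW su))// eX//; split=> //; first exact: ltW.
exact: le_trans (itv_partition_le ut) tT.
Qed.

(** Each interval contributes (v - u)^(3 kappa), at most
   e^(3 kappa - 1) (v - u), and the lengths add up to t - s. *)
Lemma psum_close T kappa Xi (J : R -> R) N s t p e : 0 < e -> 0 <= N -> 3^-1 < kappa ->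
  (forall u v, simplex T u v -> `|J v - J u - Xi u v| <= N * pw kappa u v ^+ 3) ->
  0 <= s -> t <= T -> itv_partition s t p ->
  (forall q, (q < size p)%N -> (s :: p)`_q.+1 - (s :: p)`_q < e) ->
  `|psum Xi s p - (J t - J s)| <= N * e `^ (3 * kappa - 1) * (t - s).
Proof.
move=> e0 N0 k3 JX + tT; elim: p s => [|u p ih] s s0.
  by move=> [_ /eqP/= ->] _; rewrite !subrr normr0 mulr0.
move=> /partition_cons[su ut] /mesh_cons[sue hp] /=.
have uT : u <= T := le_trans (itv_partition_le ut) tT.
have su' : simplex T s u by split=> //; exact: ltW.
have -> : Xi s u + psum Xi u p - (J t - J s) =
  (psum Xi u p - (J t - J u)) - (J u - J s - Xi s u) by ring.
have -> : N * e `^ (3 * kappa - 1) * (t - s) =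
  N * e `^ (3 * kappa - 1) * (t - u) + N * e `^ (3 * kappa - 1) * (u - s) by ring.
apply: le_trans (ler_normB _ _) _; apply: lerD.
  by apply: ih => //; exact: le_trans (ltW su).
apply: le_trans (JX _ _ su') _; rewrite -mulrA ler_wpM2l//.
have us0 : 0 < u - s by rewrite subr_gt0.
rewrite /pw -powRMn ?(ltW us0)// -[in leLHS](subrK 1 (3 * kappa)).
rewrite powRD; last by rewrite (gt_eqF us0) implybT.
rewrite powRr1 ?(ltW us0)// ler_wpM2r ?(ltW us0)//.
by apply: ge0_ler_powR; rewrite ?nnegrE ?(ltW e0) ?(ltW us0) ?(ltW sue)//; lra.
Qed.

Fixpoint dyadic n s t : seq R :=
  if n is n'.+1 then dyadic n' s ((s + t) / 2) ++ dyadic n' ((s + t) / 2) t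
  else [:: t].

Lemma last_dyadic n s t u : last u (dyadic n s t) = t.
Proof. by elim: n s t u => [|n ih] s t u //=; rewrite last_cat ih. Qed.

Lemma dyadic_path n s t :
  path (fun u v => v - u == (t - s) / 2 ^+ n) s (dyadic n s t).
Proof.
elim: n s t => [|n ih] s t /=; first by rewrite expr0 divr1 eqxx.
have E1 : ((s + t) / 2 - s) / 2 ^+ n = (t - s) / 2 ^+ n.+1.
  by rewrite exprS invfM mulrA; congr (_ * _); lra.
have E2 : (t - (s + t) / 2) / 2 ^+ n = (t - s) / 2 ^+ n.+1.
  by rewrite exprS invfM mulrA; congr (_ * _); lra.
rewrite cat_path last_dyadic; apply/andP; split.
  by have := ih s ((s + t) / 2); rewrite E1.
by have := ih ((s + t) / 2) t; rewrite E2.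
Qed.

Lemma dyadic_partition n s t : s < t -> itv_partition s t (dyadic n s t).
Proof.
move=> st; split; last by rewrite last_dyadic.
have := dyadic_path n s t; apply: sub_path => u v /eqP uv.
by rewrite -subr_gt0 uv divr_gt0 ?subr_gt0// exprn_gt0.
Qed.

Lemma dyadic_mesh n s t q : (q < size (dyadic n s t))%N ->
  (s :: dyadic n s t)`_q.+1 - (s :: dyadic n s t)`_q = (t - s) / 2 ^+ n.
Proof.
by move=> qs; have /pathP/(_ q qs)/eqP := dyadic_path n s t; apply.
Qed.

(** Each dyadic refinement adds a defect per interval; the sum of these defects
   over a level decays geometrically with ratio [half_rate kappa]. *)
Lemma dyadic_sewing T kappa Xi K n s t : 3^-1 < kappa -> 0 <= K ->
  (forall s u t, simplex T s u -> simplex T u t ->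
     `|Xi s t - Xi s u - Xi u t| <= K * pw kappa s t ^+ 3) ->
  simplex T s t ->
  `|psum Xi s (dyadic n s t) - Xi s t|
    <= K / (1 - half_rate kappa) * pw kappa s t ^+ 3.
Proof.
move=> k3 K0 dX; have l1 := half_rate_lt1 k3; have l0 := half_rate_ge0 kappa.
have k0 : 0 < kappa by apply: lt_trans k3; rewrite invr_gt0.
pose la := half_rate kappa; pose C := K / (1 - la).
have C0 : 0 <= C by rewrite divr_ge0// subr_ge0 ltW.
have CE : C * la + K = C.
  have : C * (1 - la) = K by rewrite /C divfK// gt_eqF// subr_gt0.
  by lra.
rewrite -/la -/C; elim: n s t => [|n ih] s t st /=.
  by rewrite addr0 subrr normr0 mulr_ge0// exprn_ge0// pw_ge0.
have [s0 st' tT] := st; set u := (s + t) / 2.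
have su : simplex T s u by split=> //; rewrite /u; lra.
have ut : simplex T u t by split=> //; rewrite /u; lra.
rewrite psum_cat last_dyadic.
have -> : psum Xi s (dyadic n s u) + psum Xi u (dyadic n u t) - Xi s t =
  (psum Xi s (dyadic n s u) - Xi s u) + (psum Xi u (dyadic n u t) - Xi u t)
  - (Xi s t - Xi s u - Xi u t) by ring.
have p1 : 2 * pw kappa s u ^+ 3 <= la * pw kappa s t ^+ 3.
  by apply: pw_half; rewrite ?(ltW k0)// /u; lra.
have p2 : 2 * pw kappa u t ^+ 3 <= la * pw kappa s t ^+ 3.
  by apply: pw_half; rewrite ?(ltW k0)// /u; lra.
apply: (@le_trans _ _ (C * pw kappa s u ^+ 3 + C * pw kappa u t ^+ 3
    + K * pw kappa s t ^+ 3)).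
  apply: le_trans (ler_normB _ _) _; apply: lerD; last exact: dX.
  by apply: le_trans (ler_normD _ _) _; apply: lerD; exact: ih.
have := ler_wpM2l C0 p1; have := ler_wpM2l C0 p2; move: CE.
move: (pw _ _ _ ^+ 3) (pw _ _ _ ^+ 3) (pw _ _ _ ^+ 3) => x1 x2 x3.
clearbody C la; move=> CE h1 h2; rewrite -[in leRHS]CE; lra.
Qed.

Lemma small_mesh e s t : 0 < e -> exists n, (t - s) / 2 ^+ n < e.
Proof.
move=> e0; exists (Num.truncn (`|t - s| / e)).+1.
rewrite ltr_pdivrMr ?exprn_gt0//; apply: le_lt_trans (ler_norm _) _.
rewrite -ltr_pdivrMl// mulrC; apply: lt_trans (truncnS_gt _) _.
by rewrite -natrX ltr_nat ltn_expl.
Qed.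

Lemma fine_partition e s t : 0 < e -> s <= t -> exists2 p, itv_partition s t p &
  forall q, (q < size p)%N -> (s :: p)`_q.+1 - (s :: p)`_q < e.
Proof.
move=> e0; rewrite le_eqVlt => /orP[/eqP ->|st].
  by exists [::] => //; split.
have [n ne] := small_mesh s t e0; exists (dyadic n s t).
  exact: dyadic_partition.
by move=> q qs; rewrite dyadic_mesh.
Qed.

Lemma mesh_cat e s p1 p2 :
  (forall q, (q < size p1)%N -> (s :: p1)`_q.+1 - (s :: p1)`_q < e) ->
  (forall q, (q < size p2)%N ->
     (last s p1 :: p2)`_q.+1 - (last s p1 :: p2)`_q < e) ->
  forall q, (q < size (p1 ++ p2))%N ->
    (s :: p1 ++ p2)`_q.+1 - (s :: p1 ++ p2)`_q < e.
Proof.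
elim: p1 s => [|u p1 ih] s //= /mesh_cons[h1 h2] h3.
by apply/mesh_cons; split=> //; exact: ih.
Qed.

Definition is_sewn Xi s t (v : R) := psum Xi s p @[p --> mesh_to0 s t] --> v.

Lemma is_sewnP Xi s t v : is_sewn Xi s t v <-> forall e, 0 < e -> exists2 r, 0 < r &
  forall p, itv_partition s t p ->
    (forall q, (q < size p)%N -> (s :: p)`_q.+1 - (s :: p)`_q < r) ->
    `|psum Xi s p - v| < e.
Proof.
split=> [h e e0|h A /nbhs_ballP[e e0 sub]].
  have := h (ball v e) (nbhsx_ballx v e e0) => -[r r0 hr].
  exists r => // p pp mp; have := hr p (conj pp mp).
  by rewrite /ball/= distrC.
have [r r0 hr] := h e e0; exists r => // p [pp mp].
by apply: sub; rewrite /ball/= distrC; exact: hr.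
Qed.

(** A function J whose increments are Xi up to order 3 kappa > 1 is the limit of
   the sums of Xi. *)
Lemma sewn_of_expansion T kappa Xi (J : R -> R) N t : 0 <= N -> 3^-1 < kappa ->
  (forall u v, simplex T u v -> `|J v - J u - Xi u v| <= N * pw kappa u v ^+ 3) ->
  0 <= t <= T -> is_sewn Xi 0 t (J t - J 0).
Proof.
move=> N0 k3 JX /andP[t0 tT]; apply/is_sewnP => e e0.
have k1 : 0 < 3 * kappa - 1 by lra.
have N1 : 0 < N * t + 1 by rewrite ltr_wpDl ?mulr_ge0.
have [h /andP[h0 _] hh] := small_pw k1 (divr_gt0 e0 N1).
exists h => // p pp mp.
apply: le_lt_trans (psum_close h0 N0 k3 JX _ tT pp mp) _ => //.
rewrite subr0 mulrAC; apply: (@le_lt_trans _ _ (N * t * (e / (N * t + 1)))).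
  by rewrite ler_wpM2l// mulr_ge0.
by rewrite mulrA ltr_pdivrMr// mulrC ltr_pM2l// ltrDl.
Qed.

(** The sums converge along all partitions, hence along a fine partition
   of [0, s] continued by dyadic partitions of [s, t], for which
   [dyadic_sewing] compares the contribution of [s, t] with Xi s t. *)
Lemma expansion_of_sewn T kappa Xi K s t v w : 3^-1 < kappa -> 0 <= K ->
  (forall s u t, simplex T s u -> simplex T u t ->
     `|Xi s t - Xi s u - Xi u t| <= K * pw kappa s t ^+ 3) ->
  simplex T s t -> s < t -> is_sewn Xi 0 s v -> is_sewn Xi 0 t w ->
  `|w - v - Xi s t| <= K / (1 - half_rate kappa) * pw kappa s t ^+ 3.
Proof.
move=> k3 K0 dX st lt_st /is_sewnP hv /is_sewnP hw; apply/ler_addgt0Pr => e e0.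
have e2 : 0 < e / 2 by rewrite divr_gt0.
have [r1 r10 h1] := hv _ e2; have [r2 r20 h2] := hw _ e2.
have [s0 _ tT] := st.
have r0 : 0 < Num.min r1 r2 by rewrite lt_min r10.
have [p pp mp] := fine_partition r0 s0.
have [n ne] := small_mesh s t r20.
have lp : last 0 p = s by have [_ /eqP] := pp.
have {}h1 : `|psum Xi 0 p - v| < e / 2.
  by apply: h1 => // q qs; apply: lt_le_trans (mp q qs) _; rewrite ge_min lexx.
have a2 := h2 (p ++ dyadic n s t) (itv_partition_cat pp (dyadic_partition n lt_st)).
have {}a2 : `|psum Xi 0 (p ++ dyadic n s t) - w| < e / 2.
  apply: a2; apply: mesh_cat => [q qs|q qs].
    by apply: lt_le_trans (mp q qs) _; rewrite ge_min lexx orbT.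
  by rewrite lp dyadic_mesh.
rewrite psum_cat lp in a2.
have a3 := dyadic_sewing n k3 K0 dX st.
set D := psum Xi s _ in a2 a3; set P := psum Xi 0 p in h1 a2.
have -> : w - v - Xi s t = (D - Xi s t) + (P - v) - (P + D - w) by ring.
apply: le_trans (ler_normB _ _) _.
have := ler_normD (D - Xi s t) (P - v); lra.
Qed.

End partition_sums.

(** * Controlled solutions and Davie solutions *)

Section rough_differential_equation.
Context {R : realType} {d k m : nat}.
Variables (T alpha kappa : R) (T0 : 0 < T).
Hypotheses (k3 : 3^-1 < kappa) (ka : kappa < alpha) (k2 : kappa <= 2^-1).
Variables (zeta : R -> 'cV[R]_d) (zeta2 : R -> R -> 'M[R]_d).
Hypotheses (hzeta : hoelder1 T alpha zeta) (hzeta2 : levy_area T alpha zeta zeta2).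
Variables (U : control_space R k) (eps L : R) (eps0 : 0 < eps) (L0 : 0 < L).
Variable gamma : R -> P2 U.
Hypothesis gammaL : forall s t, 0 <= s <= T -> 0 <= t <= T ->
  (W2 (gamma s) (gamma t) <= (L * `|t - s| `^ eps)%:E)%E.
Variable b : R -> 'cV[R]_m -> U -> 'cV[R]_m.
Hypotheses (hb : Cb011 T b) (hbu : unif_continuous_time T b).
Variable sigma : R -> 'cV[R]_m -> 'M[R]_(m, d).
Hypothesis hsigma : Cb T 1 3 sigma.
Variable y : 'cV[R]_m.
Implicit Types (s t u v c : R) (x z : R -> 'cV[R]_m).

Let k0 : 0 < kappa. Proof. by apply: lt_trans k3; rewrite invr_gt0. Qed.

Let sig (i : 'I_m) (l : 'I_d) t (p : 'cV[R]_m) : R := sigma t p i l.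

Let ssig i l : smooth T 3 (sig i l). Proof. exact: Cb_smooth. Qed.

Notation A := (davie_step zeta zeta2 sig).
Notation S := (first_step zeta sig).
Notation B := (mean_drift gamma b).

(** Hoelder regularity of order alpha > kappa is only used with exponent
   kappa. *)
Lemma zeta_kappa : exists2 C, 0 <= C & forall s t, simplex T s t ->
  `|zeta t - zeta s| <= C * pw kappa s t /\ `|zeta2 s t| <= C * pw kappa s t ^+ 2.
Proof.
have [C1 h1] := hzeta; have [[_ _ [C2 h2]] _ _] := hzeta2.
have n1 := powR_ge0 T (alpha - kappa); have n2 := powR_ge0 T (2 * alpha - 2 * kappa).
have [kp ka'] := conj k0 ka.
have m1 : 0 <= `|C1| * T `^ (alpha - kappa) by rewrite mulr_ge0.
have m2 : 0 <= `|C2| * T `^ (2 * alpha - 2 * kappa) by rewrite mulr_ge0.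
exists (`|C1| * T `^ (alpha - kappa) + `|C2| * T `^ (2 * alpha - 2 * kappa)).
  by rewrite addr_ge0.
move=> s t [s0 st tT].
have L1 : 0 <= t - s by rewrite subr_ge0.
have L2 : t - s <= T by lra.
split; rewrite [leRHS]mulrDl.
  apply: (@le_trans _ _ (`|C1| * T `^ (alpha - kappa) * pw kappa s t)); last first.
    rewrite lerDl; apply: mulr_ge0; [exact: m2|exact: pw_ge0].
  apply: le_trans (h1 s t _ _) _; first by rewrite s0 (le_trans st).
    by rewrite tT (le_trans s0).
  rewrite ger0_norm// -mulrA.
  apply: le_trans (ler_wpM2r (powR_ge0 _ _) (ler_norm C1)) _; rewrite ler_wpM2l//.
  by apply: powR_le_scaled => //; exact: ltW.
apply: (@le_trans _ _ (`|C2| * T `^ (2 * alpha - 2 * kappa) * pw kappa s t ^+ 2)); last first.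
  rewrite lerDr; apply: mulr_ge0; [exact: m1|by rewrite exprn_ge0// pw_ge0].
apply: le_trans (h2 s t s0 st tT) _; rewrite ger0_norm// -mulrA.
apply: le_trans (ler_wpM2r (powR_ge0 _ _) (ler_norm C2)) _; rewrite ler_wpM2l//.
rewrite /pw -powRMn//; apply: powR_le_scaled => //; lra.
Qed.

Lemma step_germ : rough_germ T kappa A S.
Proof.
have [C C0 hC] := zeta_kappa; have [[cz _ _] chen _] := hzeta2.
apply: (davie_step_germ k0 k2 ssig _ C0) => //.
- by move=> s u t [s0 su uT] [_ ut tT] i j; exact: chen.
- by move=> s t st; have [] := hC s t st.
- by move=> s t st; have [] := hC s t st.
Qed.

Lemma coordB (p q : 'cV[R]_m) i : (p - q) i 0 = p i 0 - q i 0.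
Proof. by rewrite !mxE. Qed.

Definition holder_path n (x : R -> 'cV[R]_n) : Prop :=
  exists2 c, 0 <= c & forall s t, simplex T s t -> `|x t - x s| <= c * pw kappa s t.

Lemma holder_path_dist n (x : R -> 'cV[R]_n) : holder_path x -> exists2 c, 0 <= c &
  forall s t, 0 <= s <= T -> 0 <= t <= T -> `|x t - x s| <= c * `|t - s| `^ kappa.
Proof.
move=> [c c0 hc]; exists c => // s t /andP[s0 sT] /andP[t0 tT].
have [st|/ltW ts] := leP s t.
  by rewrite (@ger0_norm _ (t - s)) ?subr_ge0//; exact: hc.
by rewrite distrC (distrC t) (@ger0_norm _ (s - t)) ?subr_ge0//; exact: hc.
Qed.

Lemma path_drift_continuous x i : holder_path x ->
  {within `[0, T], continuous (fun s => B s (x s) i 0)}.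
Proof.
move=> /holder_path_dist[c c0 hc].
have [C C0 hC] := mean_drift_lipschitz gamma hb.
apply/subspace_continuousP => s /= sT'.
have sT : 0 <= s <= T by move: sT'; rewrite in_itv.
apply/cvgrPdist_le => e e0; rewrite near_withinE.
have e2 : 0 < e / 2 by rewrite divr_gt0.
have [r r0 hr] := mean_drift_time_continuous eps0 L0 gammaL hb hbu (x s) sT e2.
have Cc : 0 < C * c + 1 by rewrite ltr_wpDl// mulr_ge0.
have [h /andP[h0 _] hh] := small_pw k0 (divr_gt0 e2 Cc).
have := nbhsx_ballx s (Num.min r h); rewrite lt_min r0 h0 => /(_ isT).
apply: filterS => u; rewrite /ball/= lt_min => /andP[ur uh].
rewrite in_itv/= => uT.
have -> : B s (x s) i 0 - B u (x u) i 0 =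
   - ((B u (x u) - B u (x s)) + (B u (x s) - B s (x s))) i 0 by rewrite !mxE; ring.
rewrite normrN; apply: le_trans (coord_le_norm _ _ _) _.
apply: le_trans (ler_normD _ _) _.
have -> : e = e / 2 + e / 2 by lra.
apply: lerD; last by apply: hr => //; rewrite distrC.
apply: le_trans (hC _ _ _ uT) _.
apply: (@le_trans _ _ (C * (c * (e / 2 / (C * c + 1))))).
  rewrite ler_wpM2l//; apply: le_trans (hc _ _ sT uT) _; rewrite ler_wpM2l//.
  apply: le_trans hh; apply: ge0_ler_powR; rewrite ?nnegrE ?(ltW k0) ?(ltW h0)//.
  by rewrite distrC ltW.
rewrite mulrA mulrA ler_pdivrMr// mulrC ler_wpM2l ?(ltW e2)// lerDl//.
Qed.

Notation Dr := (drift gamma b).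

Lemma drift0_eq x : Dr x 0 = 0.
Proof. by apply/matrixP => i j; rewrite !mxE set_itv1 Rintegral_set1. Qed.

Lemma driftE x t i : Dr x t i 0 =
  \int[@lebesgue_measure R]_(s in `[0, t]) B s (x s) i 0.
Proof. by rewrite mxE; apply: eq_Rintegral => s _; rewrite mxE. Qed.

Lemma drift_lipschitz x : holder_path x -> lipschitz_drift T (Dr x).
Proof.
move=> hx; have [M M0 hM] := mean_drift_bounded gamma hb.
exists M => // s t st; have [s0 st' tT] := st.
apply: cv_norm_le => [|i]; first by rewrite mulr_ge0// subr_ge0.
rewrite (coordB (Dr x t)) (driftE x t) (driftE x s); apply: (Rintegral_increment_bound st (path_drift_continuous (i := i) hx)).
move=> u /andP[su ut]; apply: le_trans (coord_le_norm _ _ _) _; apply: hM.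
by rewrite (le_trans s0)// (le_trans ut).
Qed.

Lemma drift_diff_bound : exists2 C, 0 <= C & forall x z s t V,
  holder_path x -> holder_path z -> simplex T s t ->
  (forall u, s <= u <= t -> `|x u - z u| <= V) ->
  `|(Dr x t - Dr x s) - (Dr z t - Dr z s)| <= C * V * (t - s).
Proof.
have [C C0 hC] := mean_drift_lipschitz gamma hb; exists C => // x z s t V hx hz st xz.
have [s0 st' tT] := st.
have V0 : 0 <= V by apply: le_trans (xz s _); rewrite ?lexx.
apply: cv_norm_le => [|i]; first by rewrite !mulr_ge0// subr_ge0.
have coordE (a c e f : 'cV[R]_m) (a' c' e' f' : R) : a i 0 = a' -> c i 0 = c' ->
    e i 0 = e' -> f i 0 = f' -> (a - c - (e - f)) i 0 = a' - e' - (c' - f').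
  by move=> <- <- <- <-; rewrite !mxE; ring.
rewrite (coordE _ _ _ _ _ _ _ _ (driftE x t i) (driftE x s i) (driftE z t i) (driftE z s i)).
have cx := path_drift_continuous (i := i) hx; have cz := path_drift_continuous (i := i) hz.
have cxz : {within `[0, T], continuous (fun s => B s (x s) i 0 - B s (z s) i 0)}.
  move=> u; apply: cvgB; [exact: cx|exact: cz].
rewrite -!RintegralB//; try by apply: (continuous_integrable (T := T)) => //; exact: le_trans tT.
apply: (Rintegral_increment_bound st cxz) => u /andP[su ut].
rewrite -coordB.
apply: le_trans (coord_le_norm _ _ _) _.
apply: le_trans (hC _ _ _ _) _; first by rewrite (le_trans s0)// (le_trans ut).
by rewrite ler_wpM2l// xz// su.
Qed.

Lemma first_stepE s t p : S s t p = sigma s p *m (zeta t - zeta s).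
Proof. by apply/matrixP => i j; rewrite !mxE ord1; apply: eq_bigr => l _; rewrite !mxE. Qed.

(** The compensated Riemann sums of the rough integral are sums of the germ as
   soon as the derivative of x is sigma(u, x u). *)
Lemma rough_integrandE x (x' : R -> 'M[R]_(m, d)) i u v : 0 <= u <= T ->
  x' u = sigma u (x u) ->
  \sum_(l < d) sigma_path sigma x i u l 0 * (zeta v - zeta u) l 0 +
  \sum_(l < d) \sum_(q < d) sigma_path' sigma x x' i u l q * zeta2 u v q l =
  A u v (x u) i 0.
Proof.
move=> uT x'u; rewrite mxE [X in _ = X + _]mxE [X in _ = _ + X]mxE; congr (_ + _).
  by apply: eq_bigr => l _; rewrite [sigma_path _ _ _ _ _ _]mxE.
apply: eq_bigr => l _; apply: eq_bigr => q _; congr (_ * _).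
rewrite mxE /sig2; apply: eq_bigr => j _; rewrite x'u; congr (_ * _).
have [_ /(_ j)[df _]] := hsigma.
by rewrite /partial_x derive_mx ?mxE//; exact: df.
Qed.

Lemma is_rough_integralE x (x' : R -> 'M[R]_(m, d)) i t v : 0 <= t <= T ->
  (forall u, 0 <= u <= T -> x' u = sigma u (x u)) ->
  is_rough_integral zeta zeta2 (sigma_path sigma x i) (sigma_path' sigma x x' i) 0 t v
  <-> is_sewn (fun u v => A u v (x u) i 0) 0 t v.
Proof.
move=> /andP[t0 tT] hx'.
pose Xi u v := \sum_(l < d) sigma_path sigma x i u l 0 * (zeta v - zeta u) l 0 +
  \sum_(l < d) \sum_(q < d) sigma_path' sigma x x' i u l q * zeta2 u v q l.
have -> : is_rough_integral zeta zeta2 (sigma_path sigma x i) (sigma_path' sigma x x' i) 0 t v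
    = is_sewn Xi 0 t v.
  rewrite /is_rough_integral /is_sewn.
  have -> : (fun p => rough_sum zeta zeta2 (sigma_path sigma x i)
      (sigma_path' sigma x x' i) 0 p) = (fun p => psum Xi 0 p) => [|//].
  by apply/funext => p; exact: (big_psum Xi).
have E p : itv_partition 0 t p -> psum Xi 0 p = psum (fun u v => A u v (x u) i 0) 0 p.
  apply: (eq_psum (T := T)) => // u w uw; apply: rough_integrandE; first exact: simplexL uw.
  by apply: hx'; exact: simplexL uw.
split=> /is_sewnP h; apply/is_sewnP => e e0; have [r r0 hr] := h e e0;
  exists r => // p pp mp; have := hr p pp mp; by rewrite E.
Qed.

(** The path J = x - y - drift is the rough integral, that is the limit of the sums of
   the germ along x. Being controlled with derivative sigma is
   exactly the compatibility required by [germ_defect], so the sums converge at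
   the rate given by sewing, and J has the germ as its local expansion. *)
Lemma davie_of_solution x (x' : R -> 'M[R]_(m, d)) :
  controlled T kappa zeta x x' -> solves T zeta zeta2 gamma b sigma y x x' ->
  [/\ x 0 = y, holder_path x & davie_solution T kappa A x (Dr x)].
Proof.
move=> [[c1 h1] _ [_ _ [c2 h2]]] sol.
have hx : holder_path x.
  exists `|c1| => // s t st; have [_ st' _] := st.
  apply: le_trans (h1 s t (simplexL st) (simplexR st)) _.
  by rewrite ger0_norm ?subr_ge0// ler_wpM2r ?powR_ge0// ler_norm.
have x'E u : 0 <= u <= T -> x' u = sigma u (x u) by move=> uT; have [] := sol u uT.
have germ := step_germ.
have [K K0 hK] := germ_defect germ (normr_ge0 c2).
pose J t := x t - y - Dr x t.
have sewn t i : 0 <= t <= T -> is_sewn (fun u v => A u v (x u) i 0) 0 t (J t i 0).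
  move=> tT; have [[I [hI xE]] _] := sol t tT.
  have -> : J t = I by rewrite /J xE; apply/matrixP => a c; rewrite !mxE; ring.
  exact: (is_rough_integralE i _ tT x'E).1 (hI i).
have defect i s u t : simplex T s u -> simplex T u t ->
    `|A s t (x s) i 0 - A s u (x s) i 0 - A u t (x u) i 0| <= K * pw kappa s t ^+ 3.
  move=> su ut; rewrite -!coordB; apply: le_trans (coord_le_norm _ _ _) _.
  apply: hK => //; rewrite first_stepE -x'E ?(simplexL su)//.
  have [s0 su' uT] := su; apply: le_trans (h2 s u s0 su' uT) _.
  rewrite ger0_norm ?subr_ge0// powRMn ?subr_ge0//.
  by rewrite ler_wpM2r ?exprn_ge0 ?powR_ge0// ler_norm.
have T00 : 0 <= (0 : R) <= T by apply/andP; split => //; exact: ltW.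
have x0 : x 0 = y.
  have J0 : J 0 = 0.
    apply/matrixP => i j; rewrite ord1 [RHS]mxE; apply/eqP; rewrite -normr_le0.
    apply/ler_addgt0Pr => e e0; rewrite add0r.
    have /is_sewnP/(_ e e0)[r r0 hr] := sewn 0 i T00.
    have := hr [::]; rewrite /= sub0r normrN => h; exact/ltW/h.
  by apply: subr0_eq; rewrite -[RHS]J0 /J drift0_eq subr0.
split=> //.
pose N := K / (1 - half_rate kappa).
have N0 : 0 <= N by rewrite divr_ge0// subr_ge0 ltW// half_rate_lt1.
exists N => // s t st; have [s0 st' tT] := st.
have [<-|snt] := eqVneq s t.
  rewrite /davie_rem (germ_diag k3 germ) ?(simplexL st)// !subrr normr0.
  by rewrite mulr_ge0// exprn_ge0// pw_ge0.
have lt_st : s < t by rewrite lt_neqAle snt.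
apply: cv_norm_le => [|i]; first by rewrite mulr_ge0// exprn_ge0// pw_ge0.
have := expansion_of_sewn k3 K0 (defect i) st lt_st (sewn s i (simplexL st)) (sewn t i (simplexR st)).
congr (`|_| <= _); rewrite /davie_rem /J.
by move: (Dr x t) (Dr x s) (A s t (x s)) => D1 D2 a; rewrite !mxE; ring.
Qed.

Lemma mulmx_norm p q (M : 'M[R]_(p, q)) (v : 'cV[R]_q) :
  `|M *m v| <= q%:R * (`|M| * `|v|).
Proof.
apply: cv_norm_le => [|i]; first by rewrite !mulr_ge0.
rewrite mxE; apply: ler_norm_sum_ord => j.
by rewrite normrM ler_pM// coord_le_norm.
Qed.

Lemma sigma_bounded : exists2 K, 0 <= K & forall t p, 0 <= t <= T -> `|sigma t p| <= K.
Proof.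
have [K K0 hK] : exists2 K, 0 <= K & forall i l t p, 0 <= t <= T -> `|sig i l t p| <= K.
  apply: (@sig_common_bound _ _ _ (fun i l K => forall t p, 0 <= t <= T -> `|sig i l t p| <= K)).
    by move=> i l K K' KK' h t p tT; apply: le_trans (h t p tT) KK'.
  by move=> i l; have [] := ssig i l.
by exists K => // t p tT; apply: norm_le_coord => // i l; exact: hK.
Qed.

Lemma sigma_path_holder x : holder_path x -> exists2 c, 0 <= c & forall s t,
  0 <= s <= T -> 0 <= t <= T ->
  `|sigma t (x t) - sigma s (x s)| <= c * `|t - s| `^ kappa.
Proof.
move=> /holder_path_dist[c c0 hc]; have [c1 c10 h1] := time_le_pw2 T k0 k2.
have [K K0 hK] : exists2 K, 0 <= K & forall i l s t p q, 0 <= s <= T -> 0 <= t <= T ->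
    `|sig i l t q - sig i l s p| <= K * (`|t - s| + `|q - p|).
  apply: (@sig_common_bound _ _ _ (fun i l K => forall s t p q, 0 <= s <= T -> 0 <= t <= T ->
    `|sig i l t q - sig i l s p| <= K * (`|t - s| + `|q - p|))).
    move=> i l K K' KK' h s t p q sT tT; apply: le_trans (h s t p q sT tT) _.
    by rewrite ler_wpM2r// addr_ge0.
  move=> i l; have [_ [K1 hK1] _] := ssig i l.
  have [K2 K20 hK2] := smooth_lipschitz (smoothW (smoothW (ssig i l))).
  exists (`|K1| + K2) => s t p q sT tT.
  rewrite -(subrK (sig i l s q) (sig i l t q)) -addrA.
  apply: le_trans (ler_normD _ _) _.
  have e1 := hK1 s t q sT tT; have e2 := hK2 s p q sT.
  have e3 := ler_wpM2r (normr_ge0 (t - s)) (ler_norm K1).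
  have e4 : 0 <= `|K1| * `|q - p| by rewrite mulr_ge0.
  have e5 : 0 <= K2 * `|t - s| by rewrite mulr_ge0.
  rewrite mulrDl !mulrDr; lra.
have Tk := powR_ge0 T kappa.
exists (K * (c1 * T `^ kappa + c)); first by rewrite mulr_ge0 ?addr_ge0 ?mulr_ge0.
move=> s t sT tT; apply: norm_le_coord => [|i l].
  by rewrite mulr_ge0 ?powR_ge0 ?mulr_ge0 ?addr_ge0 ?mulr_ge0.
rewrite !mxE; apply: le_trans (hK i l s t (x s) (x t) sT tT) _.
rewrite -mulrA ler_wpM2l// mulrDl; apply: lerD; last exact: hc.
have ord u v : 0 <= u -> u <= v -> v <= T -> v - u <= c1 * T `^ kappa * (v - u) `^ kappa.
  move=> u0 uv vT; apply: le_trans (h1 u v u0 uv vT) _.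
  by rewrite expr2 mulrA ler_wpM2r ?powR_ge0// ler_wpM2l// pw_le// ltW.
move: sT tT => /andP[s0 sT] /andP[t0 tT]; have [st|/ltW ts] := leP s t.
  by rewrite (@ger0_norm _ (t - s)) ?subr_ge0//; exact: ord.
by rewrite (distrC t) (@ger0_norm _ (s - t)) ?subr_ge0//; exact: ord.
Qed.

(** The remainder is of order 2 kappa by assumption; what is left is
   its joint continuity, which follows from the Hoelder continuity of x, zeta and
   sigma(., x). *)
Lemma first_order_controlled x : holder_path x ->
  (exists2 c, 0 <= c & forall s t, simplex T s t ->
    `|x t - x s - S s t (x s)| <= c * pw kappa s t ^+ 2) ->
  controlled T kappa zeta x (fun t => sigma t (x t)).
Proof.
move=> hx [c c0 hc]; have [c1 c10 h1] := holder_path_dist hx.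
have [c2 c20 h2] := sigma_path_holder hx; have [K K0 hK] := sigma_bounded.
have [C C0 hC] := zeta_kappa.
have hz : holder_path zeta.
  by exists C => // s t st; have [] := hC s t st.
split; first by exists c1.
  by exists c2.
split=> [||].
- have [C' C'0 hz'] := holder_path_dist hz.
  pose Tk := T `^ kappa; have Tk0 : 0 <= Tk := powR_ge0 _ _.
  pose dR : R := d%:R; have d0 : 0 <= dR := ler0n _ _.
  pose Q := 2 * c1 + dR * (K * (2 * C')) + dR * (c2 * (C * Tk)).
  have Q0 : 0 <= Q by rewrite /Q !addr_ge0 ?mulr_ge0.
  have Q1 : 0 < Q + 1 by rewrite ltr_wpDl.
  apply/subspace_continuousP => -[s t] /= [s0 [st tT]].
  have sT' : 0 <= s <= T by rewrite s0 (le_trans st).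
  have tT' : 0 <= t <= T by rewrite tT (le_trans s0).
  apply/cvgrPdist_le => e e0; rewrite near_withinE.
  have [h /andP[h0 _] hh] := small_pw k0 (divr_gt0 e0 Q1).
  have nb : nbhs (s, t) [set w : R * R | ball s h w.1 /\ ball t h w.2].
    exists (ball s h, ball t h); first by split; exact: nbhsx_ballx.
    by move=> w [].
  apply: filterS nb => -[s' t'] /= [bs bt] [s'0 [st' t'T]].
  have sT1 : 0 <= s' <= T by rewrite s'0 (le_trans st').
  have tT1 : 0 <= t' <= T by rewrite t'T (le_trans s'0).
  have om (u v : R) : ball u h v -> `|v - u| `^ kappa <= e / (Q + 1).
    rewrite /ball/= distrC => uv; apply: le_trans hh.
    by apply: ge0_ler_powR; rewrite ?nnegrE ?(ltW k0) ?(ltW h0)// ltW.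
  pose om1 := e / (Q + 1); have om0 : 0 <= om1 by rewrite divr_ge0// ltW.
  have x1 : `|x t' - x t| <= c1 * om1.
    by apply: le_trans (h1 _ _ tT' tT1) _; rewrite ler_wpM2l// om.
  have x2 : `|x s' - x s| <= c1 * om1.
    by apply: le_trans (h1 _ _ sT' sT1) _; rewrite ler_wpM2l// om.
  have z1 : `|zeta t' - zeta t| <= C' * om1.
    by apply: le_trans (hz' _ _ tT' tT1) _; rewrite ler_wpM2l// om.
  have z2 : `|zeta s' - zeta s| <= C' * om1.
    by apply: le_trans (hz' _ _ sT' sT1) _; rewrite ler_wpM2l// om.
  have g1 : `|sigma s' (x s') - sigma s (x s)| <= c2 * om1.
    by apply: le_trans (h2 _ _ sT' sT1) _; rewrite ler_wpM2l// om.
  have st1 : simplex T s t by split.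
  have z3 : `|zeta t - zeta s| <= C * Tk.
    have [z _] := hC s t st1; apply: le_trans z _.
    by apply: ler_wpM2l => //; apply: pw_le => //; exact: ltW.
  have g2 := hK s' (x s') sT1.
  rewrite /from_subspace distrC.
  have -> : x t' - x s' - sigma s' (x s') *m (zeta t' - zeta s')
      - (x t - x s - sigma s (x s) *m (zeta t - zeta s)) =
    ((x t' - x t) - (x s' - x s))
    - (sigma s' (x s') *m ((zeta t' - zeta t) - (zeta s' - zeta s))
       + (sigma s' (x s') - sigma s (x s)) *m (zeta t - zeta s)).
    rewrite !mulmxBr !mulmxBl.
    move: (sigma s' _ *m _) (sigma s' _ *m _) (sigma s' _ *m _) (sigma s' _ *m _)
      (sigma s _ *m _) (sigma s _ *m _) => a1 a2 a3 a4 a5 a6.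
    by apply/matrixP => i j; rewrite !mxE; ring.
  apply: (@le_trans _ _ (Q * om1)); last first.
    by rewrite /om1 mulrA ler_pdivrMr// mulrC ler_wpM2l ?(ltW e0)// lerDl.
  apply: (@le_trans _ _ ((c1 * om1 + c1 * om1) + (dR * (K * (C' * om1 + C' * om1))
      + dR * ((c2 * om1) * (C * Tk))))); last first.
    by rewrite le_eqVlt; apply/orP; left; apply/eqP; rewrite /Q; ring.
  apply: le_trans (ler_normB _ _) _; apply: lerD.
    by apply: le_trans (ler_normB _ _) _; exact: lerD.
  apply: le_trans (ler_normD _ _) _; apply: lerD.
    apply: le_trans (mulmx_norm _ _) _; rewrite ler_wpM2l// ler_pM//.
    by apply: le_trans (ler_normB _ _) _; exact: lerD.
  by apply: le_trans (mulmx_norm _ _) _; rewrite ler_wpM2l// ler_pM.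
- by move=> t _; rewrite !subrr mulmx0 subr0.
- exists c => s t s0 st tT; have := hc s t (And3 s0 st tT).
  by rewrite first_stepE /pw powRMn ?subr_ge0// ger0_norm ?subr_ge0.
Qed.

(** The drift G of the limit of the Euler schemes has derivative B(t, x t), hence
   is the drift of x; with this the Davie expansion turns into the rough
   integral equation. *)
Lemma solution_exists : exists x (x' : R -> 'M[R]_(m, d)),
  controlled T kappa zeta x x' /\ solves T zeta zeta2 gamma b sigma y x x'.
Proof.
have germ := step_germ.
have [M M0 hM] := mean_drift_bounded gamma hb.
have [C C0 hC] := mean_drift_lipschitz gamma hb.
have hcont t p e := @mean_drift_time_continuous _ _ _ _ _ _ _ _ _ eps0 L0 gammaL hb hbu t p e.
have [x [G [x0 G0 dx lG exp]]] := davie_exists T0 k3 k2 germ M0 hM C0 hC hcont y.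
have hx : holder_path x by exact: (davie_bounded k3 k2 germ dx lG).
have GE t : 0 <= t <= T -> G t = Dr x t.
  move=> tT; apply/matrixP => i j; rewrite ord1 driftE; apply/esym.
  have [M' M'0 hM'] := lG.
  apply: (Rintegral_of_expansion (F := fun u => G u i 0) (M := M') T0 (path_drift_continuous (i := i) hx)) => //.
  - by rewrite G0 mxE.
  - move=> s u su; rewrite -coordB; apply: le_trans (coord_le_norm _ _ _) _; exact: hM'.
  - move=> s e sT e0; have [r r0 hr] := exp s e sT e0; exists r => // u uT us.
    have := coord_le_norm (G u - G s - (u - s) *: B s (x s)) i 0.
    rewrite !mxE => h; apply: le_trans h _; exact: hr.
exists x, (fun t => sigma t (x t)); split.
  by apply: first_order_controlled => //; exact: (first_order_remainder k3 k2 germ dx lG).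
move=> t tT; split=> //; exists (x t - y - G t); split; last first.
  by rewrite GE// addrCA addrC; apply/matrixP => i j; move: (Dr x t) => D; rewrite !mxE; ring.
move=> i; apply: (is_rough_integralE i _ tT _).2 => //.
have [N N0 hN] := dx.
have := @sewn_of_expansion _ T kappa (fun u v => A u v (x u) i 0) (fun u => (x u - G u) i 0) N t N0 k3.
rewrite x0 G0 subr0.
have -> : (x t - G t) i 0 - y i 0 = (x t - y - G t) i 0 by rewrite !mxE; ring.
apply=> // u v uv.
have -> : (x v - G v) i 0 - (x u - G u) i 0 - A u v (x u) i 0 = davie_rem A x G u v i 0.
  by rewrite /davie_rem; move: (A u v (x u)) => a; rewrite !mxE; ring.
by apply: le_trans (coord_le_norm _ _ _) _; exact: hN.
Qed.

Lemma solution_unique x (x' : R -> 'M[R]_(m, d)) z (z' : R -> 'M[R]_(m, d)) :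
  controlled T kappa zeta x x' -> solves T zeta zeta2 gamma b sigma y x x' ->
  controlled T kappa zeta z z' -> solves T zeta zeta2 gamma b sigma y z z' ->
  forall t, 0 <= t <= T -> z t = x t /\ z' t = x' t.
Proof.
move=> cx sx cz sz.
have [x0 hx dx] := davie_of_solution cx sx; have [z0 hz dz] := davie_of_solution cz sz.
have [C C0 hC] := drift_diff_bound.
have zx t : 0 <= t <= T -> z t = x t.
  apply: (davie_unique k3 k2 step_germ dz dx (drift_lipschitz hz) (drift_lipschitz hx) C0).
    by move=> s u V su zx; exact: (hC z x s u V hz hx su zx).
  by rewrite z0 x0.
by move=> t tT; split; [exact: zx|rewrite (sz t tT).2 (sx t tT).2 zx].
Qed.

End rough_differential_equation.

Theorem corollary3p11 (R : realType) (d k m : nat) (T alpha : R)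
    (hT : 0 < T) (halpha : 3^-1 < alpha)
    (zeta : R -> 'cV[R]_d) (zeta2 : R -> R -> 'M[R]_d)
    (hzeta : hoelder1 T alpha zeta) (hzeta0 : zeta 0 = 0)
    (hzeta2 : levy_area T alpha zeta zeta2)
    (U : control_space R k) (K : set (P2 U)) (hK : compact K)
    (eps L : R) (heps : 0 < eps) (hL : 0 < L)
    (gamma : R -> P2 U) (hgamma : relaxed_control T K eps L gamma)
    (b : R -> 'cV[R]_m -> U -> 'cV[R]_m)
    (hb : Cb011 T b) (hbu : unif_continuous_time T b)
    (sigma : R -> 'cV[R]_m -> 'M[R]_(m, d)) (hsigma : Cb T 1 3 sigma)
    (y : 'cV[R]_m)
    (kappa : R) (hkappa : 3^-1 < kappa < alpha) (hkappa2 : kappa <= 2^-1) :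
  exists (x : R -> 'cV[R]_m) (x' : R -> 'M[R]_(m, d)),
    [/\ controlled T kappa zeta x x',
        solves T zeta zeta2 gamma b sigma y x x' &
        forall (z : R -> 'cV[R]_m) (z' : R -> 'M[R]_(m, d)),
          controlled T kappa zeta z z' ->
          solves T zeta zeta2 gamma b sigma y z z' ->
          forall t, 0 <= t <= T -> z t = x t /\ z' t = x' t].
Proof.
have [k3 ka] := andP hkappa; have [_ gammaL] := hgamma.
have [x [x' [cx sx]]] :=
  solution_exists hT k3 ka hkappa2 hzeta hzeta2 heps hL gammaL hb hbu hsigma y.
exists x, x'; split=> // z z' cz sz.
exact: (solution_unique hT k3 ka hkappa2 hzeta hzeta2 heps hL gammaL hb hbu hsigma cx sx cz sz).
Qed.
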